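(* For every $N\ge 1$ there exists a surjective homomorphism of algebras $\mathcal E\to S\ddot H_N$, where the parameters $q,v$ of the spherical double affine Hecke algebra $S\ddot H_N$ are related to the parameters $q_1,q_3$ of $\mathcal E$ by $q=q_1$, $v^2=q_3^{-1}$.
   Context: The algebra $\mathcal E$ (quantum continuous $\mathfrak{gl}_\infty$). Here it is taken over the field $\mathbb C(q,v)$ with parameters $q_1=q$, $q_3=v^{-2}$, $q_2=q_1^{-1}q_3^{-1}$. Put $g(z,w)=(z-q_1w)(z-q_2w)(z-q_3w)$. $\mathcal E$ is the unital associative algebra generated by $e_i,f_i$ ($i\in\mathbb Z$), $\psi^+_j,\psi^-_{-j}$ ($j>0$) and $(\psi_0^{\pm})^{\pm1}$. With $e(z)=\sum_{i\in\mathbb Z}e_iz^{-i}$, $f(z)=\sum_{i\in\mathbb Z}f_iz^{-i}$, $\psi^\pm(z)=\sum_{\pm i\ge0}\psi^\pm_iz^{-i}$, $\delta(z)=\sum_{n\in\mathbb Z}z^n$, the defining relations (understood coefficientwise) are $$g(z,w)e(z)e(w)=-g(w,z)e(w)e(z),\quad g(w,z)f(z)f(w)=-g(z,w)f(w)f(z),$$ $$g(z,w)\psi^\pm(z)e(w)=-g(w,z)e(w)\psi^\pm(z),\quad g(w,z)\psi^\pm(z)f(w)=-g(z,w)f(w)\psi^\pm(z),$$ $$[e(z),f(w)]=\frac{\delta(z/w)}{g(1,1)}(\psi^+(z)-\psi^-(z)),\quad [\psi^\pm_i,\psi^\pm_j]=0,\ [\psi^\pm_i,\psi^\mp_j]=0,$$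 $$\psi^\pm_0(\psi^\pm_0)^{-1}=(\psi^\pm_0)^{-1}\psi^\pm_0=1,\quad [e_0,[e_1,e_{-1}]]=0,\quad [f_0,[f_1,f_{-1}]]=0.$$ The double affine Hecke algebra $\ddot H_N$ of type $GL_N$ is the unital $\mathbb C(q,v)$-algebra generated by invertible elements $T_i^{\pm1}$ ($1\le i\le N-1$), $X_j^{\pm1},Y_j^{\pm1}$ ($1\le j\le N$) with relations $(T_i+v^{-1})(T_i-v)=0$; $T_iT_{i+1}T_i=T_{i+1}T_iT_{i+1}$; $T_iT_k=T_kT_i$ if $|i-k|>1$; $X_jX_k=X_kX_j$; $Y_jY_k=Y_kY_j$; $T_iX_iT_i=X_{i+1}$; $T_i^{-1}Y_iT_i^{-1}=Y_{i+1}$; $T_iX_k=X_kT_i$ and $T_iY_k=Y_kT_i$ if $k\ne i,i+1$; $Y_1X_1\cdots X_N=qX_1\cdots X_NY_1$; $X_1^{-1}Y_2=Y_2X_1^{-1}T_1^{-2}$. Let $S=\frac1{[N]!}\sum_{w\in\mathfrak S_N}v^{l(w)}T_w\in\ddot H_N$, where $T_w=T_{i_1}\cdots T_{i_r}$ for a reduced decomposition $w=s_{i_1}\cdots s_{i_r}$, $s_i=(i,i+1)$, $l(w)$ is the length, $[N]!=\prod_{i=1}^N[i]$, $[i]=\frac{v^{2i}-1}{v^2-1}$. $S$ is an idempotent and $S\ddot H_N=S\ddot H_NS$ (spherical DAHA), with unit $S$. *)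

(* Defs.v *)
From HB Require Import structures.
From mathcomp Require Import all_boot all_order all_algebra all_fingroup.
From mathcomp Require Import generic_quotient ring_quotient fraction.
From mathcomp Require Import boolp classical_sets reals complex.
From mathcomp Require Import monalg.

Set Implicit Arguments.
Unset Strict Implicit.
Unset Printing Implicit Defensive.

Import GRing.Theory.

Local Open Scope ring_scope.
Local Open Scope quotient_scope.

(* Unital associative algebras given by generators and relations: the free    *)
(* algebra (the monoid algebra of the free monoid on I) modulo the two-sided  *)
(* ideal generated by the differences a - b with rel a b. Such an algebra may *)
(* a priori be trivial, so it is a pzRingType and an lmodType, together with  *)
(* the compatibility lemmas presented_scalerAl and presented_scalerAr, rather *)
(* than an algType, which would require 1 != 0.                               *)

Notation free_alg F I := {malg F[{fmonom I}]}.

Section FreeAlgebra.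

Variables (F : fieldType) (I : choiceType).

Definition free_gen (i : I) : free_alg F I := << fmu i >>.

Lemma free_alg_scalerAr (c : F) (x y : free_alg F I) :
  c *: (x * y) = x * (c *: y).
Proof.
have cC : c%:MP * x = x * c%:MP.
  rewrite !malgM_def fgmulUg fgmulgU; apply: eq_bigr => k _.
  by rewrite mulrC mul1m mulm1.
by rewrite -!mul_malgC mulrA cC mulrA.
Qed.

Variable rel : free_alg F I -> free_alg F I -> Prop.

Definition two_sided_ideal (J : set (free_alg F I)) : Prop :=
  [/\ J 0, forall x y, J x -> J y -> J (x - y) &
      forall a x b, J x -> J (a * x * b)].

Definition generated_ideal : set (free_alg F I) :=
  [set x | forall J, two_sided_ideal J ->
    (forall a b, rel a b -> J (a - b)) -> J x].

Lemma generated_idealP : two_sided_ideal generated_ideal.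
Proof.
split=> [J [] //|x y Ix Iy J idJ relJ|a x b Ix J idJ relJ].
- by case: (idJ) => _ + _; apply; [exact: Ix|exact: Iy].
- by case: (idJ) => _ _; apply; exact: Ix.
Qed.

Lemma generated_ideal_rel a b : rel a b -> generated_ideal (a - b).
Proof. by move=> rab J _; apply. Qed.

Definition generated_idealb : {pred free_alg F I} :=
  fun x => `[< generated_ideal x >].

Lemma generated_idealb_closed : zmod_closed generated_idealb.
Proof.
have [I0 IB _] := generated_idealP.
split=> [|x y]; rewrite !unfold_in; first exact/asboolP.
by move=> /asboolP Ix /asboolP Iy; apply/asboolP; exact: IB.
Qed.

HB.instance Definition _ :=
  GRing.isZmodClosed.Build (free_alg F I) generated_idealb
    generated_idealb_closed.

Definition presented : Type := {ideal_quot generated_idealb}.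

HB.instance Definition _ := EqQuotient.on presented.
HB.instance Definition _ := GRing.Zmodule.on presented.
HB.instance Definition _ :=
  ZmodQuotient.on presented.

Definition presented_pi (x : free_alg F I) : presented := \pi_presented x.

Definition presented_gen (i : I) : presented := presented_pi (free_gen i).

Lemma presented_pi_eqP x y :
  presented_pi x = presented_pi y <-> generated_ideal (x - y).
Proof.
split=> [/eqP|Ixy].
  by rewrite -Quotient.idealrBE => /asboolP.
by apply/eqP; rewrite -Quotient.idealrBE; apply/asboolP.
Qed.

Lemma presented_pi_repr (x : presented) : presented_pi (repr x) = x.
Proof. exact: reprK. Qed.

Lemma presented_pi_zmod_morphism : zmod_morphism presented_pi.
Proof. by move=> x y; rewrite /presented_pi raddfB. Qed.

HB.instance Definition _ :=
  GRing.isZmodMorphism.Build (free_alg F I) presented presented_pi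
    presented_pi_zmod_morphism.

Definition presented_one : presented := presented_pi 1.
Definition presented_mul (x y : presented) : presented :=
  presented_pi (repr x * repr y).
Definition presented_scale (c : F) (x : presented) : presented :=
  presented_pi (c *: repr x).

Lemma presented_pi_mul x y :
  presented_pi (x * y) = presented_mul (presented_pi x) (presented_pi y).
Proof.
have [_ IB IM] := generated_idealP.
have repr_pi z : generated_ideal (z - repr (presented_pi z)).
  by apply/presented_pi_eqP; rewrite presented_pi_repr.
apply/presented_pi_eqP.
set x' := repr _; set y' := repr _.
have -> : x * y - x' * y' = 1 * (x - x') * y - (- x') * (y - y') * 1.
  by rewrite mul1r mulr1 mulrBl mulNr opprK mulrBr addrA addrNK.
by apply: IB; apply: IM; apply: repr_pi.
Qed.

Lemma presented_pi_scale c x :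
  presented_pi (c *: x) = presented_scale c (presented_pi x).
Proof.
have [_ _ IM] := generated_idealP.
apply/presented_pi_eqP; rewrite -scalerBr -[_ - _]mul1r scalerAl -[_ * _]mulr1.
by apply: IM; apply/presented_pi_eqP; rewrite presented_pi_repr.
Qed.

Lemma presented_mulA : associative presented_mul.
Proof.
move=> x y z; rewrite -[x]presented_pi_repr -[y]presented_pi_repr.
by rewrite -[z]presented_pi_repr -!presented_pi_mul mulrA.
Qed.

Lemma presented_mul1 : left_id presented_one presented_mul.
Proof. by move=> x; rewrite -[x]presented_pi_repr -presented_pi_mul mul1r. Qed.

Lemma presented_mulr1 : right_id presented_one presented_mul.
Proof. by move=> x; rewrite -[x]presented_pi_repr -presented_pi_mul mulr1. Qed.

Lemma presented_mulDl : left_distributive presented_mul +%R.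
Proof.
move=> x y z; rewrite -[x]presented_pi_repr -[y]presented_pi_repr.
rewrite -[z]presented_pi_repr -raddfD -!presented_pi_mul mulrDl.
by rewrite raddfD.
Qed.

Lemma presented_mulDr : right_distributive presented_mul +%R.
Proof.
move=> x y z; rewrite -[x]presented_pi_repr -[y]presented_pi_repr.
rewrite -[z]presented_pi_repr -raddfD -!presented_pi_mul mulrDr.
by rewrite raddfD.
Qed.

HB.instance Definition _ := GRing.Zmodule_isPzRing.Build presented
  presented_mulA presented_mul1 presented_mulr1 presented_mulDl presented_mulDr.

Lemma presented_pi_monoid_morphism : monoid_morphism presented_pi.
Proof. by split=> // x y; rewrite presented_pi_mul. Qed.

HB.instance Definition _ :=
  GRing.isMonoidMorphism.Build (free_alg F I) presented presented_pi
    presented_pi_monoid_morphism.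

Lemma presented_scaleA a b x :
  presented_scale a (presented_scale b x) = presented_scale (a * b) x.
Proof.
by rewrite -[x]presented_pi_repr -!presented_pi_scale scalerA.
Qed.

Lemma presented_scale1 : left_id 1 presented_scale.
Proof.
by move=> x; rewrite -[x]presented_pi_repr -presented_pi_scale scale1r.
Qed.

Lemma presented_scaleDr : right_distributive presented_scale +%R.
Proof.
move=> c x y; rewrite -[x]presented_pi_repr -[y]presented_pi_repr.
by rewrite -raddfD -!presented_pi_scale scalerDr raddfD.
Qed.

Lemma presented_scaleDl x : {morph presented_scale^~ x : a b / a + b}.
Proof.
move=> a b; rewrite -[x]presented_pi_repr -!presented_pi_scale.
by rewrite scalerDl raddfD.
Qed.

HB.instance Definition _ := GRing.Zmodule_isLmodule.Build F presented
  presented_scaleA presented_scale1 presented_scaleDr presented_scaleDl.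

HB.instance Definition _ :=
  GRing.isScalable.Build F (free_alg F I) presented *:%R presented_pi
    presented_pi_scale.

Lemma presented_scalerAl (c : F) (x y : presented) :
  c *: (x * y) = c *: x * y.
Proof.
rewrite -[x]presented_pi_repr -[y]presented_pi_repr.
by rewrite -rmorphM -!linearZ /= scalerAl rmorphM.
Qed.

Lemma presented_scalerAr (c : F) (x y : presented) :
  c *: (x * y) = x * (c *: y).
Proof.
rewrite -[x]presented_pi_repr -[y]presented_pi_repr.
by rewrite -rmorphM -!linearZ /= free_alg_scalerAr rmorphM.
Qed.

Lemma presented_rel a b : rel a b -> presented_pi a = presented_pi b.
Proof. by move=> rab; apply/presented_pi_eqP; exact: generated_ideal_rel. Qed.

End FreeAlgebra.

(* QPsi true j is psi^+_j and QPsi false j is psi^-_{-j}, for j >= 0; the     *)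
(* generators QPsi0inv s are the inverses of psi^+_0 and psi^-_0.             *)
Definition qgl_gen : Type := (int + int + bool * nat + bool)%type.
HB.instance Definition _ := Choice.on qgl_gen.

Definition QE (i : int) : qgl_gen := inl (inl (inl i)).
Definition QF (i : int) : qgl_gen := inl (inl (inr i)).
Definition QPsi (s : bool) (j : nat) : qgl_gen := inl (inr (s, j)).
Definition QPsi0inv (s : bool) : qgl_gen := inr s.

Section QuantumGL.

Variables (F : fieldType) (q1 q3 : F).

Let q2 : F := q1^-1 * q3^-1.

Local Notation A := (free_alg F qgl_gen).

(* The dehomogenization g(z, 1), of degree 3: hence                           *)
(* g(z, w) = \sum_(k < 4) gpoly`_k z^k w^(3 - k) and g(1, 1) = gpoly.[1].     *)
Definition gpoly : {poly F} :=
  ('X - q1%:P) * ('X - q2%:P) * ('X - q3%:P).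

(* A current a(z) = \sum_i a_i z^{-i} is the function i |-> a_i.              *)
Definition current_e : int -> A := fun i => free_gen F (QE i).
Definition current_f : int -> A := fun i => free_gen F (QF i).
Definition current_psi (s : bool) : int -> A := fun i =>
  match s, i with
  | true, Posz j => free_gen F (QPsi true j)
  | false, Posz 0 => free_gen F (QPsi false 0)
  | false, Negz j => free_gen F (QPsi false j.+1)
  | _, _ => 0
  end.

(* The coefficient of z^{-m} w^{-n} in g(z, w) a(z) b(w). *)
Definition g_zw (a b : int -> A) (m n : int) : A :=
  \sum_(k < 4) gpoly`_k *: (a (m + k%:Z) * b (n + 3 - k%:Z)).

(* The coefficient of z^{-m} w^{-n} in g(w, z) a(z) b(w). *)
Definition g_wz (a b : int -> A) (m n : int) : A :=
  \sum_(k < 4) gpoly`_k *: (a (m + 3 - k%:Z) * b (n + k%:Z)).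

Local Notation comm x y := (x * y - y * x).

(* The coefficients of z^{-m} w^{-n} in the quadratic relations. On the right *)
(* hand sides a(w) b(z) occurs instead of a(z) b(w), so that z, w and m, n    *)
(* are exchanged: e.g. g_zw e e n m comes from g(w, z) e(w) e(z).             *)
Inductive qgl_rel : A -> A -> Prop :=
| Qee m n : qgl_rel (g_zw current_e current_e m n)
                    (- g_zw current_e current_e n m)
| Qff m n : qgl_rel (g_wz current_f current_f m n)
                    (- g_wz current_f current_f n m)
| Qpsie s m n : qgl_rel (g_zw (current_psi s) current_e m n)
                        (- g_zw current_e (current_psi s) n m)
| Qpsif s m n : qgl_rel (g_wz (current_psi s) current_f m n)
                        (- g_wz current_f (current_psi s) n m)
| Qef m n : qgl_rel (comm (current_e m) (current_f n))
    (gpoly.[1]^-1 *: (current_psi true (m + n) - current_psi false (m + n)))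
| Qpsipsi s t i j : qgl_rel (comm (current_psi s i) (current_psi t j)) 0
| QpsiV s : qgl_rel (current_psi s 0 * free_gen F (QPsi0inv s)) 1
| QVpsi s : qgl_rel (free_gen F (QPsi0inv s) * current_psi s 0) 1
| QserreE : qgl_rel (comm (current_e 0) (comm (current_e 1) (current_e (-1)))) 0
| QserreF : qgl_rel (comm (current_f 0) (comm (current_f 1) (current_f (-1)))) 0.

Definition quantum_gl : Type := presented qgl_rel.

HB.instance Definition _ := GRing.PzRing.on quantum_gl.
HB.instance Definition _ := GRing.Lmodule.on quantum_gl.

End QuantumGL.

(* The customary indices 1, ..., N are shifted to 0, ..., N - 1; i : 'I_N.-1  *)
(* stands for the consecutive indices fst_idx i and snd_idx i of 'I_N.        *)

Definition fst_idx N (i : 'I_N.-1) : 'I_N := widen_ord (leq_pred N) i.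

Lemma snd_idx_subproof N (i : 'I_N.-1) : (i.+1 < N)%N.
Proof. by rewrite -ltn_predRL. Qed.

Definition snd_idx N (i : 'I_N.-1) : 'I_N := Ordinal (snd_idx_subproof i).

Section ReducedWords.

Variable N : nat.

Definition word_perm (s : seq 'I_N.-1) : 'S_N :=
  (\prod_(i <- s) tperm (fst_idx i) (snd_idx i))%g.

Definition reduced (w : 'S_N) (s : seq 'I_N.-1) : Prop :=
  word_perm s = w /\ forall t, word_perm t = w -> (size s <= size t)%N.

Definition reduced_word (w : 'S_N) : seq 'I_N.-1 :=
  xget [::] [set s | reduced w s].

Definition perm_length (w : 'S_N) : nat := size (reduced_word w).

Lemma word_perm_tperm (x y : 'I_N) : exists s, word_perm s = tperm x y.
Proof.
wlog lexy : x y / (x <= y)%N.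
  move=> H; case: (leqP x y) => [|/ltnW] /H // [s Es].
  by exists s; rewrite Es tpermC.
move: {2}(y - x)%N (erefl (y - x)%N) => d.
elim: d => [|d IH] in y lexy *.
  move=> /eqP; rewrite subn_eq0 => leyx.
  exists [::]; rewrite /word_perm big_nil.
  by rewrite (_ : y = x) ?tperm1 //; apply/val_inj/eqP; rewrite eqn_leq leyx.
move=> ysx.
have ltxy : (x < y)%N by rewrite -subn_gt0 ysx.
have y_gt0 : (0 < y)%N by apply: leq_ltn_trans ltxy.
have ly : (y.-1 < N.-1)%N by rewrite ltn_predRL prednK.
pose i : 'I_N.-1 := Ordinal ly.
have Ey : snd_idx i = y by apply: val_inj; rewrite /= prednK.
have lexi : (x <= fst_idx i)%N by rewrite /= -ltnS prednK.
have [|s Es] := IH (fst_idx i) lexi.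
  by move: ysx; rewrite /= -{1}(prednK y_gt0) subSn ?[in RHS]/= => [[]|].
have [->|neqx] := eqVneq x (fst_idx i).
  by exists [:: i]; rewrite /word_perm big_seq1 Ey.
exists (i :: s ++ [:: i]).
rewrite /word_perm big_cons big_cat big_seq1 /= -/(word_perm s) Es Ey.
set t := tperm (fst_idx i) y.
have tV : t = (t^-1)%g by rewrite tpermV.
rewrite {1}tV -[LHS]/(tperm x (fst_idx i) ^ t)%g tpermJ tpermL.
rewrite tpermD // ?[fst_idx i == _]eq_sym // eq_sym.
by apply/eqP => xy; move: ltxy; rewrite xy ltnn.
Qed.

Lemma word_perm_surj (w : 'S_N) : exists s, word_perm s = w.
Proof.
have [ts -> _] := prod_tpermP w.
elim: ts => [|t ts [s Es]]; first by exists [::]; rewrite /word_perm !big_nil.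
have [s' Es'] := word_perm_tperm t.1 t.2.
by exists (s' ++ s); rewrite /word_perm big_cat big_cons -Es -Es'.
Qed.

Lemma reduced_wordP (w : 'S_N) : reduced w (reduced_word w).
Proof.
have exw : exists n, `[< exists2 s, word_perm s = w & size s = n >].
  by have [s Es] := word_perm_surj w; exists (size s); apply/asboolP; exists s.
case: (ex_minnP exw) => n /asboolP[s Es sn] n_min.
rewrite /reduced_word; apply: (@xgetPex _ [::] [set s | reduced w s]).
exists s; split=> // t Et.
by rewrite sn; apply: n_min; apply/asboolP; exists t.
Qed.

End ReducedWords.

(* (g, false) is the generator g and (g, true) its inverse.                   *)
Definition daha_gen (N : nat) : Type := (('I_N.-1 + 'I_N + 'I_N) * bool)%type.
HB.instance Definition _ N := Choice.on (daha_gen N).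

Definition HT N (i : 'I_N.-1) : daha_gen N := (inl (inl i), false).
Definition HX N (j : 'I_N) : daha_gen N := (inl (inr j), false).
Definition HY N (j : 'I_N) : daha_gen N := (inr j, false).
Definition HTV N (i : 'I_N.-1) : daha_gen N := (inl (inl i), true).
Definition HXV N (j : 'I_N) : daha_gen N := (inl (inr j), true).
Definition HYV N (j : 'I_N) : daha_gen N := (inr j, true).

Section DAHA.

Variables (F : fieldType) (q v : F) (N : nat).

Local Notation A := (free_alg F (daha_gen N)).
Local Notation T i := (free_gen F (HT i)).
Local Notation X j := (free_gen F (HX j)).
Local Notation Y j := (free_gen F (HY j)).
Local Notation TV i := (free_gen F (HTV i)).
Local Notation XV j := (free_gen F (HXV j)).

Inductive daha_rel : A -> A -> Prop :=
| Hinvr g : daha_rel (free_gen F (g, false) * free_gen F (g, true)) 1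
| Hinvl g : daha_rel (free_gen F (g, true) * free_gen F (g, false)) 1
| Hquad i : daha_rel ((T i + v^-1 *: 1) * (T i - v *: 1)) 0
| Hbraid (i k : 'I_N.-1) : k = i.+1 :> nat ->
    daha_rel (T i * T k * T i) (T k * T i * T k)
| Hcomm (i k : 'I_N.-1) : (i.+1 < k)%N || (k.+1 < i)%N ->
    daha_rel (T i * T k) (T k * T i)
| HXX j k : daha_rel (X j * X k) (X k * X j)
| HYY j k : daha_rel (Y j * Y k) (Y k * Y j)
| HTX i : daha_rel (T i * X (fst_idx i) * T i) (X (snd_idx i))
| HTY i : daha_rel (TV i * Y (fst_idx i) * TV i) (Y (snd_idx i))
| HTXc i k : k != fst_idx i -> k != snd_idx i ->
    daha_rel (T i * X k) (X k * T i)
| HTYc i k : k != fst_idx i -> k != snd_idx i ->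
    daha_rel (T i * Y k) (Y k * T i)
| HYX (o : 'I_N) : o = 0%N :> nat ->
    daha_rel (Y o * \prod_(j < N) X j) (q *: ((\prod_(j < N) X j) * Y o))
| HXY (i : 'I_N.-1) : i = 0%N :> nat ->
    daha_rel (XV (fst_idx i) * Y (snd_idx i))
             (Y (snd_idx i) * XV (fst_idx i) * TV i ^+ 2).

Definition daha : Type := presented daha_rel.

HB.instance Definition _ := GRing.PzRing.on daha.
HB.instance Definition _ := GRing.Lmodule.on daha.

(* The product of 'S_N is composition from left to right, so that w and w^-1  *)
(* are exchanged with respect to the opposite convention; the sum over all w  *)
(* in daha_S does not depend on the convention.                               *)
Definition daha_T (w : 'S_N) : daha :=
  \prod_(i <- reduced_word w) presented_gen daha_rel (HT i).

Definition qint (i : nat) : F := (v ^+ (2 * i) - 1) / (v ^+ 2 - 1).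
Definition qfact (n : nat) : F := \prod_(1 <= i < n.+1) qint i.

Definition daha_S : daha :=
  (qfact N)^-1 *: \sum_(w : 'S_N) v ^+ perm_length w *: daha_T w.

(* The underlying set of S H_N S, an algebra with unit S.                     *)
Definition spherical_daha : set daha :=
  [set daha_S * h * daha_S | h in setT].

End DAHA.

Arguments daha_T {F} q v {N} w.
Arguments spherical_daha {F} q v N _.

(* The field C(q, v), with C = R[i] and C[q, v] = C[q][v].                    *)
Section RationalFunctions.

Variable R : realType.

Definition Cqv : fieldType := {fraction {poly {poly R[i]}}}.
Definition var_q : Cqv := tofrac ('X%:P : {poly {poly R[i]}}).
Definition var_v : Cqv := tofrac ('X : {poly {poly R[i]}}).

End RationalFunctions.

(* Main.v *)
From HB Require Import structures.
Require Import Defs.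
From mathcomp Require Import all_boot all_algebra.
From mathcomp Require Import classical_sets reals.
From mathcomp Require Import all_order all_fingroup fraction complex ring zify.
From mathcomp Require Import finmap monalg.

Set Implicit Arguments.
Unset Strict Implicit.
Unset Printing Implicit Defensive.

Import Order.TTheory GRing.Theory Num.Theory.
Local Open Scope ring_scope.

(** Write X_j, Y_j and T_k for the generators of the double affine Hecke algebra
    and S for its symmetrizer. The homomorphism is
      e_m |-> S X_1^m Y_1^-1 S,   f_m |-> c S Y_1 X_1^m S,   psi^+_0, psi^-_0 |-> S
    for a suitable scalar c. The relation for [e(z), f(w)] leaves no choice for
    the other psi's: they are multiples of the elements [e_k, f_0].

    The quadratic relations of e and of f. X_1 and Y_1 commute with T_2, T_3,
    ..., so that for a and b in the algebra generated by X_1 and Y_1 the middle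
    factor of S a S b S can be replaced by a combination of 1 and T_1
    ([sym_prod]): everything takes place in rank two. A product of two
    half currents is thereby a combination of two double sequences, one of
    which is eliminated by the commutation relation of X_1 with Y_1, and the
    other of which T_1 symmetrizes; what remains is a linear combination of
    these symmetries ([cure_exchange], [curf_exchange]). By the same formulas
    [e_1, e_-1] is a combination of S Y_1^-2 S and S Y_1^-1 Y_2^-1 S, with
    which e_0, a multiple of S (Y_1^-1 + ... + Y_N^-1), commutes: this is the
    Serre relation.

    The relations with psi. The power sums P_l = (X_1^l + ... + X_N^l) S shift
    the indices of e and f, with opposite eigenvalues, hence
    [P_l, [e_m, f_n]] is a multiple of [e_(l+m), f_n] - [e_m, f_(l+n)].
    Moreover [e_0, f_0] = 0, and [e_0, f_l] is a multiple of P_l for l = 1 and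
    l = -1. It follows by induction that [e_m, f_n] depends on m + n only
    ([bracket_ef]). The bracket of the quadratic relation of e with f_j is then
    the exchange relation of e with the current [e_k, f_0], the two halves of
    which are psi^+ and psi^- ([cartan_exchange]); the commutativity of the
    psi's follows ([cartan_comm]).

    Surjectivity. Let O be the ring of the rational functions in q and v that
    are regular at v = 1. Modulo v - 1 the T_k generate the symmetric group,
    letters X_i, X_i^-1, Y_i, Y_i^-1 with different indices commute, and X_i
    and Y_i commute up to a power of q. The elements that are combinations over
    O of words with at most d letters form a finitely generated O-module G d. If every
    S z S with z in G d is congruent modulo (v - 1) G d to an element of the
    image, then by Nakayama's lemma it belongs to the image ([W_word]). For
    z = X_1^n the commutator [f_n, e_0] does it, with leading coefficient
    q^n - 1, and brackets with Y_1 + ... + Y_N or with the sum of the inverses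
    raise the exponent of Y_1; brackets with P_1 and P_-1 then remove X_1
    altogether, which yields the powers of Y_1 ([E_mxy]). For words with several indices,
    S u S r S is the average of S u' r S over the words u' obtained from u by
    changing its index, which gives an induction on the number of indices
    ([E_word]).

    In the formal text the indices start from 0. *)

(** * Associative algebras over a field, possibly trivial *)

(** An algebra that is given by generators and relations may a priori be zero:
    the condition 1 != 0 is not imposed. *)
Record pzalg (K : fieldType) := PzAlg {
  pzalg_ring : pzRingType;
  pzalg_scale : K -> pzalg_ring -> pzalg_ring;
  pzalg_scaleA : forall a b x,
    pzalg_scale a (pzalg_scale b x) = pzalg_scale (a * b) x;
  pzalg_scale1 : left_id 1 pzalg_scale;
  pzalg_scaleDr : right_distributive pzalg_scale +%R;
  pzalg_scaleDl : forall x, {morph pzalg_scale^~ x : a b / a + b};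
  pzalg_scaleAl : forall c x y, pzalg_scale c (x * y) = pzalg_scale c x * y;
  pzalg_scaleAr : forall c x y, pzalg_scale c (x * y) = x * pzalg_scale c y
}.

Definition kalg (K : fieldType) (A : pzalg K) : Type := pzalg_ring A.

HB.instance Definition _ (K : fieldType) (A : pzalg K) :=
  GRing.PzRing.on (kalg A).
HB.instance Definition _ (K : fieldType) (A : pzalg K) :=
  GRing.Zmodule_isLmodule.Build K (kalg A) (@pzalg_scaleA K A)
    (@pzalg_scale1 K A) (@pzalg_scaleDr K A) (@pzalg_scaleDl K A).

Section ScaleMul.

Variables (K : fieldType) (A : pzalg K).
Implicit Types (c : K) (x y : kalg A).

Lemma scaleAl c x y : c *: (x * y) = c *: x * y.
Proof. exact: pzalg_scaleAl. Qed.

Lemma scaleAr c x y : c *: (x * y) = x * (c *: y).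
Proof. exact: pzalg_scaleAr. Qed.

End ScaleMul.

Lemma mulA22 (A : pzSemiRingType) (a b c d : A) :
  a * b = c * d -> forall z, a * (b * z) = c * (d * z).
Proof. by move=> E z; rewrite !mulrA E. Qed.

Lemma mulA21 (A : pzSemiRingType) (a b c : A) :
  a * b = c -> forall z, a * (b * z) = c * z.
Proof. by move=> E z; rewrite !mulrA E. Qed.

Lemma mulA20 (A : pzSemiRingType) (a b : A) :
  a * b = 1 -> forall z, a * (b * z) = z.
Proof. by move=> E z; rewrite !mulrA E mul1r. Qed.

Lemma mulA33 (A : pzSemiRingType) (a b c a' b' c' : A) :
  a * (b * c) = a' * (b' * c') ->
  forall z, a * (b * (c * z)) = a' * (b' * (c' * z)).
Proof. by move=> E z; move: (congr1 ( *%R^~ z) E); rewrite -!mulrA. Qed.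

(** * Integer powers of an element with a given inverse *)

Section IntegerPowers.

Variable A : pzRingType.
Implicit Types (a b c : A) (m n : int).

Definition zpow a b n : A :=
  match n with Posz k => a ^+ k | Negz k => b ^+ k.+1 end.

Lemma zpow0 a b : zpow a b 0 = 1. Proof. by []. Qed.
Lemma zpow1 a b : zpow a b 1 = a. Proof. by []. Qed.

Lemma zpow_intertwine a b a' b' c n :
  c * a = a' * c -> c * b = b' * c -> c * zpow a b n = zpow a' b' n * c.
Proof.
have X u u' k : c * u = u' * c -> c * u ^+ k = u' ^+ k * c.
  move=> E; elim: k => [|k IH]; first by rewrite !expr0 mulr1 mul1r.
  by rewrite !exprS mulrA E -!mulrA IH.
by move=> Ea Eb; case: n => k /=; exact: X.
Qed.

Lemma intertwine_inv a b a' b' c :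
  a * b = 1 -> b' * a' = 1 -> c * a = a' * c -> c * b = b' * c.
Proof.
move=> ab ba E; rewrite -[LHS]mul1r -ba -mulrA [a' * _]mulrA -E.
by rewrite -[c * a * b]mulrA ab mulr1.
Qed.

Section Inverse.

Variables (a b : A) (ab : a * b = 1) (ba : b * a = 1).

Lemma zpowS n : zpow a b (n + 1) = a * zpow a b n.
Proof.
case: n => [k|[|k]].
- have -> : Posz k + 1 = k.+1 by lia.
  by rewrite /zpow exprS.
- by rewrite -[_ + 1]/(Posz 0) /zpow expr1 ab.
- have -> : Negz k.+1 + 1 = Negz k by lia.
  by rewrite /zpow [b ^+ k.+2]exprS mulA20.
Qed.

Lemma zpowP n : zpow a b (n - 1) = b * zpow a b n.
Proof. by rewrite -{2}[n](subrK 1) zpowS mulA20. Qed.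

Lemma zpowD m n : zpow a b (m + n) = zpow a b m * zpow a b n.
Proof.
elim/int_ind: m => [|m IH|m IH]; first by rewrite add0r mul1r.
  by rewrite -addn1 PoszD addrAC zpowS IH zpowS mulrA.
by rewrite -addn1 PoszD opprD addrAC zpowP IH zpowP mulrA.
Qed.

End Inverse.

End IntegerPowers.

Lemma comm_zpow (A : pzRingType) (a b c : A) n :
  GRing.comm c a -> GRing.comm c b -> GRing.comm c (zpow a b n).
Proof. exact: zpow_intertwine. Qed.

Section ScaledPowers.

Variables (K : fieldType) (A0 : pzalg K).
Local Notation A := (kalg A0).

Lemma zpowZ (c : K) (a b : A) n :
  zpow (c *: a) (c^-1 *: b) n = c ^ n *: zpow a b n.
Proof.
have X d (u : A) k : (d *: u) ^+ k = d ^+ k *: u ^+ k.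
  elim: k => [|k IH]; first by rewrite !expr0 scale1r.
  by rewrite !exprS IH -scaleAl -scaleAr scalerA.
by case: n => k /=; rewrite X // exprVn.
Qed.

Lemma commZ (c : K) (a b : A) : GRing.comm a b -> GRing.comm a (c *: b).
Proof. by move=> E; rewrite /GRing.comm -scaleAr E scaleAl. Qed.

End ScaledPowers.

(** * Deciding identities of free associative algebras *)

Section NoncommutativeNormalForm.

Variables (K : fieldType) (A0 : pzalg K).
Local Notation A := (kalg A0).

(** The functions on lists are spelled out, so that [nc_coefs] can reduce them
    without unfolding anything that occurs in the coefficients. *)
Inductive ncexp : Type :=
| NcAtom of nat | Nc0 | Nc1 | NcAdd of ncexp & ncexp | NcOpp of ncexp
| NcScale of K & ncexp | NcMul of ncexp & ncexp.

Fixpoint ncnth (env : list A) (n : nat) {struct env} : A :=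
  match env, n with
  | [::], _ => 0
  | a :: _, O => a
  | _ :: env', S m => ncnth env' m
  end.

Fixpoint nceval (env : list A) (e : ncexp) : A :=
  match e with
  | NcAtom n => ncnth env n
  | Nc0 => 0
  | Nc1 => 1
  | NcAdd a b => nceval env a + nceval env b
  | NcOpp a => - nceval env a
  | NcScale c a => c *: nceval env a
  | NcMul a b => nceval env a * nceval env b
  end.

Fixpoint ncword (env : list A) (w : list nat) : A :=
  match w with [::] => 1 | n :: w' => ncnth env n * ncword env w' end.

Fixpoint ncapp (T : Type) (l m : list T) : list T :=
  match l with [::] => m | a :: l' => a :: ncapp l' m end.

Fixpoint ncscale (c : K) (l : list (K * list nat)) : list (K * list nat) :=
  match l with
  | [::] => [::]
  | (d, w) :: l' => (c * d, w) :: ncscale c l'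
  end.

Fixpoint ncmul1 (c : K) (u : list nat) (l : list (K * list nat)) :=
  match l with
  | [::] => [::]
  | (d, w) :: l' => (c * d, ncapp u w) :: ncmul1 c u l'
  end.

Fixpoint ncmul (l m : list (K * list nat)) :=
  match l with
  | [::] => [::]
  | (c, u) :: l' => ncapp (ncmul1 c u m) (ncmul l' m)
  end.

Fixpoint ncnf (e : ncexp) : list (K * list nat) :=
  match e with
  | NcAtom n => [:: (1, [:: n])]
  | Nc0 => [::]
  | Nc1 => [:: (1, [::])]
  | NcAdd a b => ncapp (ncnf a) (ncnf b)
  | NcOpp a => ncscale (-1) (ncnf a)
  | NcScale c a => ncscale c (ncnf a)
  | NcMul a b => ncmul (ncnf a) (ncnf b)
  end.

Fixpoint nceqn (m n : nat) : bool :=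
  match m, n with
  | O, O => true | S m', S n' => nceqn m' n' | _, _ => false
  end.

Fixpoint nceqw (u w : list nat) : bool :=
  match u, w with
  | [::], [::] => true
  | a :: u', b :: w' => if nceqn a b then nceqw u' w' else false
  | _, _ => false
  end.

(** Splits off the total coefficient of the word w. *)
Fixpoint nccollect (w : list nat) (l : list (K * list nat)) :
    K * list (K * list nat) :=
  match l with
  | [::] => (0, [::])
  | (c, u) :: l' =>
      let: (d, r) := nccollect w l' in
      if nceqw u w then (c + d, r) else (d, (c, u) :: r)
  end.

Fixpoint ncvanish (fuel : nat) (l : list (K * list nat)) : Prop :=
  match fuel, l with
  | _, [::] => True
  | O, _ => False
  | S n, (c, w) :: l' =>
      let: (d, r) := nccollect w l' in c + d = 0 /\ ncvanish n r
  end.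

Fixpoint nclen (T : Type) (l : list T) : nat :=
  match l with [::] => O | _ :: l' => S (nclen l') end.

Fixpoint ncsum (env : list A) (l : list (K * list nat)) : A :=
  match l with [::] => 0 | (c, w) :: l' => c *: ncword env w + ncsum env l' end.

Lemma ncsum_app env l m : ncsum env (ncapp l m) = ncsum env l + ncsum env m.
Proof. by elim: l => [|[c w] l IH] /=; rewrite ?add0r // IH addrA. Qed.

Lemma ncword_app env u w :
  ncword env (ncapp u w) = ncword env u * ncword env w.
Proof. by elim: u => [|n u IH] /=; rewrite ?mul1r // IH mulrA. Qed.

Lemma ncsum_scale env c l : ncsum env (ncscale c l) = c *: ncsum env l.
Proof.
by elim: l => [|[d w] l IH] /=; rewrite ?scaler0 // IH scalerDr scalerA.
Qed.

Lemma ncsum_mul1 env c u l :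
  ncsum env (ncmul1 c u l) = c *: ncword env u * ncsum env l.
Proof.
elim: l => [|[d w] l IH] /=; first by rewrite mulr0.
by rewrite IH mulrDr ncword_app -!scaleAl -!scaleAr scalerA.
Qed.

Lemma ncsum_mul env l m : ncsum env (ncmul l m) = ncsum env l * ncsum env m.
Proof.
elim: l => [|[c u] l IH] /=; first by rewrite mul0r.
by rewrite ncsum_app IH ncsum_mul1 mulrDl.
Qed.

Lemma ncsum_nf env e : nceval env e = ncsum env (ncnf e).
Proof.
elim: e => //=.
- by move=> n; rewrite scale1r mulr1 addr0.
- by rewrite scale1r addr0.
- by move=> a -> b ->; rewrite ncsum_app.
- by move=> a ->; rewrite ncsum_scale scaleN1r.
- by move=> c a ->; rewrite ncsum_scale.
- by move=> a -> b ->; rewrite ncsum_mul.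
Qed.

Lemma nceqwP u w : nceqw u w -> u = w.
Proof.
have eqnP a b : nceqn a b -> a = b.
  by elim: a b => [|a IH] [|b] //= /IH ->.
elim: u w => [|a u IH] [|b w] //=.
by case: ifP => // /eqnP -> /IH ->.
Qed.

Lemma ncsum_collect env w l :
  ncsum env l
  = (nccollect w l).1 *: ncword env w + ncsum env (nccollect w l).2.
Proof.
elim: l => [|[c u] l IH] /=; first by rewrite scale0r add0r.
rewrite IH; case: (nccollect w l) => d r /=.
case: ifP => [/nceqwP ->|_] /=; first by rewrite scalerDl addrA.
by rewrite addrCA.
Qed.

Lemma ncvanishP env n l : ncvanish n l -> ncsum env l = 0.
Proof.
elim: n l => [|n IH] [|[c w] l] //=.
have := ncsum_collect env w l.
case: (nccollect w l) => d r /= -> [cd0 /IH ->].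
by rewrite addr0 -scalerDl cd0 scale0r.
Qed.

Lemma ncexp_eq env a b :
  ncvanish (nclen (ncnf (NcAdd a (NcOpp b)))) (ncnf (NcAdd a (NcOpp b))) ->
  nceval env a = nceval env b.
Proof.
by move=> /(ncvanishP env) E; apply/subr0_eq; move: E; rewrite -ncsum_nf.
Qed.

End NoncommutativeNormalForm.

Ltac nc_mem a env :=
  lazymatch env with
  | [::] => constr:(false)
  | a :: _ => constr:(true)
  | _ :: ?env' => nc_mem a env'
  end.

Ltac nc_index a env :=
  lazymatch env with
  | a :: _ => constr:(O)
  | _ :: ?env' => let n := nc_index a env' in constr:(S n)
  end.

Ltac nc_atoms env e :=
  lazymatch e with
  | (?a + ?b)%R => let env := nc_atoms env a in nc_atoms env b
  | (- ?a)%R => nc_atoms env a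
  | (?a * ?b)%R => let env := nc_atoms env a in nc_atoms env b
  | (_ *: ?a)%R => nc_atoms env a
  | 0%R => env
  | 1%R => env
  | _ => lazymatch nc_mem e env with
         | true => env
         | false => constr:(e :: env)
         end
  end.

Ltac nc_reify K env e :=
  lazymatch e with
  | (?a + ?b)%R =>
      let a := nc_reify K env a in
      let b := nc_reify K env b in constr:(NcAdd a b)
  | (- ?a)%R => let a := nc_reify K env a in constr:(NcOpp a)
  | (?a * ?b)%R =>
      let a := nc_reify K env a in
      let b := nc_reify K env b in constr:(NcMul a b)
  | (?c *: ?a)%R => let a := nc_reify K env a in constr:(NcScale c a)
  | 0%R => constr:(@Nc0 K)
  | 1%R => constr:(@Nc1 K)
  | _ => let n := nc_index e env in constr:(@NcAtom K n)
  end.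

(** Reduces an identity in a K-algebra that holds in the free algebra on its
    atoms to the identities of coefficients in K. *)
Ltac nc_coefs :=
  lazymatch goal with
  | |- @eq ?T ?a ?b =>
      let A := lazymatch eval hnf in (erefl _ : T = T) with _ => T end in
      lazymatch constr:((fun (K : fieldType) (A0 : pzalg K)
                          (_ : kalg A0) => (K, A0)) _ _ (a : kalg _)) with
      | _ ?K ?A0 _ =>
          let env := nc_atoms (@nil (kalg A0)) a in
          let env := nc_atoms env b in
          let ea := nc_reify K env a in
          let eb := nc_reify K env b in
          refine (@ncexp_eq K A0 env ea eb _);
          lazy [ncnf ncvanish nclen ncapp ncscale ncmul1 ncmul nceqn nceqw
                nccollect]
      end
  end.

Ltac nc := nc_coefs; repeat split; ring.
Ltac ncf := nc_coefs; repeat split; field.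

(** * The commutation relations of the double affine Hecke algebra *)

Lemma comm_inv (A : pzRingType) (a b c : A) : a * b = 1 -> b * a = 1 ->
  GRing.comm c a -> GRing.comm c b.
Proof. by move=> ab ba; exact: intertwine_inv. Qed.

Lemma intertwine_sym (A : pzRingType) (a a' b c : A) : a * a' = 1 -> a' * a = 1 ->
  a * b = c * a -> a' * c = b * a'.
Proof. by move=> aV Va E; rewrite -[LHS]mulr1 -aV -mulrA (mulA22 (esym E)) mulA20. Qed.

Lemma comm_prod_seq (A : pzRingType) (J : eqType) (r : seq J) (F : J -> A) c :
  (forall i, i \in r -> GRing.comm c (F i)) ->
  GRing.comm c (\prod_(i <- r) F i).
Proof. by move=> H; rewrite big_seq; apply: commr_prod. Qed.

Lemma comm_sum_seq (A : pzRingType) (J : eqType) (r : seq J) (F : J -> A) c :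
  (forall i, i \in r -> GRing.comm c (F i)) ->
  GRing.comm c (\sum_(i <- r) F i).
Proof. by move=> H; rewrite big_seq; apply: commr_sum. Qed.

Lemma prod_rev_inv (A : pzRingType) (J : eqType) (r : seq J) (F G : J -> A) :
  (forall i, i \in r -> F i * G i = 1) ->
  (\prod_(i <- rev r) F i) * (\prod_(i <- r) G i) = 1.
Proof.
elim: r => [|a r IH] H; first by rewrite !big_nil mulr1.
have E : F a * G a = 1 by apply: H; rewrite mem_head.
rewrite rev_cons -cats1 big_cat big_seq1 big_cons /= -mulrA (mulA20 E).
by apply: IH => i ir; apply: H; rewrite inE ir orbT.
Qed.

Lemma prod_rev_recl (A : pzRingType) (F : nat -> A) a b : (a < b)%N ->
  \prod_(i <- rev (index_iota a b)) F i
  = (\prod_(i <- rev (index_iota a.+1 b)) F i) * F a.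
Proof.
move=> ab; rewrite /index_iota (_ : (b - a = (b - a.+1).+1)%N); last by lia.
by rewrite /= rev_cons -cats1 big_cat big_seq1.
Qed.

Lemma prod_rev_recr (A : pzRingType) (F : nat -> A) a b : (a <= b)%N ->
  \prod_(i <- rev (index_iota a b.+1)) F i
  = F b * \prod_(i <- rev (index_iota a b)) F i.
Proof.
move=> ab; rewrite /index_iota subSn // -addn1 iotaD rev_cat big_cat.
by rewrite big_seq1 subnKC.
Qed.

Lemma prod_rev_geq (A : pzRingType) (F : nat -> A) a b : (b <= a)%N ->
  \prod_(i <- rev (index_iota a b)) F i = 1.
Proof. by rewrite -subn_eq0 /index_iota => /eqP ->; rewrite big_nil. Qed.

(** Families indexed by the natural numbers, of which only the values in range
    matter, allow computations with the indices. *)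
Record daha_family (K : fieldType) (q v : K) (N : nat) (A : pzalg K)
    (t ti x xi y yi : nat -> kalg A) : Prop := DahaFamily {
  daha_N : (0 < N)%N;
  daha_v : v != 0;
  daha_q : q != 0;
  dtV : forall i, (i.+1 < N)%N -> t i * ti i = 1;
  dVt : forall i, (i.+1 < N)%N -> ti i * t i = 1;
  dxV : forall j, (j < N)%N -> x j * xi j = 1;
  dVx : forall j, (j < N)%N -> xi j * x j = 1;
  dyV : forall j, (j < N)%N -> y j * yi j = 1;
  dVy : forall j, (j < N)%N -> yi j * y j = 1;
  dquad : forall i, (i.+1 < N)%N -> 
    (t i + v^-1 *: (1 : kalg A)) * (t i - v *: (1 : kalg A)) = 0;
  dbraid : forall i, (i.+2 < N)%N ->
    t i * t i.+1 * t i = t i.+1 * t i * t i.+1;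
  dttC : forall i k, (i.+1 < k)%N -> (k.+1 < N)%N -> t i * t k = t k * t i;
  dxxC : forall j k, (j < N)%N -> (k < N)%N -> x j * x k = x k * x j;
  dyyC : forall j k, (j < N)%N -> (k < N)%N -> y j * y k = y k * y j;
  dtx : forall i, (i.+1 < N)%N -> t i * x i * t i = x i.+1;
  dty : forall i, (i.+1 < N)%N -> ti i * y i * ti i = y i.+1;
  dtxC : forall i k, (i.+1 < N)%N -> (k < N)%N -> k != i -> k != i.+1 ->
    t i * x k = x k * t i;
  dtyC : forall i k, (i.+1 < N)%N -> (k < N)%N -> k != i -> k != i.+1 ->
    t i * y k = y k * t i;
  dyX : y 0%N * \prod_(0 <= j < N) x j = q *: (\prod_(0 <= j < N) x j * y 0%N);
  dxy : (1 < N)%N -> xi 0%N * y 1%N = y 1%N * xi 0%N * ti 0%N ^+ 2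
}.

Section Relations.

Variables (K : fieldType) (q v : K) (N : nat) (A0 : pzalg K).
Local Notation A := (kalg A0).
Variables t ti x xi y yi : nat -> A.
Hypothesis D : daha_family q v N t ti x xi y yi.
Let N_gt0 := daha_N D.
Let v_neq0 := daha_v D.
Let q_neq0 := daha_q D.

Let h := v - v^-1.

Lemma tt i : (i.+1 < N)%N -> t i * t i = 1 + h *: t i.
Proof.
move=> Hi; apply/subr0_eq; rewrite -(dquad D Hi) /h.
by ncf.
Qed.

Lemma tiE i : (i.+1 < N)%N -> ti i = t i - h *: (1 : A).
Proof.
move=> Hi; have E : t i * (t i - h *: (1 : A)) = 1.
  by rewrite mulrBr tt // -scaleAr mulr1 addrK.
by rewrite -[LHS]mulr1 -[X in _ * X = _]E (mulA20 (dVt D Hi)).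
Qed.

Lemma t_x i : (i.+1 < N)%N -> t i * x i = x i.+1 * ti i.
Proof.
by move=> Hi; rewrite -(dtx D Hi) -mulrA (dtV D) // mulr1.
Qed.

Lemma x_t i : (i.+1 < N)%N -> x i * t i = ti i * x i.+1.
Proof.
by move=> Hi; rewrite -(dtx D Hi) -mulrA (mulA20 (dVt D Hi)).
Qed.

Lemma t_y i : (i.+1 < N)%N -> t i * y i.+1 = y i * ti i.
Proof.
by move=> Hi; rewrite -(dty D Hi) -mulrA (mulA20 (dtV D Hi)).
Qed.

Lemma y_t i : (i.+1 < N)%N -> y i.+1 * t i = ti i * y i.
Proof.
by move=> Hi; rewrite -(dty D Hi) -mulrA (dVt D) // mulr1.
Qed.

Lemma tyt i : (i.+1 < N)%N -> t i * y i.+1 * t i = y i.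
Proof. by move=> Hi; rewrite t_y // -mulrA (dVt D) // mulr1. Qed.

Lemma ti_comm i (c : A) : (i.+1 < N)%N ->
  GRing.comm c (t i) -> GRing.comm c (ti i).
Proof. by move=> Hi; apply: comm_inv; [exact: dtV D _ Hi | exact: dVt D _ Hi]. Qed.

Lemma xi_comm i (c : A) : (i < N)%N ->
  GRing.comm c (x i) -> GRing.comm c (xi i).
Proof. by move=> Hi; apply: comm_inv; [exact: dxV D _ Hi | exact: dVx D _ Hi]. Qed.

Lemma yi_comm i (c : A) : (i < N)%N ->
  GRing.comm c (y i) -> GRing.comm c (yi i).
Proof. by move=> Hi; apply: comm_inv; [exact: dyV D _ Hi | exact: dVy D _ Hi]. Qed.

Lemma tk_comm i k : (i.+1 < N)%N -> (k.+1 < N)%N ->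
  (i.+1 < k)%N || (k.+1 < i)%N -> GRing.comm (t i) (t k).
Proof.
move=> Hi Hk /orP[ik|ki]; first exact: dttC D _ _ ik Hk.
exact/commr_sym/(dttC D ki Hi).
Qed.

(** * The rotation element *)

(** The element w is such that y 0 = t 0 * ... * t N.-2 * w; conjugation by w
    rotates the variables cyclically, up to the factor q. *)
Definition tup (a b : nat) : A := \prod_(a <= i < b) t i.
Definition tupI (a b : nat) : A := \prod_(i <- rev (index_iota a b)) ti i.
Definition tdn (a b : nat) : A := \prod_(i <- rev (index_iota a b)) t i.
Definition tdnI (a b : nat) : A := \prod_(a <= i < b) ti i.

Let M := N.-1.

Lemma tupIl a b : (b < N)%N -> tupI a b * tup a b = 1.
Proof.
move=> bN; apply: prod_rev_inv => i; rewrite mem_index_iota => /andP[_ ib].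
by apply: dVt D _ _; apply: leq_ltn_trans bN.
Qed.

Lemma tupIr a b : (b < N)%N -> tup a b * tupI a b = 1.
Proof.
move=> bN; rewrite /tup -[index_iota a b]revK.
apply: prod_rev_inv => i; rewrite mem_rev mem_index_iota => /andP[_ ib].
by apply: dtV D _ _; apply: leq_ltn_trans bN.
Qed.

Lemma tdnIl a b : (b < N)%N -> tdnI a b * tdn a b = 1.
Proof.
move=> bN; rewrite /tdnI -[index_iota a b]revK.
apply: prod_rev_inv => i; rewrite mem_rev mem_index_iota => /andP[_ ib].
by apply: dVt D _ _; apply: leq_ltn_trans bN.
Qed.

Lemma tdnIr a b : (b < N)%N -> tdn a b * tdnI a b = 1.
Proof.
move=> bN; apply: prod_rev_inv => i; rewrite mem_index_iota => /andP[_ ib].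
by apply: dtV D _ _; apply: leq_ltn_trans bN.
Qed.

Lemma tup_comm a b (c : A) :
  (forall i, (a <= i < b)%N -> GRing.comm c (t i)) -> GRing.comm c (tup a b).
Proof.
by move=> H; apply: comm_prod_seq => i; rewrite mem_index_iota; apply: H.
Qed.

Lemma tdn_comm a b (c : A) :
  (forall i, (a <= i < b)%N -> GRing.comm c (t i)) -> GRing.comm c (tdn a b).
Proof.
move=> H; apply: comm_prod_seq => i.
by rewrite mem_rev mem_index_iota; apply: H.
Qed.

Lemma tupI_comm a b (c : A) : (b < N)%N ->
  (forall i, (a <= i < b)%N -> GRing.comm c (t i)) -> GRing.comm c (tupI a b).
Proof.
move=> bN H; apply: comm_inv (tup_comm H); [exact: tupIr | exact: tupIl].
Qed.

Lemma tdnI_comm a b (c : A) : (b < N)%N ->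
  (forall i, (a <= i < b)%N -> GRing.comm c (t i)) -> GRing.comm c (tdnI a b).
Proof.
move=> bN H; apply: comm_inv (tdn_comm H); [exact: tdnIr | exact: tdnIl].
Qed.

Lemma x_comm i k : (i.+1 < N)%N -> (k < N)%N -> k != i -> k != i.+1 ->
  GRing.comm (x k) (t i).
Proof. by move=> Hi Hk n1 n2; exact/commr_sym/(dtxC D Hi Hk n1 n2). Qed.

Lemma y_comm i k : (i.+1 < N)%N -> (k < N)%N -> k != i -> k != i.+1 ->
  GRing.comm (y k) (t i).
Proof. by move=> Hi Hk n1 n2; exact/commr_sym/(dtyC D Hi Hk n1 n2). Qed.

Lemma xi_tcomm i k : (i.+1 < N)%N -> (k < N)%N -> k != i -> k != i.+1 ->
  GRing.comm (xi k) (t i).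
Proof.
by move=> Hi Hk n1 n2; apply/commr_sym/xi_comm => //; exact: dtxC D _ _ Hi Hk n1 n2.
Qed.

Lemma yi_tcomm i k : (i.+1 < N)%N -> (k < N)%N -> k != i -> k != i.+1 ->
  GRing.comm (yi k) (t i).
Proof.
by move=> Hi Hk n1 n2; apply/commr_sym/yi_comm => //; exact: dtyC D _ _ Hi Hk n1 n2.
Qed.

Definition w : A := locked (tupI 0 M * y 0%N).
Definition wi : A := locked (yi 0%N * tup 0 M).

Lemma wE : w = tupI 0 M * y 0%N. Proof. by rewrite /w -lock. Qed.
Lemma wiE : wi = yi 0%N * tup 0 M. Proof. by rewrite /wi -lock. Qed.

Lemma MN : (M < N)%N. Proof. by rewrite /M prednK. Qed.

Lemma y0E : y 0%N = tup 0 M * w.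
Proof. by rewrite wE mulrA tupIr ?mul1r // MN. Qed.

Lemma yi0E : yi 0%N = wi * tupI 0 M.
Proof. by rewrite wiE -mulrA tupIr ?mulr1 // MN. Qed.

Lemma w_wi : w * wi = 1.
Proof.
by rewrite wE wiE -mulrA (mulA20 (dyV D N_gt0)) tupIl // MN.
Qed.

Lemma wi_w : wi * w = 1.
Proof.
by rewrite wE wiE -mulrA (mulA20 (tupIr 0 MN)) (dVy D).
Qed.

Lemma tup_shift i : (i.+2 < N)%N -> tup 0 M * t i = t i.+1 * tup 0 M.
Proof.
move=> Hi; have -> : tup 0 M = tup 0 i * (t i * (t i.+1 * tup i.+2 M)).
  rewrite /tup (@big_cat_nat _ _ _ i) //=; last by rewrite /M; lia.
  have Hi1 : (i < M)%N by rewrite /M; lia.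
  have Hi2 : (i.+1 < M)%N by rewrite /M; lia.
  by rewrite (big_ltn Hi1) (big_ltn Hi2).
have C1 : GRing.comm (t i) (tup i.+2 M).
  by apply: tup_comm => j Hj; apply: tk_comm; move: Hj; rewrite /M; lia.
have C2 : GRing.comm (t i.+1) (tup 0 i).
  by apply: tup_comm => j Hj; apply: tk_comm; move: Hj; rewrite /M; lia.
have B := dbraid D Hi; rewrite -!mulrA in B.
by rewrite -!mulrA -C1 [RHS]mulrA C2 -[RHS]mulrA (mulA33 B).
Qed.

Lemma tupI_shift i : (i.+2 < N)%N -> tupI 0 M * t i.+1 = t i * tupI 0 M.
Proof.
move=> Hi; apply: intertwine_sym (tup_shift Hi); first exact: tupIr MN.
exact: tupIl MN.
Qed.

Lemma w_t i : (i.+2 < N)%N -> w * t i.+1 = t i * w.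
Proof.
move=> Hi; have C : t i.+1 * y 0%N = y 0%N * t i.+1 by apply: (dtyC D); lia.
rewrite wE -mulrA -C.
by rewrite (mulA22 (tupI_shift Hi)).
Qed.

Lemma wi_t i : (i.+2 < N)%N -> wi * t i = t i.+1 * wi.
Proof.
by move=> Hi; apply: intertwine_sym (w_t Hi); [exact: w_wi | exact: wi_w].
Qed.

Lemma w_ti i : (i.+2 < N)%N -> w * ti i.+1 = ti i * w.
Proof.
move=> Hi; apply: intertwine_inv (w_t Hi); first exact: dtV D _ _.
by apply: dVt D _ _; lia.
Qed.

(** The mixed relation, in the form in which Y_1 acts on X_2. *)
Lemma y0_x1 : (1 < N)%N -> y 0%N * x 1%N = t 0%N * x 0%N * ti 0%N * y 0%N.
Proof.
move=> N1; apply: (@intertwine_inv _ (xi 1%N) _ (t 0%N * xi 0%N * ti 0%N)).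
- exact: dVx D _ N1.
- by rewrite -!mulrA (mulA20 (dVt D N1)) (mulA20 (dxV D N_gt0)) (dtV D).
have := dxy D N1; rewrite -(dty D N1) expr2 -!mulrA => E.
have E1 : xi 0%N * (ti 0%N * y 0%N)
    = ti 0%N * (y 0%N * (ti 0%N * (xi 0%N * ti 0%N))).
  move: (congr1 ( *%R^~ (t 0%N)) E); rewrite -!mulrA (dVt D N1) !mulr1.
  by [].
rewrite -?mulrA E1 (mulA20 (dtV D N1)); congr (_ * _).
have X : xi 1%N * x 1%N = 1 by exact: dVx D _ N1.
have Y : x 1%N * (ti 0%N * (xi 0%N * ti 0%N)) = 1.
  rewrite -(mulA22 (t_x N1)) (mulA20 (dxV D N_gt0)) (dtV D) //.
by rewrite -[LHS]mulr1 -Y (mulA20 X).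
Qed.

Lemma w_x j : (j.+1 < N)%N -> w * x j.+1 = x j * w.
Proof.
elim: j => [|j IH] Hj.
  have C : GRing.comm (x 0%N) (tupI 1 M).
    by apply: tupI_comm MN _ => i Hi; apply: x_comm; move: Hi; rewrite /M; lia.
  have E : tupI 0 M = tupI 1 M * ti 0%N.
    by rewrite /tupI prod_rev_recl // /M; lia.
  rewrite wE -mulrA y0_x1 // E -!mulrA (mulA20 (dVt D Hj)).
  by rewrite !mulrA -C.
have Hj' : (j.+1 < N)%N by lia.
rewrite -(dtx D Hj) -[in RHS](dtx D Hj') !mulrA w_t // -!mulrA.
by rewrite (mulA22 (IH Hj')) w_t.
Qed.

Lemma w_xi j : (j.+1 < N)%N -> w * xi j.+1 = xi j * w.
Proof.
move=> Hj; apply: intertwine_inv (w_x Hj); first exact: dxV D _ _.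
by apply: dVx D _ _; lia.
Qed.

Lemma wi_x j : (j.+1 < N)%N -> wi * x j = x j.+1 * wi.
Proof.
by move=> Hj; apply: intertwine_sym (w_x Hj); [exact: w_wi | exact: wi_w].
Qed.

(** The product of all the variables is symmetric and gets the factor q from
    Y_1; the other variables are rotated without a factor, which leaves q for
    the one that jumps from the first position to the last. *)
Lemma w_x0 : w * x 0%N = (q *: x M) * w.
Proof.
pose p := \prod_(0 <= j < M) x j; pose p' := \prod_(1 <= j < N) x j.
have XE : \prod_(0 <= j < N) x j = p * x M.
  by rewrite -{1}(prednK N_gt0) big_nat_recr //=.
have XE' : \prod_(0 <= j < N) x j = p' * x 0%N.
  rewrite big_ltn //; apply: comm_prod_seq => i.
  by rewrite mem_index_iota => /andP[_ iN]; apply: (dxxC D).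
have wp : w * p' = p * w.
  rewrite /p /p' -{1}(prednK N_gt0) big_add1 /= -/M.
  have : (M < N)%N by exact: MN.
  elim: (M) => [|m IH] Hm; first by rewrite !big_geq // mulr1 mul1r.
  by rewrite !big_nat_recr //= mulrA IH ?(ltnW Hm) // -!mulrA w_x.
have wX : w * \prod_(0 <= j < N) x j = q *: (\prod_(0 <= j < N) x j * w).
  have C : GRing.comm (\prod_(0 <= j < N) x j) (tupI 0 M).
    apply: tupI_comm MN _ => i Hi; apply/commr_sym.
    rewrite (@big_cat_nat _ _ _ i) //=; last by move: Hi; rewrite /M; lia.
    have Hi' : (i.+1 < N)%N by move: Hi; rewrite /M; lia.
    rewrite (big_ltn (ltnW Hi')) (big_ltn Hi').
    have Cc k : (k < N)%N -> (k != i) -> (k != i.+1) -> GRing.comm (t i) (x k).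
      by move=> Hk n1 n2; exact: dtxC D _ _ Hi' Hk n1 n2.
    apply: commrM.
      apply: comm_prod_seq => k; rewrite mem_index_iota => Hk.
      by apply: Cc; lia.
    rewrite mulrA; apply: commrM; last first.
      apply: comm_prod_seq => k; rewrite mem_index_iota => Hk.
      by apply: Cc; lia.
    rewrite /GRing.comm mulrA t_x // -mulrA -x_t // !mulrA.
    by rewrite (dxxC D (j := i)) //; lia.
  by rewrite wE -mulrA (dyX D) -scaleAr !mulrA C.
have pV : (\prod_(j <- rev (index_iota 0 M)) xi j) * p = 1.
  apply: prod_rev_inv => j; rewrite mem_index_iota => Hj.
  by apply: dVx D _ _; move: Hj; rewrite /M; lia.
move: wX; rewrite {1}XE' XE mulrA wp -!mulrA scaleAr scaleAl => E.
by rewrite -[LHS](mulA20 pV) E (mulA20 pV).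
Qed.

Lemma w_xi0 : w * xi 0%N = (q^-1 *: xi M) * w.
Proof.
apply: intertwine_inv w_x0; first exact: dxV D _ _.
by rewrite -scaleAl -scaleAr scalerA mulVf // scale1r; apply: dVx D _ MN.
Qed.

Lemma wi_xM : wi * x M = q^-1 *: (x 0%N * wi).
Proof.
have := intertwine_sym w_wi wi_w w_x0; rewrite -scaleAr => E.
by rewrite -E scalerA mulVf // scale1r.
Qed.

Lemma y_wE j : (j < N)%N -> y j = tup j M * (w * tdnI 0 j).
Proof.
elim: j => [|j IH] Hj.
  by rewrite /tdnI big_geq // mulr1 -y0E.
rewrite -(dty D Hj) IH ?(ltnW Hj) // /tup big_ltn; last by rewrite /M; lia.
rewrite -!mulrA (mulA20 (dVt D Hj)); congr (_ * (_ * _)).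
by rewrite /tdnI big_nat_recr.
Qed.

Lemma yi_wE j : (j < N)%N -> yi j = tdn 0 j * (wi * tupI j M).
Proof.
move=> Hj; rewrite -[RHS]mulr1 -(dyV D Hj) [in RHS]y_wE // -!mulrA.
rewrite (mulA20 (tupIl j MN)) (mulA20 wi_w) (mulA20 (tdnIr 0 Hj)) //.
Qed.

(** * Symmetric functions of the variables *)

Definition xz j n : A := zpow (x j) (xi j) n.

Lemma xzD j m n : (j < N)%N -> xz j (m + n) = xz j m * xz j n.
Proof. by move=> Hj; apply: zpowD; [exact: dxV D _ Hj | exact: dVx D _ Hj]. Qed.

Lemma xz_xz j k m n : (j < N)%N -> (k < N)%N ->
  xz j m * xz k n = xz k n * xz j m.
Proof.
move=> Hj Hk; have C : GRing.comm (x j) (x k) by exact: dxxC D _ _ Hj Hk.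
have C2 a : GRing.comm a (x k) -> GRing.comm a (xz k n).
  by move=> Ca; apply: comm_zpow => //; apply: xi_comm.
apply/commr_sym; apply: comm_zpow; first exact/commr_sym/C2.
by apply: xi_comm => //; apply/commr_sym/C2.
Qed.

Lemma xz_tcomm i k n : (i.+1 < N)%N -> (k < N)%N -> k != i -> k != i.+1 ->
  GRing.comm (t i) (xz k n).
Proof.
move=> Hi Hk n1 n2; apply: comm_zpow; exact/commr_sym/x_comm + exact/commr_sym/xi_tcomm.
Qed.

Lemma hecke_sum_comm (T a : A) : T * T = 1 + h *: T ->
  GRing.comm T (a + T * a * T).
Proof.
move=> TT; apply/subr0_eq.
rewrite mulrDr mulrDl.
have -> : T * (T * a * T) = (1 + h *: T) * (a * T) by rewrite -TT !mulrA.
have -> : T * a * T * T = T * a * (1 + h *: T) by rewrite -TT !mulrA.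
by nc.
Qed.

(** Symmetric Laurent polynomials in two neighbouring variables commute with the
    Hecke generator that exchanges them. For power sums this follows by Newton's
    recursion from x i + x i.+1 and the product x i * x i.+1, which is also used
    to reach the negative exponents. *)
Lemma xz_pair i n : (i.+1 < N)%N -> GRing.comm (t i) (xz i n + xz i.+1 n).
Proof.
move=> Hi; have Hi' : (i < N)%N by lia.
pose f n := xz i n + xz i.+1 n; rewrite -/(f n).
pose e := x i * x i.+1; pose e' := xi i * xi i.+1.
have xx : x i * x i.+1 = x i.+1 * x i by exact: dxxC D _ _ Hi' Hi.
have Ce : GRing.comm (t i) e.
  by rewrite /GRing.comm /e mulrA t_x // -mulrA -x_t // mulrA xx.
have ee' : e * e' = 1.
  by rewrite /e /e' xx -mulrA (mulA20 (dxV D Hi')) (dxV D Hi).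
have e'e : e' * e = 1.
  rewrite /e /e' xx.
  by rewrite -mulrA (mulA20 (dVx D Hi)) (dVx D Hi').
have Ce' : GRing.comm (t i) e' by apply: comm_inv Ce.
have f1 : GRing.comm (t i) (f 1).
  rewrite /f /xz !zpow1 -(dtx D Hi); apply: hecke_sum_comm; exact: tt.
have rec k : f k.+2%:Z = f 1 * f k.+1%:Z - e * f k.
  rewrite /f -[xz i 1]/(x i) -[xz i.+1 1]/(x i.+1) /xz /zpow /e.
  rewrite !(exprS _ k.+1) !(exprS _ k) !mulrDl !mulrDr !mulrA -xx.
  by nc.
have P k : GRing.comm (t i) (f (Posz k)).
  suff [] : GRing.comm (t i) (f (Posz k)) /\ GRing.comm (t i) (f k.+1%:Z) by [].
  elim: k => [|k [IH1 IH2]].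
    split=> //; rewrite /f /xz /zpow !expr0; apply: commrD; exact: commr1.
  split=> //; rewrite rec; apply: commrB; apply: commrM => //.
case: n => k; first exact: P.
have -> : f (Negz k) = e' ^+ k.+1 * f (Posz k.+1).
  have C a b : a * b = b * a :> A -> GRing.comm (a ^+ k.+1) (b ^+ k.+1).
    by move=> E; apply/commrX/commr_sym/commrX/commr_sym.
  have X1 : xi i * xi i.+1 = xi i.+1 * xi i.
    by have := xz_xz (-1) (-1) Hi' Hi.
  have V j : (j < N)%N -> xi j ^+ k.+1 * x j ^+ k.+1 = 1.
    move=> Hj; rewrite -exprMn_comm ?(dVx D Hj) ?expr1n //.
    by rewrite /GRing.comm (dVx D Hj) (dxV D Hj).
  rewrite /f /xz /zpow /e' exprMn_comm // mulrDr addrC.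
  rewrite -[X in _ = _ + X]mulrA V // mulr1; congr (_ + _).
  by rewrite (C _ _ X1) -mulrA V // mulr1.
by apply: commrM => //; apply: commrX.
Qed.

Definition psum n : A := \sum_(0 <= j < N) xz j n.

(** A sum over all indices commutes with t i as soon as the two terms that t i
    exchanges do so together. *)
Lemma sum_tcomm (f : nat -> A) i : (i.+1 < N)%N ->
  GRing.comm (t i) (f i + f i.+1) ->
  (forall k, (k < N)%N -> k != i -> k != i.+1 -> GRing.comm (t i) (f k)) ->
  GRing.comm (t i) (\sum_(0 <= j < N) f j).
Proof.
move=> Hi H2 H; rewrite (@big_cat_nat _ _ _ i) //=; last by lia.
rewrite (big_ltn (ltnW Hi)) (big_ltn Hi).
apply: commrD.
  by apply: comm_sum_seq => k; rewrite mem_index_iota => Hk; apply: H; lia.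
rewrite addrA; apply: commrD => //.
by apply: comm_sum_seq => k; rewrite mem_index_iota => Hk; apply: H; lia.
Qed.

Lemma psum_t i n : (i.+1 < N)%N -> GRing.comm (t i) (psum n).
Proof.
move=> Hi; apply: sum_tcomm => //; first exact: xz_pair.
by move=> k Hk n1 n2; apply: xz_tcomm.
Qed.

Lemma psum_xz j m n : (j < N)%N -> GRing.comm (xz j m) (psum n).
Proof.
move=> Hj; apply: comm_sum_seq => k; rewrite mem_index_iota => /andP[_ Hk].
exact: xz_xz.
Qed.

Lemma w_xz j n : (j.+1 < N)%N -> w * xz j.+1 n = xz j n * w.
Proof. by move=> Hj; apply: zpow_intertwine; [exact: w_x|exact: w_xi]. Qed.

Lemma w_xz0 n : w * xz 0 n = (q ^ n *: xz M n) * w.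
Proof. by rewrite -zpowZ; apply: zpow_intertwine; [exact: w_x0|exact: w_xi0]. Qed.

(** The factor tup 0 M of Y_1 commutes with symmetric functions and w rotates
    the variables, so that only the term with the factor q^n is changed. *)
Lemma psum_y0 n :
  psum n * y 0%N = y 0%N * (psum n + (q ^ (- n) - 1) *: xz 0 n).
Proof.
have C : GRing.comm (psum n) (tup 0 M).
  by apply: tup_comm => i Hi; apply/commr_sym/psum_t; move: Hi; rewrite /M; lia.
rewrite y0E mulrA C -!mulrA; congr (_ * _).
have -> : psum n + (q ^ (- n) - 1) *: xz 0 n
    = q ^ (- n) *: xz 0 n + \sum_(1 <= j < N) xz j n.
  rewrite /psum (big_ltn N_gt0); set s := \sum_(_ <= _ < _) _.
  by nc.
rewrite mulrDr -scaleAr w_xz0 -scaleAl scalerA -expfzDr // addNr scale1r.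
rewrite /psum -{1}(prednK N_gt0) big_nat_recr //= -/M mulrDl addrC.
congr (_ + _); rewrite -{1}(prednK N_gt0) big_add1 /= -/M mulr_suml mulr_sumr.
rewrite big_nat [RHS]big_nat; apply: eq_bigr => j /andP[_ Hj].
by rewrite w_xz //; move: Hj; rewrite /M; lia.
Qed.

Lemma yi0_psum n :
  yi 0%N * psum n = (psum n + (q ^ (- n) - 1) *: xz 0 n) * yi 0%N.
Proof.
rewrite -[LHS]mulr1 -(dyV D N_gt0) -!mulrA (mulA22 (psum_y0 n)).
by rewrite (mulA20 (dVy D N_gt0)).
Qed.

Definition ysum : A := \sum_(0 <= j < N) y j.
Definition yisum : A := \sum_(0 <= j < N) yi j.

Lemma ysum_t i : (i.+1 < N)%N -> GRing.comm (t i) ysum.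
Proof.
move=> Hi; apply: sum_tcomm => //.
  by rewrite addrC -(tyt Hi); apply: hecke_sum_comm; exact: tt.
by move=> k Hk n1 n2; apply/commr_sym/y_comm.
Qed.

Lemma yi_S i : (i.+1 < N)%N -> yi i.+1 = t i * yi i * t i.
Proof.
move=> Hi; have Hi' : (i < N)%N by lia.
rewrite -[RHS]mulr1 -(dyV D Hi) -(dty D Hi) -!mulrA.
by rewrite (mulA20 (dtV D Hi)) (mulA20 (dVy D Hi')) (mulA20 (dtV D Hi)).
Qed.

Lemma yisum_t i : (i.+1 < N)%N -> GRing.comm (t i) yisum.
Proof.
move=> Hi; apply: sum_tcomm => //.
  by rewrite (yi_S Hi); apply: hecke_sum_comm; exact: tt.
by move=> k Hk n1 n2; apply/commr_sym/yi_tcomm.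
Qed.

Lemma y_yi j k : (j < N)%N -> (k < N)%N -> GRing.comm (y j) (yi k).
Proof. by move=> Hj Hk; apply: yi_comm => //; exact: dyyC D _ _ Hj Hk. Qed.

Lemma yi_yi j k : (j < N)%N -> (k < N)%N -> GRing.comm (yi j) (yi k).
Proof. by move=> Hj Hk; apply/yi_comm/commr_sym/y_yi. Qed.

(** The error term in the commutation of the inverse of Y_j with X_1, up to the
    factors h and X_1. *)
Definition ycorr j : A := tdn 1 j * (wi * tupI j M).

Lemma x_tupI n : (n < N)%N -> x n * tupI 0 n = tdn 0 n * x 0%N.
Proof.
elim: n => [|n IH] Hn; first by rewrite /tupI /tdn !prod_rev_geq // mul1r mulr1.
rewrite /tupI /tdn !prod_rev_recr // -/(tupI 0 n) -/(tdn 0 n) (mulA22 (esym (t_x Hn))).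
by rewrite IH ?mulrA // ltnW.
Qed.

Lemma yi_x0 j : (0 < j < N)%N ->
  yi j * x 0%N = x 0%N * yi j + h *: (ycorr j * x 0%N).
Proof.
move=> /andP[j0 Hj]; have N1 : (1 < N)%N by lia.
have E : tdn 0 j = tdn 1 j * t 0%N.
  by rewrite /tdn prod_rev_recl.
have C1 : GRing.comm (x 0%N) (tupI j M).
  by apply: tupI_comm MN _ => i Hi; apply: x_comm; move: Hi; rewrite /M; lia.
have C2 : GRing.comm (x 0%N) (tdn 1 j).
  by apply: tdn_comm => i Hi; apply: x_comm; move: Hi; lia.
have X : t 0%N * (wi * x 0%N) = (x 0%N * t 0%N + h *: x 1%N) * wi.
  rewrite wi_x // -{1}(dtx D N1) !mulrA tt //; congr (_ * _).
  rewrite -[in RHS](dtx D N1).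
  by nc.
rewrite yi_wE // /ycorr E -!mulrA -C1 [wi * (x _ * _)]mulrA.
rewrite [t 0%N * (_ * _)]mulrA X -!mulrA mulrDl mulrDr -!mulrA.
rewrite (mulA22 (esym C2)); congr (_ + _).
by rewrite -scaleAl -scaleAr (mulA22 (wi_x N1)).
Qed.

(** X_1 is carried through the factor tupI 0 M of the inverse of Y_1 step by
    step: B n is the position after n steps, and each step costs one of the
    error terms. *)
Lemma yi0_x0 :
  yi 0%N * x 0%N = q^-1 *: (x 0%N * yi 0%N)
                   - h *: \sum_(1 <= j < N) (ycorr j * x 0%N).
Proof.
pose B n := wi * (tupI n M * (x n * tupI 0 n)).
have B0 : B 0%N = yi 0%N * x 0%N.
  by rewrite /B yi0E {2}/tupI prod_rev_geq // mulr1 mulrA.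
have BM : B M = q^-1 *: (x 0%N * yi 0%N).
  rewrite /B {1}/tupI prod_rev_geq // mul1r mulrA wi_xM -scaleAl.
  by rewrite -mulrA -yi0E.
have BS n : (n < M)%N -> B n = B n.+1 - h *: (ycorr n.+1 * x 0%N).
  move=> Hn; have Hn1 : (n.+1 < N)%N by move: Hn; rewrite /M; lia.
  have Hn0 : (n < N)%N by lia.
  have E1 : tupI n M = tupI n.+1 M * ti n.
    by rewrite /tupI prod_rev_recl.
  have E2 : tupI 0 n.+1 = ti n * tupI 0 n.
    by rewrite /tupI prod_rev_recr.
  have E3 : ti n * (x n * tupI 0 n)
      = x n.+1 * tupI 0 n.+1 - h *: (tdn 0 n * x 0%N).
    rewrite -x_tupI // E2 [X in _ = X - _]mulrA -t_x // [ti n in LHS]tiE //.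
    by nc.
  have C : GRing.comm (tupI n.+1 M) (tdn 0 n).
    apply: tdn_comm => i Hi; apply/commr_sym/tupI_comm; first exact: MN.
    by move=> k Hk; apply: tk_comm; move: Hi Hk; rewrite /M; lia.
  have E4 k : (k < M)%N -> wi * tdn 0 k = tdn 1 k.+1 * wi.
    elim: k => [|k IH] Hk; first by rewrite /tdn !prod_rev_geq // mul1r mulr1.
    have -> : tdn 0 k.+1 = t k * tdn 0 k by rewrite /tdn prod_rev_recr.
    have -> : tdn 1 k.+2 = t k.+1 * tdn 1 k.+1 by rewrite /tdn prod_rev_recr.
    rewrite mulrA wi_t; last by move: Hk; rewrite /M; lia.
    by rewrite -!mulrA IH // ltnW.
  rewrite /B E1 -!mulrA E3 mulrBr mulrBr; congr (_ - _).
  rewrite -!scaleAr; congr (_ *: _).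
  by rewrite [tupI _ _ * _]mulrA C -!mulrA mulrA E4 // -!mulrA.
rewrite -BM -B0.
have : (M <= M)%N by [].
rewrite -[in X in _ - _ *: X](prednK N_gt0) -/M big_add1 /=.
elim: {-2}(M) => [|n IH] Hn; first by rewrite big_geq // scaler0 subr0.
by rewrite big_nat_recr //= [X in h *: X]addrC scalerDr opprD addrA -BS // -IH // ltnW.
Qed.

(** The error terms of [yi_x0] and of [yi0_x0] cancel in the sum. *)
Lemma yisum_x0 :
  yisum * x 0%N = x 0%N * yisum + (q^-1 - 1) *: (x 0%N * yi 0%N).
Proof.
rewrite /yisum (big_ltn N_gt0) mulrDl mulrDr yi0_x0 mulr_suml mulr_sumr.
have -> : \sum_(1 <= j < N) yi j * x 0%N
  = \sum_(1 <= j < N) x 0%N * yi j + h *: \sum_(1 <= j < N) (ycorr j * x 0%N).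
  rewrite scaler_sumr -big_split; apply: eq_big_nat => j Hj /=.
  exact: yi_x0.
set s := \sum_(_ <= _ < _) _; set s' := \sum_(_ <= _ < _) _.
by nc.
Qed.

(** The error term in the commutation of Y_j with the inverse of X_1. *)
Definition ycorr' j : A := tup j M * (w * tdnI 1 j).

Lemma x_xi i : (i.+1 < N)%N -> t i * xi i.+1 = xi i * ti i.
Proof.
move=> Hi; have Hi' : (i < N)%N by lia.
rewrite -[LHS]mul1r -(dVx D Hi') -!mulrA; congr (_ * _).
by rewrite (mulA22 (x_t Hi)) (dxV D Hi) mulr1.
Qed.

Lemma ti_xi i : (i.+1 < N)%N -> ti i * xi i = xi i.+1 * t i.
Proof.
move=> Hi; have Hi' : (i < N)%N by lia.
rewrite -[LHS]mul1r -(dVx D Hi) -!mulrA (mulA22 (esym (t_x Hi))).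
by rewrite (dxV D Hi') mulr1.
Qed.

Lemma y_xi0 j : (0 < j < N)%N ->
  y j * xi 0%N = xi 0%N * y j + h *: (xi 0%N * ycorr' j).
Proof.
move=> /andP[j0 Hj]; have N1 : (1 < N)%N by lia.
have E : tdnI 0 j = ti 0%N * tdnI 1 j by rewrite /tdnI big_ltn.
have C1 : GRing.comm (xi 0%N) (tup j M).
  by apply: tup_comm => i Hi; apply: xi_tcomm; move: Hi; rewrite /M; lia.
have C2 : GRing.comm (xi 0%N) (tdnI 1 j).
  by apply: tdnI_comm => // i Hi; apply: xi_tcomm; move: Hi; lia.
have X : w * (ti 0%N * xi 0%N) = xi 0%N * (w * ti 0%N + h *: w).
  have -> : ti 0%N * xi 0%N = xi 1%N * (ti 0%N + h *: (1 : A)).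
    by rewrite ti_xi // tiE // subrK.
  by rewrite mulrA w_xi // -!mulrA mulrDr -scaleAr mulr1.
have X' Z : w * (ti 0%N * (xi 0%N * Z))
    = xi 0%N * (w * (ti 0%N * Z) + h *: (w * Z)).
  by move: (congr1 ( *%R^~ Z) X); rewrite !mulrA => ->; nc.
rewrite y_wE // /ycorr' E -!mulrA -C2 X' (mulA22 (esym C1)).
by nc.
Qed.

Lemma y0_xi0 :
  y 0%N * xi 0%N = q^-1 *: (xi 0%N * y 0%N)
                   - (q^-1 * h) *: \sum_(1 <= j < N) (xi 0%N * ycorr' j).
Proof.
pose B n := tup 0 n * (xi n * (tup n M * w)).
have B0 : B 0%N = xi 0%N * y 0%N.
  by rewrite /B /tup big_geq // mul1r -/(tup 0 M) -y0E.
have BM : q^-1 *: B M = y 0%N * xi 0%N.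
  rewrite /B {2}/tup big_geq // mul1r scaleAr scaleAl -w_xi0 mulrA -y0E //.
have BS n : (n < M)%N -> B n.+1 = B n - h *: (xi 0%N * ycorr' n.+1).
  move=> Hn; have Hn1 : (n.+1 < N)%N by move: Hn; rewrite /M; lia.
  have E1 : tup n M = t n * tup n.+1 M by rewrite /tup big_ltn.
  have E2 k : tup 0 k.+1 = tup 0 k * t k by rewrite /tup big_nat_recr.
  have E2' k : tdnI 0 k.+1 = tdnI 0 k * ti k by rewrite /tdnI big_nat_recr.
  have E3 k : (k < N)%N -> tup 0 k * xi k = xi 0%N * tdnI 0 k.
    elim: k => [|k IH] Hk; first by rewrite /tup /tdnI !big_geq // mul1r mulr1.
    by rewrite E2 E2' -mulrA x_xi // !mulrA IH // ltnW.
  have C : GRing.comm (tup n.+1 M) (tdnI 0 n).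
    apply: tdnI_comm; first by lia.
    move=> i Hi; apply/commr_sym/tup_comm.
    by move=> k Hk; apply: tk_comm; move: Hi Hk; rewrite /M; lia.
  have E4 k : (k < M)%N -> tdnI 0 k * w = w * tdnI 1 k.+1.
    elim: k => [|k IH] Hk; first by rewrite /tdnI !big_geq // mul1r mulr1.
    rewrite E2' [tdnI 1 k.+2]/tdnI big_nat_recr //= -/(tdnI 1 k.+1) mulrA -IH ?(ltnW Hk) //.
    by rewrite -!mulrA w_ti //; move: Hk; rewrite /M; lia.
  rewrite /ycorr' -E4 // [tup _ _ * (_ * _)]mulrA C !mulrA -E3 ?(ltnW Hn1) //.
  rewrite /B E2 E1 -!mulrA (mulA22 (x_xi Hn1)) [ti n]tiE //.
  by nc.
rewrite -BM -B0 -scalerA -scalerBr; congr (_ *: _).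
have : (M <= M)%N by [].
rewrite -[in X in _ - _ *: X](prednK N_gt0) -/M big_add1 /=.
elim: {-2}(M) => [|n IH] Hn; first by rewrite big_geq // scaler0 subr0.
by rewrite big_nat_recr //= scalerDr opprD addrA -IH ?(ltnW Hn) // -BS.
Qed.

Lemma ysum_xi0 :
  ysum * xi 0%N = xi 0%N * ysum + (1 - q) *: (y 0%N * xi 0%N).
Proof.
rewrite /ysum (big_ltn N_gt0) mulrDl mulrDr mulr_suml mulr_sumr y0_xi0.
have -> : \sum_(1 <= j < N) y j * xi 0%N
  = \sum_(1 <= j < N) xi 0%N * y j + h *: \sum_(1 <= j < N) (xi 0%N * ycorr' j).
  rewrite scaler_sumr -big_split; apply: eq_big_nat => j Hj /=.
  exact: y_xi0.
set s := \sum_(_ <= _ < _) _; set s' := \sum_(_ <= _ < _) _.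
by ncf.
Qed.

End Relations.

(** * Products in the spherical subalgebra *)

(** The sum over all permutations enters the computations of products only
    through these properties, which are proved in [hecke_symmetrizer]. *)
Record symmetrizer (K : fieldType) (v : K) (N : nat) (A : pzalg K)
    (t : nat -> kalg A) (S : kalg A) : Prop := Symmetrizer {
  sym_tl : forall i, (i.+1 < N)%N -> t i * S = v *: S;
  sym_tr : forall i, (i.+1 < N)%N -> S * t i = v *: S;
  sym_fix : forall z, (forall i, (i.+1 < N)%N -> t i * z = v *: z) -> S * z = z;
  sym_comm : forall z, (forall i, (i.+1 < N)%N -> GRing.comm z (t i)) ->
    GRing.comm z S
}.

(** The quantum integer v^0 + v^2 + ... + v^(2n-2). *)
Definition qnum (K : fieldType) (v : K) (n : nat) : K :=
  \sum_(0 <= k < n) v ^+ (2 * k).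

Lemma qnumS (K : fieldType) (v : K) n : qnum v n.+1 = qnum v n + v ^+ (2 * n).
Proof. by rewrite /qnum big_nat_recr. Qed.

Lemma qnum_recl (K : fieldType) (v : K) n : qnum v n.+1 = 1 + v ^+ 2 * qnum v n.
Proof.
rewrite /qnum big_nat_recl // muln0 expr0 mulr_sumr; congr (_ + _).
by apply: eq_bigr => k _; rewrite -exprD mulnS.
Qed.

Lemma qnum_geom (K : fieldType) (v : K) n :
  v ^+ (2 * n) = 1 + (v ^+ 2 - 1) * qnum v n.
Proof.
elim: n => [|n IH]; first by rewrite /qnum big_geq // muln0 expr0 mulr0 addr0.
by rewrite qnumS IH mulnS exprD IH; ring.
Qed.

Section Spherical.

Variables (K : fieldType) (q v : K) (N : nat) (A0 : pzalg K).
Local Notation A := (kalg A0).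
Variables t ti x xi y yi : nat -> A.
Hypothesis D : daha_family q v N t ti x xi y yi.
Let N_gt0 := daha_N D.
Let v_neq0 := daha_v D.
Let q_neq0 := daha_q D.
Variable S : A.
Hypothesis SS : symmetrizer v N t S.
Hypothesis qN_neq0 : qnum v N != 0.

Local Notation h := (v - v^-1).
Local Notation M := N.-1.
Local Notation tdn := (tdn t).
Local Notation xz := (xz x xi).
Local Notation psum := (psum N x xi).
Local Notation ysum := (ysum N y).
Local Notation yisum := (yisum N yi).
Let n1 := qnum v M.

Let qN : qnum v N = 1 + v ^+ 2 * n1.
Proof. by rewrite -{1}(prednK N_gt0) qnum_recl. Qed.

Let S_t i (Hi : (i.+1 < N)%N) : S * t i = v *: S := sym_tr SS Hi.
Let t_S i (Hi : (i.+1 < N)%N) : t i * S = v *: S := sym_tl SS Hi.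

Lemma S_S : S * S = S.
Proof. exact: (sym_fix SS t_S). Qed.

Lemma ti_S i : (i.+1 < N)%N -> ti i * S = v^-1 *: S.
Proof.
move=> Hi; rewrite -[S in LHS]scale1r -(mulVf v_neq0) -scalerA -(t_S Hi).
by rewrite -scaleAr (mulA20 (dVt D Hi)).
Qed.

Lemma S_ti i : (i.+1 < N)%N -> S * ti i = v^-1 *: S.
Proof.
move=> Hi; rewrite -[S in LHS]scale1r -(mulVf v_neq0) -scalerA -(S_t Hi).
by rewrite -scaleAl -mulrA (dtV D Hi) mulr1.
Qed.

(** Elements that commute with t 1, t 2, ...; for these a product a S b is
    computed within rank two. *)
Definition tail_comm (a : A) : Prop :=
  forall i, (0 < i)%N -> (i.+1 < N)%N -> GRing.comm a (t i).

Lemma tail_commM a b : tail_comm a -> tail_comm b -> tail_comm (a * b).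
Proof.
by move=> Ca Cb i i0 Hi; apply/commr_sym/commrM; apply/commr_sym; auto.
Qed.

Lemma tail_comm1 : tail_comm 1.
Proof. by move=> i _ _; apply/commr_sym/commr1. Qed.

Lemma tail_comm_y0 : tail_comm (y 0%N).
Proof. by move=> i i0 Hi; apply: (y_comm D) => //; lia. Qed.

Lemma tail_comm_yi0 : tail_comm (yi 0%N).
Proof. by move=> i i0 Hi; apply: (yi_tcomm D) => //; lia. Qed.

Lemma tail_comm_xz0 n : tail_comm (xz 0 n).
Proof. by move=> i i0 Hi; apply/commr_sym/(xz_tcomm D) => //; lia. Qed.

Lemma S_tail a i : tail_comm a -> (0 < i)%N -> (i.+1 < N)%N ->
  S * a * t i = v *: (S * a).
Proof. by move=> Ca i0 Hi; rewrite -mulrA Ca // mulrA S_t // scaleAl. Qed.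

Lemma tail_S b i : tail_comm b -> (0 < i)%N -> (i.+1 < N)%N ->
  t i * (b * S) = v *: (b * S).
Proof. by move=> Cb i0 Hi; rewrite mulrA -Cb // -mulrA t_S // scaleAr. Qed.

Lemma tdnS k : tdn 0 k.+1 = t k * tdn 0 k.
Proof. by rewrite /tdn prod_rev_recr. Qed.

(** The elements tdn 0 k are the minimal representatives of the cosets of the
    stabilizer of the first index, and z is already symmetric under that
    stabilizer. *)
Lemma sym_coset z : (forall i, (0 < i)%N -> (i.+1 < N)%N -> t i * z = v *: z) ->
  S * z = (qnum v N)^-1 *: \sum_(0 <= k < N) v ^+ k *: (tdn 0 k * z).
Proof.
move=> Hz; pose u k := tdn 0 k * z.
have uS k : u k.+1 = t k * u k by rewrite /u tdnS mulrA.
have u_far i k : (i.+1 < N)%N -> (k < N)%N -> k != i -> k != i.+1 ->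
    t i * u k = v *: u k.
  move=> Hi Hk n1' n2'; case: (ltnP k i) => ki.
    have C : GRing.comm (t i) (tdn 0 k).
      by apply: tdn_comm => j Hj; apply: (tk_comm D) => //; lia.
    by rewrite /u mulrA C -mulrA Hz // ?scaleAr //; lia.
  have {ki n1' n2'} ik : (i.+1 < k)%N by lia.
  have E : t i * tdn 0 k = tdn 0 k * t i.+1.
    elim: k ik Hk => // k IH ik Hk; rewrite tdnS.
    case: (ltnP i.+1 k) => ik'.
      have C : GRing.comm (t i) (t k) by apply: (tk_comm D) => //; lia.
      by rewrite mulrA C -!mulrA IH //; lia.
    have -> : k = i.+1 by lia.
    have C : GRing.comm (t i.+1) (tdn 0 i).
      by apply: tdn_comm => j Hj; apply: (tk_comm D) => //; lia.
    have Hi2 : (i.+2 < N)%N by lia.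
    have B := dbraid D Hi2; rewrite -!mulrA in B.
    by rewrite tdnS -!mulrA -C (mulA33 B).
  by rewrite /u mulrA E -mulrA Hz ?scaleAr //; lia.
have Su k : (k < N)%N -> S * u k = v ^+ k *: (S * z).
  elim: k => [|k IH] Hk; first by rewrite /u /tdn prod_rev_geq // mul1r scale1r.
  by rewrite uS mulrA S_t // -scaleAl IH ?(ltnW Hk) // scalerA exprS.
have Hsum : S * (\sum_(0 <= k < N) v ^+ k *: u k) = \sum_(0 <= k < N) v ^+ k *: u k.
  apply: (sym_fix SS) => i Hi.
  rewrite (@big_cat_nat _ _ _ i) //=; last by lia.
  rewrite (big_ltn (ltnW Hi)) (big_ltn Hi) !mulrDr !scalerDr.
  have far a b : (forall k, (a <= k < b)%N -> t i * u k = v *: u k) ->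
      t i * (\sum_(a <= k < b) v ^+ k *: u k)
      = v *: (\sum_(a <= k < b) v ^+ k *: u k).
    move=> H; rewrite mulr_sumr scaler_sumr; apply: eq_big_nat => k Hk.
    by rewrite -scaleAr H // !scalerA mulrC.
  congr (_ + _); first by apply: far => k Hk; apply: u_far; lia.
  rewrite addrA [RHS]addrA; congr (_ + _); last first.
    by apply: far => k Hk; apply: u_far; lia.
  rewrite -!scaleAr uS mulrA (tt D) // exprS.
  set u' := u i.
  by ncf.
have E : S * (\sum_(0 <= k < N) v ^+ k *: u k) = qnum v N *: (S * z).
  rewrite mulr_sumr /qnum scaler_suml; apply: eq_big_nat => k Hk.
  by rewrite -scaleAr Su // scalerA -exprD addnn mul2n.
by rewrite -[LHS]scale1r -(mulVf qN_neq0) -scalerA -E Hsum.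
Qed.

(** All the coset representatives except 1 are of the form t' * t 0 with t'
    a product of t 1, t 2, ..., which commute with a; they contribute the same term up to
    a power of v. *)
Lemma sym_prod a b : tail_comm a -> tail_comm b ->
  S * a * S * (b * S) = (qnum v N)^-1 *:
    (S * a * (b * S) + (v * n1) *: (S * a * t 0%N * (b * S))).
Proof.
move=> Ca Cb; rewrite -mulrA (sym_coset (z := b * S)); last first.
  by move=> i i0 Hi; exact: tail_S.
rewrite -scaleAr; congr (_ *: _).
rewrite big_ltn // expr0 scale1r mulrDr {1}/tdn prod_rev_geq // mul1r.
congr (_ + _); rewrite -{1}(prednK N_gt0) big_add1 /= mulr_sumr.
rewrite /n1 /qnum mulr_sumr scaler_suml; apply: eq_big_nat => k Hk.
have E : S * a * tdn 0 k.+1 = v ^+ k *: (S * a * t 0%N).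
  have : (k.+1 < N)%N by lia.
  elim: k {Hk} => [|k IH] Hk.
    by rewrite tdnS /tdn prod_rev_geq // mulr1 scale1r.
  rewrite tdnS mulrA S_tail // -scaleAl IH ?(ltnW Hk) // scalerA exprS //.
rewrite -scaleAr mulrA E -scaleAl scalerA; congr (_ *: _).
by rewrite exprS -mulrA -exprD addnn mul2n.
Qed.

(** The elements t j of the conjugation are absorbed by S on both sides. *)
Lemma sum_conj (U : nat -> A) a b : tail_comm a -> tail_comm b ->
  (forall j, (0 < j)%N -> (j.+1 < N)%N -> U j.+1 = t j * U j * t j) ->
  S * a * (\sum_(1 <= j < N) U j) * (b * S)
  = n1 *: (S * a * U 1%N * (b * S)).
Proof.
move=> Ca Cb HU; rewrite -{1}(prednK N_gt0) big_add1 /= mulr_sumr mulr_suml.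
rewrite /n1 /qnum scaler_suml; apply: eq_big_nat => k Hk.
have : (k.+1 < N)%N by lia.
elim: k {Hk} => [|k IH] Hk; first by rewrite muln0 expr0 scale1r.
rewrite HU // !mulrA S_tail // -!mulrA tail_S // -!scaleAr -scaleAl !mulrA.
rewrite -[_ * b * S]mulrA IH ?(ltnW Hk) // !scalerA mulrA; congr (_ *: _).
by rewrite mulnS exprD expr2.
Qed.

Lemma xzS j n : (j < N)%N -> xz j (n + 1) = x j * xz j n.
Proof. by move=> Hj; rewrite addrC (xzD D). Qed.

Lemma xzSr j n : (j < N)%N -> xz j (n + 1) = xz j n * x j.
Proof. by move=> Hj; rewrite (xzD D). Qed.

(** ** The first half current *)

Definition cure m : A := S * xz 0 m * yi 0%N * S.

(* The two terms to which sym_prod reduces the product of two currents. *)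
Let Aee m n := S * xz 0 m * yi 0%N * (xz 0 n * yi 0%N * S).
Let cee m n := S * xz 0 m * xz 1 n * (yi 1%N * yi 0%N * S).

Lemma yit_x0 : (1 < N)%N -> yi 0%N * t 0%N * x 0%N = x 1%N * (yi 0%N * t 0%N).
Proof.
move=> N1; have E := y0_x1 D N1.
apply: (@intertwine_sym _ (ti 0%N * y 0%N) (yi 0%N * t 0%N)).
- by rewrite -!mulrA (mulA20 (dyV D N_gt0)) (dVt D).
- by rewrite -!mulrA (mulA20 (dtV D N1)) (dVy D).
by rewrite -mulrA E -!mulrA (mulA20 (dVt D N1)).
Qed.

Lemma yit_xz0 n : (1 < N)%N ->
  yi 0%N * t 0%N * xz 0 n = xz 1 n * (yi 0%N * t 0%N).
Proof.
move=> N1; have E := yit_x0 N1.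
apply: zpow_intertwine => //; apply: intertwine_inv E; first exact: dxV D _ _.
exact: dVx D _ _.
Qed.

Lemma yi1_comm : (1 < N)%N -> GRing.comm (t 0%N) (yi 1%N * yi 0%N).
Proof.
move=> N1; have E := yi_S D N1.
have C : yi 1%N * yi 0%N = yi 0%N * yi 1%N by exact: (yi_yi D).
by rewrite /GRing.comm -[RHS]mulrA C [in LHS]mulrA E -!mulrA.
Qed.

Lemma yi_t_yi_S : (1 < N)%N ->
  yi 0%N * (t 0%N * (yi 0%N * S)) = v^-1 *: (yi 1%N * yi 0%N * S).
Proof.
move=> N1; have C := ti_comm D N1 (commr_sym (yi1_comm N1)).
have -> : yi 0%N * (t 0%N * (yi 0%N * S)) = ti 0%N * (yi 1%N * yi 0%N) * S.
  by rewrite (yi_S D N1) -!mulrA (mulA20 (dVt D N1)).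
by rewrite -C -mulrA ti_S // -scaleAr.
Qed.

Let n1_0 : ~~ (1 < N)%N -> n1 = 0.
Proof. by move=> N1; rewrite /n1 /qnum big_geq //; lia. Qed.

Let pN : v ^+ (2 * M) = 1 + (v ^+ 2 - 1) * n1.
Proof. exact: qnum_geom. Qed.

Lemma cure_mul m n :
  cure m * cure n = (qnum v N)^-1 *: (Aee m n + n1 *: cee m n).
Proof.
have -> : cure m * cure n
    = S * (xz 0 m * yi 0%N) * S * (xz 0 n * yi 0%N * S).
  by rewrite /cure !mulrA -[_ * S * S]mulrA S_S.
have T k : tail_comm (xz 0 k * yi 0%N).
  by apply: tail_commM; [exact: tail_comm_xz0 | exact: tail_comm_yi0].
rewrite sym_prod //; congr (_ *: (_ + _)); first by rewrite /Aee !mulrA.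
have [N1|/n1_0 ->] := boolP (1 < N)%N; last by rewrite mulr0 !scale0r.
have -> : S * (xz 0 m * yi 0%N) * t 0%N * (xz 0 n * yi 0%N * S)
    = S * xz 0 m * (yi 0%N * t 0%N * xz 0 n) * (yi 0%N * S).
  by rewrite !mulrA.
rewrite yit_xz0 // -!mulrA yi_t_yi_S // -!scaleAr scalerA /cee !mulrA.
by congr (_ *: _); field.
Qed.

(** The elements U j measure the failure of X_1 and Y_1 to commute. Their sum is
    known from the commutation with the symmetric function X_1 + ... + X_N, and
    [sum_conj] replaces all of them by U 1, which the rank two relations turn
    into a multiple of [cee]. *)
Let Aee_rec m n :
  Aee m (n + 1) = q^-1 *: Aee (m + 1) n - (h * n1 / v) *: cee m (n + 1).
Proof.
pose U j := x j * yi 0%N - yi 0%N * x j.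
have E : yi 0%N * x 0%N
    = q^-1 *: (x 0%N * yi 0%N) + \sum_(1 <= j < N) U j.
  have := yi0_psum D 1.
  rewrite -[psum 1]/(\sum_(0 <= j < N) x j) (big_ltn N_gt0) mulrDr !mulrDl mulr_sumr mulr_suml.
  rewrite -[xz 0 1]/(x 0%N) sumrB => /(canRL (addrK _)) ->.
  rewrite exprN1; set s1 := \sum_(_ <= _ < _) (x _ * _).
  set s2 := \sum_(_ <= _ < _) (_ * x _).
  by nc.
have US j : (0 < j)%N -> (j.+1 < N)%N -> U j.+1 = t j * U j * t j.
  move=> j0 Hj; rewrite /U -(dtx D Hj).
  have C : GRing.comm (yi 0%N) (t j) by exact: tail_comm_yi0.
  by rewrite mulrBr mulrBl -!mulrA -C (mulA22 C).
rewrite /Aee (xzS n N_gt0) (xzSr m N_gt0).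
have -> : S * xz 0 m * yi 0%N * (x 0%N * xz 0 n * yi 0%N * S)
    = S * xz 0 m * (yi 0%N * x 0%N) * (xz 0 n * yi 0%N * S).
  by rewrite !mulrA.
rewrite E mulrDr mulrDl; congr (_ + _).
  rewrite -scaleAr -scaleAl; congr (_ *: _).
  by rewrite !mulrA.
have T k : tail_comm (xz 0 k * yi 0%N).
  by apply: tail_commM; [exact: tail_comm_xz0 | exact: tail_comm_yi0].
rewrite (sum_conj (tail_comm_xz0 m) (T n) US).
have [N1|/n1_0 ->] := boolP (1 < N)%N; last first.
  by rewrite mulr0 mul0r !scale0r oppr0.
have U1 : U 1%N = - h *: (yi 0%N * t 0%N * x 0%N).
  have X : x 1%N * yi 0%N = yi 0%N * t 0%N * x 0%N * ti 0%N.
    by rewrite yit_x0 // -!mulrA (dtV D N1) mulr1.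
  by rewrite /U X -(dtx D N1) (tiE D N1); nc.
rewrite U1; have -> : x 0%N = xz 0 1 by [].
rewrite yit_xz0 // -scaleAr -scaleAl.
have -> : S * xz 0 m * (xz 1 1 * (yi 0%N * t 0%N)) * (xz 0 n * yi 0%N * S)
    = S * xz 0 m * xz 1 1 * (yi 0%N * t 0%N * xz 0 n) * (yi 0%N * S).
  by rewrite !mulrA.
rewrite yit_xz0 // -!mulrA yi_t_yi_S // -!scaleAr scalerA /cee.
rewrite (xzS n N1) !mulrA scalerA -scaleNr; congr (_ *: _).
by field.
Qed.

Lemma xz_sym m n : (1 < N)%N ->
  GRing.comm (t 0%N) (xz 0 m * xz 1 n + xz 0 n * xz 1 m).
Proof.
move=> N1; have E (k l : int) : xz 0 (k + l) = xz 0 k * xz 0 l by apply: (xzD D).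
have E1 (k l : int) : xz 1 (k + l) = xz 1 k * xz 1 l by apply: (xzD D).
have C k l : xz 0 k * xz 1 l = xz 1 l * xz 0 k by apply: (xz_xz D).
have -> : xz 0 m * xz 1 n + xz 0 n * xz 1 m
    = xz 0 n * xz 1 n * (xz 0 (m - n) + xz 1 (m - n)).
  have a1 : n + (m - n) = m by lia.
  rewrite mulrDr -!mulrA -E1 -(C (m - n) n).
  by rewrite [xz 0 n * (xz 0 _ * _)]mulrA -E !a1.
apply: commrM; last exact: (xz_pair D).
have xx : x 0%N * x 1%N = x 1%N * x 0%N by exact: dxxC D _ _ _ _.
have ii : xi 0%N * xi 1%N = xi 1%N * xi 0%N by exact: (C (-1) (-1)).
have -> : xz 0 n * xz 1 n = zpow (x 0%N * x 1%N) (xi 0%N * xi 1%N) n.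
  by case: n {E E1 C} => k; rewrite /xz /zpow exprMn_comm.
have Cx : GRing.comm (t 0%N) (x 0%N * x 1%N).
  by rewrite /GRing.comm mulrA (t_x D) // -mulrA -(x_t D) // mulrA xx.
apply: comm_zpow => //; apply: comm_inv Cx.
  by rewrite xx -mulrA (mulA20 (dxV D N_gt0)) (dxV D N1).
by rewrite ii -mulrA (mulA20 (dVx D N_gt0)) (dVx D N1).
Qed.

(** Moving t 0 through a function of the first two variables that stands next
    to the symmetrizer. *)
Lemma S_x1 k g : (1 < N)%N -> GRing.comm (t 0%N) k -> GRing.comm (t 0%N) g ->
  S * x 1%N * k * (g * S) = v ^+ 2 *: (S * x 0%N * k * (g * S)).
Proof.
move=> N1 Ck Cg.
have E1 : S * x 0%N * t 0%N * k * (g * S) = v *: (S * x 0%N * k * (g * S)).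
  by rewrite -!mulrA (mulA22 Ck) (mulA22 Cg) t_S // -!scaleAr.
have E2 : S * x 0%N * t 0%N * k * (g * S) = v^-1 *: (S * x 1%N * k * (g * S)).
  by rewrite -!mulrA (mulA22 (x_t D N1)) (mulA21 (S_ti N1)) -scaleAl.
by rewrite expr2 -scalerA -E1 E2 scalerA divff // scale1r.
Qed.

Let cee_rec m n : (1 < N)%N ->
  cee m (n + 1) + cee n (m + 1) = v ^+ 2 *: (cee (m + 1) n + cee (n + 1) m).
Proof.
move=> N1; have C k l : xz 0 k * xz 1 l = xz 1 l * xz 0 k by apply: (xz_xz D).
have X k : xz 1 (k + 1) = x 1%N * xz 1 k by exact: xzS.
have X0 k : xz 0 (k + 1) = x 0%N * xz 0 k by exact: xzS.
have := S_x1 N1 (xz_sym m n N1) (yi1_comm N1).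
rewrite !mulrDr !mulrDl /cee !X !X0 !mulrA => <-.
have C1 k : S * xz 0 k * x 1%N = S * x 1%N * xz 0 k.
  by rewrite -mulrA -[x 1%N]/(xz 1 1) C mulrA.
by rewrite !C1.
Qed.

(** The factor z - q^-1 w of the structure function eliminates [Aee]. *)
Let cure_rec m n :
  cure m * cure (n + 1) - q^-1 *: (cure (m + 1) * cure n)
  = (n1 / qnum v N) *: (v ^- 2 *: cee m (n + 1) - q^-1 *: cee (m + 1) n).
Proof.
rewrite !cure_mul Aee_rec; set a := Aee _ _; set b := cee _ _; set c := cee _ _.
by ncf; rewrite ?v_neq0 ?q_neq0 ?qN_neq0.
Qed.

(** The three factors of the cubic structure function play different roles: one
    of them is in [r], by [cure_rec], and the product of the other two is applied
    in [T]. Then [cee_rec] makes the symmetrization vanish: it is written below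
    as an explicit combination of three instances of [cee_rec]. *)
Lemma cure_exchange m n :
  let r m n := cure m * cure (n + 1) - q^-1 *: (cure (m + 1) * cure n) in
  let T m n := r (m + 2) n - (q^-1 * v ^+ 2 + v ^- 2) *: r (m + 1) (n + 1)
               + q^-1 *: r m (n + 2) in
  T m n + T n m = 0.
Proof.
move=> r T; have rE a b : r a b
  = (n1 / qnum v N) *: (v ^- 2 *: cee a (b + 1) - q^-1 *: cee (a + 1) b).
  exact: cure_rec.
rewrite /T !rE.
have [N1|/n1_0 ->] := boolP (1 < N)%N; last by rewrite mul0r; nc.
have R a b := esym (cee_rec a b N1).
have i1 (a : int) : a + 1 + 1 = a + 2 by lia.
have i2 (a : int) : a + 2 + 1 = a + 3 by lia.
have := R (m + 2) n; have := R m (n + 2); have := R (m + 1) (n + 1).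
rewrite !i1 !i2.
move: (cee (m + 2) (n + 1)) (cee (m + 1) (n + 2)) (cee (n + 2) (m + 1)) (cee (n + 1) (m + 2)).
move: (cee (m + 3) n) (cee (n + 3) m) (cee m (n + 3)) (cee n (m + 3)).
move=> c30 d30 c03 d03 c21 c12 d21 d12 R1 R2 R3.
have E1 : c12 + d12 - v ^+ 2 *: (c21 + d21) = 0 by rewrite R1 subrr.
have E2 : c03 + d21 - v ^+ 2 *: (c12 + d30) = 0 by rewrite R2 subrr.
have E3 : c21 + d03 - v ^+ 2 *: (c30 + d12) = 0 by rewrite R3 subrr.
transitivity ((n1 / qnum v N * v ^- 2) *: (
   q^-1 *: (c03 + d21 - v ^+ 2 *: (c12 + d30)
            + (c21 + d03 - v ^+ 2 *: (c30 + d12)))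
   - (v ^- 2 + q^-1 ^+ 2 * v ^+ 2) *: (c12 + d12 - v ^+ 2 *: (c21 + d21)))).
  by ncf; rewrite ?v_neq0 ?q_neq0 ?qN_neq0.
by rewrite E1 E2 E3 addr0 !scaler0 subr0 scaler0.
Qed.

(** ** The second half current *)

Definition curf m : A := S * y 0%N * xz 0 m * S.

Let Aff m n := S * y 0%N * xz 0 m * (y 0%N * xz 0 n * S).
Let g := y 0%N * y 1%N.

(* Locked, so that rewriting does not look into the monomials. *)
Definition mono2 a b : A := locked (xz 1 a * xz 0 b).
Let mono2E a b : mono2 a b = xz 1 a * xz 0 b.
Proof. by rewrite /mono2 -lock. Qed.

Let cff m n := S * g * mono2 m n * S.
(* The term that t 0 does not exchange symmetrically. *)
Let dff m n := S * g * x 1%N * ti 0%N * mono2 m n * S.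

Let g_comm : (1 < N)%N -> GRing.comm (t 0%N) g.
Proof.
move=> N1; have E := tyt D N1.
have C : y 0%N * y 1%N = y 1%N * y 0%N by exact: dyyC D _ _ _ _.
by rewrite /GRing.comm /g {1}C -[in LHS]E -[in RHS]E !mulrA.
Qed.

Let x0_yt : (1 < N)%N -> x 0%N * (y 1%N * t 0%N) = y 1%N * t 0%N * x 1%N.
Proof.
move=> N1; have := dxy D N1; rewrite expr2 => E.
have E1 : x 0%N * y 1%N = y 1%N * t 0%N * (t 0%N * x 0%N).
  apply/esym; rewrite -[LHS]mul1r -(dxV D N_gt0) -!mulrA.
  move: (congr1 ( *%R^~ (t 0%N * (t 0%N * x 0%N))) E); rewrite -!mulrA.
  rewrite (mulA20 (dVt D N1)) (mulA20 (dVt D N1)) (dVx D N_gt0) mulr1 => ->.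
  done.
by rewrite mulrA E1 -(dtx D N1) !mulrA.
Qed.

Let curf_mul m n :
  curf m * curf n
  = (qnum v N)^-1 *: (v ^+ (2 * M) *: Aff m n + (v ^+ 2 * n1) *: cff m n).
Proof.
have -> : curf m * curf n
    = S * (y 0%N * xz 0 m) * S * (y 0%N * xz 0 n * S).
  by rewrite /curf !mulrA -[_ * S * S]mulrA S_S.
have T k : tail_comm (y 0%N * xz 0 k).
  by apply: tail_commM; [exact: tail_comm_y0 | exact: tail_comm_xz0].
rewrite sym_prod //; congr (_ *: _).
have -> : S * (y 0%N * xz 0 m) * (y 0%N * xz 0 n * S) = Aff m n.
  by rewrite /Aff !mulrA.
have [N1|/n1_0 E0] := boolP (1 < N)%N; last by rewrite pN E0; nc.
have ty : t 0%N * y 0%N = y 1%N * t 0%N + h *: y 0%N.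
  by rewrite -{1}(tyt D N1) !mulrA (tt D) // -(tyt D N1); nc.
have xyt : xz 0 m * (y 1%N * t 0%N) = y 1%N * t 0%N * xz 1 m.
  apply/esym/zpow_intertwine; first exact/esym/x0_yt.
  apply: intertwine_inv (esym (x0_yt N1)); first exact: dxV D _ _.
  exact: dVx D _ _.
have -> : S * (y 0%N * xz 0 m) * t 0%N * (y 0%N * xz 0 n * S)
    = v *: cff m n + h *: Aff m n.
  have -> : S * (y 0%N * xz 0 m) * t 0%N * (y 0%N * xz 0 n * S)
      = S * y 0%N * xz 0 m * (t 0%N * y 0%N) * (xz 0 n * S) by rewrite !mulrA.
  rewrite ty mulrDr mulrDl -[_ * xz 0 m * (y 1%N * _)]mulrA xyt.
  have -> : S * y 0%N * (y 1%N * t 0%N * xz 1 m)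
      = S * (g * t 0%N) * xz 1 m by rewrite /g !mulrA.
  rewrite -(g_comm N1) /cff mono2E !mulrA S_t // /Aff -!scaleAl -!scaleAr !mulrA.
  by rewrite -!scaleAl.
by rewrite pN; ncf.
Qed.

(** As for [Aee_rec], but the error term G has its X_1 to the left of Y_1 Y_2. Moving X_1 to the right produces G once
    more, which yields the linear equation E3 for G, hence the power of v in the
    statement. *)
Let Aff_rec m n :
  v ^+ (2 * M) *: Aff (m + 1) n = (q^-1 * v ^+ (2 * M)) *: Aff m (n + 1)
    - (h * n1 * v ^+ 2 * q^-1) *: dff m n.
Proof.
pose U j := y 0%N * x j - x j * y 0%N.
have E : x 0%N * y 0%N
    = q^-1 *: (y 0%N * x 0%N) + \sum_(1 <= j < N) U j.
  have := psum_y0 D 1.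
  rewrite -[psum 1]/(\sum_(0 <= j < N) x j) (big_ltn N_gt0) mulrDr !mulrDl.
  rewrite mulrDr mulr_sumr mulr_suml -[xz 0 1]/(x 0%N) sumrB.
  move=> /(canRL (addrK _)) ->.
  rewrite exprN1; set s1 := \sum_(_ <= _ < _) (x _ * _).
  set s2 := \sum_(_ <= _ < _) (_ * x _).
  by nc.
have US j : (0 < j)%N -> (j.+1 < N)%N -> U j.+1 = t j * U j * t j.
  move=> j0 Hj; rewrite /U -(dtx D Hj).
  have C : GRing.comm (y 0%N) (t j) by exact: tail_comm_y0.
  by rewrite mulrBr mulrBl -!mulrA -C (mulA22 C).
have [N1|] := boolP (1 < N)%N; last first.
  move=> N1; have M0 : M = 0%N by lia.
  rewrite (n1_0 N1) M0 muln0 expr0 mulr0 !mul0r scale0r subr0 scale1r mulr1.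
  rewrite /Aff (xzS n N_gt0) (xzSr m N_gt0).
  have -> : S * y 0%N * (xz 0 m * x 0%N) * (y 0%N * xz 0 n * S)
    = S * y 0%N * xz 0 m * (x 0%N * y 0%N) * (xz 0 n * S) by rewrite !mulrA.
  rewrite E [X in _ + X]big_geq ?addr0; last by lia.
  by rewrite -scaleAr -scaleAl !mulrA.
have U1 : U 1%N = - h *: (t 0%N * x 0%N * y 0%N).
  rewrite /U (y0_x1 D N1) -(dtx D N1) (tiE D N1).
  by nc.
have [G GE] : exists G, G = S * x 0%N * g * xz 1 m * xz 0 n * S by eexists.
have E1 : Aff (m + 1) n = q^-1 *: Aff m (n + 1) - (h * n1 * v) *: G.
  rewrite /Aff (xzS n N_gt0) (xzSr m N_gt0).
  have -> : S * y 0%N * (xz 0 m * x 0%N) * (y 0%N * xz 0 n * S)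
    = S * (y 0%N * xz 0 m) * (x 0%N * y 0%N) * (xz 0 n * S) by rewrite !mulrA.
  rewrite E mulrDr mulrDl; congr (_ + _).
    by rewrite -scaleAr -scaleAl !mulrA.
  have T k : tail_comm (y 0%N * xz 0 k).
    by apply: tail_commM; [exact: tail_comm_y0 | exact: tail_comm_xz0].
  rewrite (sum_conj (T m) (tail_comm_xz0 n) US) U1.
  have X : xz 0 m * (t 0%N * x 0%N * y 0%N) = t 0%N * x 0%N * y 0%N * xz 1 m.
    have X1 : t 0%N * x 0%N * y 0%N * x 1%N = x 0%N * (t 0%N * x 0%N * y 0%N).
      rewrite -!mulrA (y0_x1 D N1) [in RHS](mulA22 (t_x D N1)) !mulrA.
      by rewrite (dtx D N1) (dxxC D N1 N_gt0).
    apply/esym/zpow_intertwine => //.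
    by apply: intertwine_inv X1; [exact: dxV D _ _ | exact: dVx D _ _].
  have Y : y 0%N * (t 0%N * x 0%N) = t 0%N * x 0%N * y 1%N.
    by rewrite [in LHS](t_x D N1) mulrA (y0_x1 D N1) -(dty D N1) !mulrA.
  rewrite -scaleAr -scaleAl scalerA.
  have -> : S * (y 0%N * xz 0 m) * (t 0%N * x 0%N * y 0%N) * (xz 0 n * S)
      = v *: G.
    have -> : S * (y 0%N * xz 0 m) * (t 0%N * x 0%N * y 0%N) * (xz 0 n * S)
        = S * y 0%N * (xz 0 m * (t 0%N * x 0%N * y 0%N)) * (xz 0 n * S).
      by rewrite !mulrA.
    rewrite X; have -> : S * y 0%N * (t 0%N * x 0%N * y 0%N * xz 1 m)
        = S * (y 0%N * (t 0%N * x 0%N)) * y 0%N * xz 1 m by rewrite !mulrA.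
    rewrite Y !mulrA S_t // -!scaleAl GE /g !mulrA; congr (_ *: _).
    by rewrite -[_ * y 1%N * y 0%N]mulrA (dyyC D (j := 1%N)) ?mulrA.
  by rewrite scalerA -scaleNr; congr (_ *: _); ring.
have E2 : v ^+ (2 * M) *: G = (q^-1 * v) *: dff m n.
  have [f fE] : exists f, f = xz 1 m * xz 0 n * S by eexists.
  have Ut j : (j.+1 < N)%N ->
      S * U j.+1 * (y 1%N * f) = - (h * (v * v ^+ (2 * j))) *: G.
    have tf i : (1 < i)%N -> (i.+1 < N)%N -> t i * (y 1%N * f) = v *: (y 1%N * f).
      move=> i1 Hi; have Cy : GRing.comm (t i) (y 1%N).
        by apply/commr_sym/(y_comm D) => //; lia.
      have C0 : GRing.comm (t i) (xz 0 n) by apply: (xz_tcomm D) => //; lia.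
      have C1 : GRing.comm (t i) (xz 1 m) by apply: (xz_tcomm D) => //; lia.
      by rewrite fE -!mulrA (mulA22 Cy) (mulA22 C1) (mulA22 C0) t_S // -!scaleAr.
    elim: j => [|[|j] IH] Hj.
    - rewrite U1 muln0 expr0 mulr1 -!scaleAr -!scaleAl !mulrA S_t //.
      by rewrite -!scaleAl scalerA GE fE /g !mulrA mulNr.
    - rewrite US // !mulrA S_t // -!scaleAl U1.
      have C : GRing.comm (x 0%N * y 0%N) (t 1%N).
        apply/commr_sym/commrM; apply/commr_sym.
          by apply: (x_comm D).
        by apply: (y_comm D).
      have -> : S * (- h *: (t 0%N * x 0%N * y 0%N)) * t 1%N * y 1%N * f
          = - (h * v ^+ 2) *: G.
        rewrite -scaleAr -!scaleAl !mulrA S_t // -!scaleAl.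
        have -> : S * x 0%N * y 0%N * t 1%N * y 1%N * f
            = S * (x 0%N * y 0%N * t 1%N) * y 1%N * f by rewrite !mulrA.
        rewrite C !mulrA S_t // -!scaleAl !scalerA GE fE /g !mulrA.
        by congr (_ *: _); ring.
      by rewrite scalerA; congr (_ *: _); ring.
    have -> : v ^+ (2 * j.+2) = v ^+ 2 * v ^+ (2 * j.+1).
      by rewrite -exprD -mulnS.
    move: IH; set e := v ^+ (2 * j.+1) => IH.
    rewrite US // !mulrA S_t // -!scaleAl.
    have -> : S * U j.+2 * t j.+2 * y 1%N * f = v *: (S * U j.+2 * (y 1%N * f)).
      by rewrite -!mulrA tf // -!scaleAr.
    rewrite IH ?(ltnW Hj) // !scalerA; congr (_ *: _).
    by ring.
  have E3 : G = q^-1 *: (v *: dff m n) - (h * v * n1) *: G.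
    have X1 : S * (y 0%N * x 0%N) * (y 1%N * f) = v *: dff m n.
      have X2 : x 0%N * y 1%N = y 1%N * t 0%N * x 1%N * ti 0%N.
        by rewrite -(x0_yt N1) -!mulrA (dtV D N1) mulr1.
      have -> : S * (y 0%N * x 0%N) * (y 1%N * f)
          = S * y 0%N * (x 0%N * y 1%N) * f by rewrite !mulrA.
      rewrite X2.
      have -> : S * y 0%N * (y 1%N * t 0%N * x 1%N * ti 0%N) * f
          = S * (g * t 0%N) * x 1%N * ti 0%N * f by rewrite /g !mulrA.
      by rewrite -(g_comm N1) !mulrA S_t // -!scaleAl /dff fE mono2E !mulrA.
    have {1}-> : G = S * (x 0%N * y 0%N) * (y 1%N * f) by rewrite GE fE /g !mulrA.
    rewrite E mulrDr mulrDl -scaleAr -scaleAl X1; congr (_ + _).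
    rewrite mulr_sumr mulr_suml.
    rewrite -{1}(prednK N_gt0) big_add1 /=.
    have -> : \sum_(0 <= j < M) S * U j.+1 * (y 1%N * f)
        = \sum_(0 <= j < M) - (h * (v * v ^+ (2 * j))) *: G.
      by apply: eq_big_nat => j /andP[_ Hj]; rewrite Ut //; lia.
    rewrite -scaler_suml -scaleNr; congr (_ *: _).
    rewrite sumrN; congr (- _); rewrite /n1 /qnum mulr_sumr.
    by apply: eq_bigr => k _; rewrite mulrA.
  transitivity (G + (h * v * n1) *: G); first by rewrite pN; ncf.
  by rewrite {1}E3 subrK scalerA.
rewrite E1 scalerBr !scalerA; congr (_ - _); first by congr (_ *: _); ring.
have -> : v ^+ (2 * M) * (h * n1 * v) = h * n1 * v * v ^+ (2 * M) by ring.
rewrite -[_ *: G]scalerA E2 !scalerA; congr (_ *: _); ring.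
Qed.

Let curf_rec m n :
  curf (m + 1) * curf n - q^-1 *: (curf m * curf (n + 1))
  = (v ^+ 2 * n1 / qnum v N) *:
    (cff (m + 1) n - q^-1 *: cff m (n + 1) - (h * q^-1) *: dff m n).
Proof.
rewrite !curf_mul Aff_rec; set a := Aff _ _; set b := cff _ _; set c := cff _ _.
by ncf; rewrite ?v_neq0 ?q_neq0 ?qN_neq0.
Qed.

(** Consequences of the invariance of Y_1 Y_2 and of k under t 0. Here k'
    stands for k S, which t 0 multiplies by v. *)
Section SymmetricMultiplier.

Variable k : A.
Hypotheses (N1 : (1 < N)%N) (Ck : GRing.comm (t 0%N) k).
Let k' := locked (k * S).
Let b u := S * g * u.

Let tk' : t 0%N * k' = v *: k'.
Proof. by rewrite /k' -lock mulrA Ck -mulrA t_S // -scaleAr. Qed.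

Let tik' : ti 0%N * k' = v^-1 *: k'.
Proof.
by rewrite /k' -lock mulrA -(ti_comm D N1 (commr_sym Ck)) -mulrA ti_S // -scaleAr.
Qed.

Let t_x0k : t 0%N * (x 0%N * k') = v^-1 *: (x 1%N * k').
Proof. by rewrite (mulA22 (t_x D N1)) tik' -scaleAr. Qed.

Let ti_x1k : ti 0%N * (x 1%N * k') = v *: (x 0%N * k').
Proof. by rewrite -(mulA22 (x_t D N1)) tk' -scaleAr. Qed.

Let ti_x0 u : ti 0%N * (x 0%N * u) = x 1%N * (ti 0%N * u) - h *: (x 0%N * u).
Proof.
by rewrite {1}(tiE D N1) mulrBl (mulA22 (t_x D N1)) -scaleAl mul1r.
Qed.

Let ti_x0k : ti 0%N * (x 0%N * k') = v^-1 *: (x 1%N * k') - h *: (x 0%N * k').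
Proof. by rewrite ti_x0 tik' -scaleAr. Qed.

Let t_x1k : t 0%N * (x 1%N * k') = v *: (x 0%N * k') + h *: (x 1%N * k').
Proof.
rewrite -ti_x1k (tiE D N1) mulrBl -scaleAl mul1r subrK //.
Qed.

Lemma b_x1 : b (x 1%N * k') = v ^+ 2 *: b (x 0%N * k').
Proof.
have E : S * g * t 0%N * (x 0%N * k') = v *: b (x 0%N * k').
  by rewrite -[S * g * t 0%N]mulrA -(g_comm N1) [S * (_ * g)]mulrA S_t // -!scaleAl.
rewrite -mulrA t_x0k -scaleAr in E.
by rewrite expr2 -scalerA -E scalerA divff // scale1r.
Qed.

Lemma b_d1 :
  b (x 1%N * (x 0%N * (x 1%N * k'))) = v ^+ 2 *: b (x 1%N * (x 0%N * (x 0%N * k'))) ->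
  b (x 1%N * (ti 0%N * (x 1%N * (x 1%N * k' - v ^+ 2 *: (x 0%N * k'))))) = 0.
Proof.
move=> E; rewrite -(mulA22 (x_t D N1)) mulrBr -scaleAr t_x1k t_x0k.
rewrite /b in E *.
have -> : S * g * (x 1%N * (x 0%N * (v *: (x 0%N * k') + h *: (x 1%N * k')
    - v ^+ 2 *: (v^-1 *: (x 1%N * k')))))
  = v *: (S * g * (x 1%N * (x 0%N * (x 0%N * k'))))
    - v^-1 *: (S * g * (x 1%N * (x 0%N * (x 1%N * k')))).
  by ncf.
by rewrite E scalerA expr2 mulKf // subrr.
Qed.

Lemma b_d2 :
  b (x 1%N * (x 0%N * (x 1%N * k'))) = v ^+ 2 *: b (x 1%N * (x 0%N * (x 0%N * k'))) ->
  b (x 1%N * (ti 0%N * (x 0%N * (x 1%N * k' - v ^+ 2 *: (x 0%N * k')))))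
  = - v *: b (x 1%N * (x 1%N * (x 1%N * k' - v ^+ 2 *: (x 0%N * k')))).
Proof.
move=> E; rewrite ti_x0 [ti 0%N * _]mulrBr -scaleAr ti_x1k ti_x0k.
have X : x 1%N * (x 0%N * (x 0%N * k')) = x 0%N * (x 1%N * (x 0%N * k')).
  by rewrite (mulA22 (dxxC D N1 N_gt0)).
have X1 : x 1%N * (x 0%N * (x 1%N * k')) = x 1%N * (x 1%N * (x 0%N * k')).
  by congr (_ * _); rewrite (mulA22 (dxxC D N_gt0 N1)).
rewrite /b X1 in E *.
apply/subr0_eq.
transitivity (- h *: (S * g * (x 1%N * (x 1%N * (x 0%N * k')))
  - v ^+ 2 *: (S * g * (x 1%N * (x 0%N * (x 0%N * k')))))); last first.
  by rewrite E subrr scaler0.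
rewrite -X1.
by ncf.
Qed.

End SymmetricMultiplier.

Let mono_x0 a b : (1 < N)%N -> x 0%N * mono2 a b = mono2 a (b + 1).
Proof.
move=> N1; rewrite !mono2E (xzS _ N_gt0) [LHS]mulrA [RHS]mulrA.
by rewrite -[x 0%N]/(xz 0 1) (xz_xz D).
Qed.

Let mono_x1 a b : (1 < N)%N -> x 1%N * mono2 a b = mono2 (a + 1) b.
Proof. by move=> N1; rewrite !mono2E (xzS _ N1) mulrA. Qed.

Let msym m n := mono2 m n + mono2 n m.

Let msym_comm m n : (1 < N)%N -> GRing.comm (t 0%N) (msym m n).
Proof.
move=> N1; rewrite /msym addrC !mono2E -!(xz_xz D _ _ N_gt0 N1).
exact: xz_sym.
Qed.

Let x0_mono2 a b c d : (1 < N)%N -> x 0%N * ((mono2 a b + mono2 c d) * S)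
  = (mono2 a (b + 1) + mono2 c (d + 1)) * S.
Proof. by move=> N1; rewrite mulrA mulrDr !mono_x0. Qed.

Let x1_mono2 a b c d : (1 < N)%N -> x 1%N * ((mono2 a b + mono2 c d) * S)
  = (mono2 (a + 1) b + mono2 (c + 1) d) * S.
Proof. by move=> N1; rewrite mulrA mulrDr !mono_x1. Qed.

Let cffD a b c d : S * g * ((mono2 a b + mono2 c d) * S) = cff a b + cff c d.
Proof. by rewrite mulrDl mulrDr /cff -!mulrA. Qed.

Let dffD a b c d :
  S * g * (x 1%N * (ti 0%N * ((mono2 a b + mono2 c d) * S))) = dff a b + dff c d.
Proof. by rewrite mulrDl !mulrDr /dff -!mulrA. Qed.

Let cff_rec m n : (1 < N)%N ->
  cff (m + 1) n + cff (n + 1) m = v ^+ 2 *: (cff m (n + 1) + cff n (m + 1)).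
Proof.
move=> N1; have := b_x1 N1 (msym_comm m n N1).
by rewrite -lock /msym x1_mono2 // x0_mono2 // !cffD.
Qed.

Let cff_rec' m n : (1 < N)%N ->
  S * g * (x 1%N * (x 0%N * (x 1%N * (msym m n * S))))
  = v ^+ 2 *: (S * g * (x 1%N * (x 0%N * (x 0%N * (msym m n * S))))).
Proof.
move=> N1; have := cff_rec (m + 1) (n + 1) N1.
by rewrite /msym !(x0_mono2, x1_mono2) // !cffD.
Qed.

Let dff_rec1 m n : (1 < N)%N ->
  dff (m + 1 + 1) n + dff (n + 1 + 1) m
  - v ^+ 2 *: (dff (m + 1) (n + 1) + dff (n + 1) (m + 1)) = 0.
Proof.
move=> N1; have := b_d1 N1 (msym_comm m n N1).
rewrite -lock => /(_ (cff_rec' m n N1)).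
rewrite !(mulrBr, =^~ scaleAr).
by rewrite /msym !(x0_mono2, x1_mono2) // !dffD.
Qed.

Let dff_rec2 m n : (1 < N)%N ->
  dff (m + 1) (n + 1) + dff (n + 1) (m + 1)
  - v ^+ 2 *: (dff m (n + 1 + 1) + dff n (m + 1 + 1))
  = - v *: (cff (m + 1 + 1 + 1) n + cff (n + 1 + 1 + 1) m
            - v ^+ 2 *: (cff (m + 1 + 1) (n + 1) + cff (n + 1 + 1) (m + 1))).
Proof.
move=> N1; have := b_d2 N1 (msym_comm m n N1).
rewrite -lock => /(_ (cff_rec' m n N1)).
rewrite !(mulrBr, =^~ scaleAr).
by rewrite /msym !(x0_mono2, x1_mono2) // !dffD !cffD.
Qed.

(** As in [cure_exchange]: the expression is a combination of [cff_rec],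
    [dff_rec1] and [dff_rec2]. *)
Lemma curf_exchange m n :
  let r m n := curf (m + 1) * curf n - q^-1 *: (curf m * curf (n + 1)) in
  let T m n := r (m + 2) n - (q * v ^- 2 + v ^+ 2) *: r (m + 1) (n + 1)
               + q *: r m (n + 2) in
  T m n + T n m = 0.
Proof.
move=> r T; have rE a b : r a b = (v ^+ 2 * n1 / qnum v N) *:
    (cff (a + 1) b - q^-1 *: cff a (b + 1) - (h * q^-1) *: dff a b).
  exact: curf_rec.
rewrite /T !rE.
have [N1|/n1_0 ->] := boolP (1 < N)%N; last by rewrite mulr0 mul0r; nc.
have R a b : cff (a + 1) b + cff (b + 1) a - v ^+ 2 *: (cff a (b + 1) + cff b (a + 1)) = 0.
  by rewrite cff_rec // subrr.
have i1 (a : int) : a + 1 + 1 = a + 2 by lia.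
have i2 (a : int) : a + 2 + 1 = a + 3 by lia.
have := dff_rec1 m n N1; have := dff_rec2 m n N1.
have := R (m + 2) n; have := R m (n + 2); have := R (m + 1) (n + 1).
rewrite !i1 !i2.
move: (cff (m + 2) (n + 1)) (cff (m + 1) (n + 2)) (cff (n + 2) (m + 1)) (cff (n + 1) (m + 2)).
move: (cff (m + 3) n) (cff (n + 3) m) (cff m (n + 3)) (cff n (m + 3)).
move: (dff (m + 2) n) (dff (n + 2) m) (dff m (n + 2)) (dff n (m + 2)).
move: (dff (m + 1) (n + 1)) (dff (n + 1) (m + 1)).
move=> d11 d11' d20 d20' d02 d02' c30 c30' c03 c03' c21 c12 c21' c12' R1 R2 R3 E2 E1.
have {}E2 : d11 + d11' - v ^+ 2 *: (d02 + d02')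
    + v *: (c30 + c30' - v ^+ 2 *: (c21 + c21')) = 0.
  by rewrite E2 scaleNr addNr.
transitivity ((v ^+ 2 * n1 / qnum v N) *: (
   v ^- 2 *: ((c30 + c12' - v ^+ 2 *: (c21 + c03'))
            + (c12 + c30' - v ^+ 2 *: (c03 + c21')))
   - (q^-1 + q * v ^- 2) *: (c21 + c21' - v ^+ 2 *: (c12 + c12'))
   - (h * q^-1) *: (d20 + d20' - v ^+ 2 *: (d11 + d11'))
   + (h * v ^- 2) *: (d11 + d11' - v ^+ 2 *: (d02 + d02')
    + v *: (c30 + c30' - v ^+ 2 *: (c21 + c21'))))).
  by ncf; rewrite ?v_neq0 ?q_neq0 ?qN_neq0.
by rewrite R1 R2 R3 E1 E2 addr0 !scaler0 !subr0 addr0 scaler0.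
Qed.

(** ** The Serre relations *)

Lemma psum_comm n : GRing.comm (psum n) S.
Proof.
by apply: (sym_comm SS) => i Hi; apply/commr_sym/(psum_t D).
Qed.

Lemma ysum_comm : GRing.comm ysum S.
Proof. by apply: (sym_comm SS) => i Hi; apply/commr_sym/(ysum_t D). Qed.

Lemma yisum_comm : GRing.comm yisum S.
Proof. by apply: (sym_comm SS) => i Hi; apply/commr_sym/(yisum_t D). Qed.

Lemma sym_sum (c : K) (f : nat -> A) :
  (forall j, (j.+1 < N)%N -> S * f j.+1 * S = c *: (S * f j * S)) ->
  S * (\sum_(0 <= j < N) f j) * S
  = (\sum_(0 <= j < N) c ^+ j) *: (S * f 0%N * S).
Proof.
move=> Hf; rewrite mulr_sumr mulr_suml scaler_suml; apply: eq_big_nat.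
move=> j /andP[_]; elim: j => [|j IH] Hj; first by rewrite expr0 scale1r.
by rewrite Hf // IH ?(ltnW Hj) // scalerA exprS.
Qed.

Lemma cure0 : cure 0 = (qnum v N)^-1 *: (yisum * S).
Proof.
have E : S * yisum * S = qnum v N *: (S * yi 0%N * S).
  rewrite (@sym_sum (v ^+ 2) yi) => [|j Hj].
    by congr (_ *: _); apply: eq_bigr => j _; rewrite exprM.
  rewrite (yi_S D Hj) !mulrA S_t // -!mulrA t_S // -!scaleAr -scaleAl scalerA.
  by rewrite !mulrA.
rewrite /cure /xz zpow0 mulr1 -[LHS]scale1r -(mulVf qN_neq0) -scalerA -E.
by rewrite -yisum_comm -mulrA S_S.
Qed.

Let qNVE : \sum_(0 <= j < N) (v ^- 2) ^+ j = v ^- (2 * M) * qnum v N.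
Proof.
  rewrite big_nat_rev /qnum mulr_sumr; apply: eq_big_nat => j Hj.
  have -> : (2 * M = 2 * j + 2 * (0 + N - j.+1))%N by lia.
  rewrite exprVn -exprM exprD invfM mulrC mulrA mulfV ?mul1r //.
  by rewrite expf_neq0.
Qed.

Lemma qNV_neq0 : \sum_(0 <= j < N) (v ^- 2) ^+ j != 0.
Proof. by rewrite qNVE mulf_neq0 // invr_eq0 expf_neq0. Qed.

Lemma curf0 :
  curf 0 = (\sum_(0 <= j < N) (v ^- 2) ^+ j)^-1 *: (ysum * S).
Proof.
have E : S * ysum * S = (\sum_(0 <= j < N) (v ^- 2) ^+ j) *: (S * y 0%N * S).
  apply: sym_sum => j Hj.
  rewrite -(dty D Hj) !mulrA S_ti // -!mulrA ti_S // -!scaleAr -scaleAl scalerA.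
  by rewrite !mulrA expr2 invfM.
rewrite /curf /xz zpow0 mulr1 -[LHS]scale1r -(mulVf qNV_neq0) -scalerA -E.
by rewrite -ysum_comm -mulrA S_S.
Qed.

Let spherical_comm u c : GRing.comm c S -> GRing.comm c u ->
  GRing.comm (c * S) (S * u * S).
Proof.
move=> CS Cu; have X : S * (c * S) = c * S by rewrite mulrA -CS -mulrA S_S.
rewrite /GRing.comm -!mulrA (mulA21 S_S) X (mulA22 (esym Cu)).
by rewrite (mulA22 (esym CS)).
Qed.

(** By the recursions [cure 1 * cure (-1) - cure (-1) * cure 1] is a combination
    of the two terms with exponents zero, which involve only the inverses of
    Y_1 and Y_2, and [cure 0] is a multiple of the sum of the inverses of all
    the Y_j. For N = 1 the recursion is a q-commutation. *)
Lemma cure_serre :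
  cure 0 * (cure 1 * cure (-1) - cure (-1) * cure 1)
  = (cure 1 * cure (-1) - cure (-1) * cure 1) * cure 0.
Proof.
have [N1|N1] := boolP (1 < N)%N; last first.
  have R m n : cure m * cure (n + 1) = q^-1 *: (cure (m + 1) * cure n).
    by have := cure_rec m n; rewrite (n1_0 N1) mul0r scale0r => /subr0_eq.
  have E1 := R 0 (-1); have E2 := R (-1) 0.
  rewrite (_ : -1 + 1 = 0) // (_ : 0 + 1 = 1) // in E1 E2.
  have -> : cure 1 * cure (-1) = q *: (cure 0 * cure 0).
    by rewrite E1 scalerA divff // scale1r.
  have -> : cure (-1) * cure 1 = q^-1 *: (cure 0 * cure 0) by exact: E2.
  by nc.
have R1 : cee 0 0 + cee (-1) 1 = v ^+ 2 *: (cee 1 (-1) + cee 0 0).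
  exact: (cee_rec 0 (-1) N1).
have R2 : Aee (-1) 1 = q^-1 *: Aee 0 0 - (h * n1 / v) *: cee (-1) 1.
  exact: (Aee_rec (-1) 0).
have R3 : Aee 0 0 = q^-1 *: Aee 1 (-1) - (h * n1 / v) *: cee 0 0.
  exact: (Aee_rec 0 (-1)).
have X : cure 1 * cure (-1) - cure (-1) * cure 1
    = ((q - q^-1) / qnum v N) *: Aee 0 0
      + (((q * h / v + v ^- 2 - 1) * n1) / qnum v N) *: cee 0 0.
  rewrite !cure_mul R2.
  have {}R3 : Aee 1 (-1) = q *: (Aee 0 0 + (h * n1 / v) *: cee 0 0).
    by rewrite R3 subrK scalerA divff // scale1r.
  have {}R1 : cee 1 (-1) = v ^- 2 *: (cee 0 0 + cee (-1) 1) - cee 0 0.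
    by rewrite R1 scalerA mulVf ?expf_neq0 // scale1r addrK.
  rewrite R3 R1; move: (Aee 0 0) (cee 0 0) (cee (-1) 1) => a c d.
  by ncf; rewrite ?v_neq0 ?q_neq0 ?qN_neq0.
have AE : Aee 0 0 = S * (yi 0%N * yi 0%N) * S.
  by rewrite /Aee /xz !zpow0 mul1r mulr1 !mulrA.
have CE : cee 0 0 = S * (yi 1%N * yi 0%N) * S.
  by rewrite /cee /xz !zpow0 !mulr1 !mulrA.
have Cy j : (j < N)%N -> GRing.comm yisum (yi j).
  move=> Hj; apply/commr_sym/comm_sum_seq => k.
  by rewrite mem_index_iota => /andP[_ Hk]; apply: (yi_yi D).
have CC u : GRing.comm yisum u -> GRing.comm (cure 0) (S * u * S).
  move=> Cu; rewrite cure0; apply/commr_sym/commZ/commr_sym.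
  exact: spherical_comm yisum_comm Cu.
rewrite X AE CE; apply: commrD; apply: commZ; apply: CC; apply: commrM; exact: Cy.
Qed.

Lemma curf_serre :
  curf 0 * (curf 1 * curf (-1) - curf (-1) * curf 1)
  = (curf 1 * curf (-1) - curf (-1) * curf 1) * curf 0.
Proof.
have [N1|N1] := boolP (1 < N)%N; last first.
  have R m n : curf (m + 1) * curf n = q^-1 *: (curf m * curf (n + 1)).
    by have := curf_rec m n; rewrite (n1_0 N1) mulr0 mul0r scale0r => /subr0_eq.
  have E1 := R 0 (-1); have E2 := R (-1) 0.
  rewrite (_ : -1 + 1 = 0) // (_ : 0 + 1 = 1) // in E1 E2.
  have -> : curf (-1) * curf 1 = q *: (curf 0 * curf 0).
    by rewrite E2 scalerA divff // scale1r.
  have -> : curf 1 * curf (-1) = q^-1 *: (curf 0 * curf 0) by exact: E1.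
  by nc.
have R1 : cff 1 (-1) + cff 0 0 = v ^+ 2 *: (cff 0 0 + cff (-1) 1).
  exact: (cff_rec 0 (-1) N1).
have R2 : v ^+ (2 * M) *: Aff 0 0 = (q^-1 * v ^+ (2 * M)) *: Aff (-1) 1
    - (h * n1 * v ^+ 2 * q^-1) *: dff (-1) 0.
  exact: (Aff_rec (-1) 0).
have R3 : v ^+ (2 * M) *: Aff 1 (-1) = (q^-1 * v ^+ (2 * M)) *: Aff 0 0
    - (h * n1 * v ^+ 2 * q^-1) *: dff 0 (-1).
  exact: (Aff_rec 0 (-1)).
have M1 k : xz k 0 = 1 by [].
have d1 : dff 0 (-1) = v *: cff 0 0.
  rewrite /dff /cff !mono2E !M1 mul1r mulr1 -!mulrA -[xz 0 (-1)]/(xi 0%N).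
  rewrite (mulA22 (ti_xi D N1)) (mulA20 (dxV D N1)) t_S // mul1r.
  by rewrite -!scaleAr.
have d2 : dff (-1) 0 = v^-1 *: cff 1 (-1) - h *: cff 0 0.
  rewrite /dff /cff !mono2E !M1 !mulr1 -[xz 1 (-1)]/(xi 1%N) -[xz 1 1]/(x 1%N).
  rewrite -[xz 0 (-1)]/(xi 0%N).
  have -> : S * g * x 1%N * ti 0%N * xi 1%N * S
     = S * g * x 1%N * (xi 0%N * ti 0%N - h *: xi 1%N) * S.
    rewrite -[_ * ti 0%N * _]mulrA; congr (_ * _ * _).
    by rewrite {1}(tiE D N1) mulrBl (x_xi D N1) -scaleAl mul1r.
  transitivity (S * g * (x 1%N * xi 0%N) * (ti 0%N * S)
                - h *: (S * g * (x 1%N * xi 1%N) * S)); first by nc.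
  by rewrite ti_S // (dxV D N1) mulr1 -scaleAr.
have X : curf 1 * curf (-1) - curf (-1) * curf 1
    = (v ^+ (2 * M) * (q^-1 - q) / qnum v N) *: Aff 0 0
      + (v ^+ 2 * n1 / qnum v N * (h ^+ 2 + 1 - v ^- 2 - h * v * q^-1)) *: cff 0 0.
  rewrite !curf_mul.
  have {}R2 : v ^+ (2 * M) *: Aff (-1) 1
      = q *: (v ^+ (2 * M) *: Aff 0 0 + (h * n1 * v ^+ 2 / q) *: dff (-1) 0).
    by rewrite R2 subrK scalerA mulrA divff // mul1r.
  have {}R1 : cff (-1) 1 = v ^- 2 *: (cff 1 (-1) + cff 0 0) - cff 0 0.
    rewrite R1 scalerA mulVf ?expf_neq0 // scale1r.
    by rewrite addrC addKr.
  rewrite R3 R2 R1 d1 d2; move: (Aff 0 0) (cff 0 0) (cff 1 (-1)) => a c d.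
  set p := v ^+ (2 * M).
  by ncf; rewrite ?v_neq0 ?q_neq0 ?qN_neq0.
have AE : Aff 0 0 = S * (y 0%N * y 0%N) * S.
  by rewrite /Aff !M1 !mulr1 !mulrA.
have CE : cff 0 0 = S * (y 0%N * y 1%N) * S.
  by rewrite /cff mono2E !M1 !mulr1 /g !mulrA.
have Cy j : (j < N)%N -> GRing.comm ysum (y j).
  move=> Hj; apply/commr_sym/comm_sum_seq => k.
  by rewrite mem_index_iota => /andP[_ Hk]; apply: (dyyC D).
have CC u : GRing.comm ysum u -> GRing.comm (curf 0) (S * u * S).
  move=> Cu; rewrite curf0; apply/commr_sym/commZ/commr_sym.
  exact: spherical_comm ysum_comm Cu.
rewrite X AE CE; apply: commrD; apply: commZ; apply: CC; apply: commrM; exact: Cy.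
Qed.

(** ** Brackets with the power sums *)

(** The power sums commute with X_1 and S; what remains is the commutator with
    the inverse of Y_1, see [yi0_psum]. *)
Lemma psum_cure l m :
  psum l * S * cure m - cure m * (psum l * S) = (1 - q ^ (- l)) *: cure (l + m).
Proof.
have C : xz 0 m * psum l = psum l * xz 0 m by exact: (psum_xz D).
have CS := psum_comm l.
have -> : psum l * S * cure m = psum l * cure m.
  by rewrite /cure -!mulrA (mulA21 S_S).
have -> : cure m * (psum l * S) = S * xz 0 m * (yi 0%N * psum l) * S.
  by rewrite /cure CS !mulrA -[_ * S * S]mulrA S_S -!mulrA -CS.
have -> : S * xz 0 m * (yi 0%N * psum l) * S
    = psum l * cure m + (q ^ (- l) - 1) *: cure (l + m).
  rewrite (yi0_psum D) mulrDl mulrDr mulrDl; congr (_ + _).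
    by rewrite /cure -!mulrA (mulA22 C) (mulA22 (esym CS)).
  rewrite -scaleAl -scaleAr -scaleAl /cure (xzD D _ _ N_gt0).
  by rewrite (xz_xz D l m N_gt0 N_gt0) !mulrA.
by nc.
Qed.

Lemma psum_curf l m :
  psum l * S * curf m - curf m * (psum l * S) = (q ^ (- l) - 1) *: curf (l + m).
Proof.
have C : xz 0 m * psum l = psum l * xz 0 m by exact: (psum_xz D).
have CS := psum_comm l.
have -> : psum l * S * curf m = S * (psum l * y 0%N) * xz 0 m * S.
  by rewrite /curf -!mulrA (mulA21 S_S) (mulA22 CS).
have -> : curf m * (psum l * S) = S * y 0%N * psum l * xz 0 m * S.
  by rewrite /curf CS -!mulrA (mulA21 S_S) -CS (mulA22 C).
rewrite (psum_y0 D) /curf (xzD D _ _ N_gt0).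
by nc.
Qed.

Lemma psum_psum k l : GRing.comm (psum k * S) (psum l * S).
Proof.
have C : GRing.comm (psum k) (psum l).
  apply/commr_sym/comm_sum_seq => j; rewrite mem_index_iota => /andP[_ Hj].
  exact/commr_sym/(psum_xz D).
rewrite /GRing.comm -!mulrA (mulA22 (esym (psum_comm l))) S_S.
by rewrite (mulA22 (esym (psum_comm k))) S_S (mulA22 C).
Qed.

Lemma cure0_curf0 : GRing.comm (cure 0) (curf 0).
Proof.
have C : GRing.comm yisum ysum.
  apply: comm_sum_seq => j; rewrite mem_index_iota => /andP[_ Hj].
  apply/commr_sym/comm_sum_seq => k; rewrite mem_index_iota => /andP[_ Hk].
  exact: (y_yi D).
rewrite cure0 curf0; apply/commZ/commr_sym/commZ/commr_sym.
rewrite /GRing.comm -!mulrA (mulA22 (esym ysum_comm)) S_S.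
by rewrite (mulA22 (esym yisum_comm)) S_S (mulA22 C).
Qed.

Let S_x_sum : psum 1 * S = qnum v N *: (S * x 0%N * S).
Proof.
have -> : psum 1 * S = S * psum 1 * S by rewrite -psum_comm -mulrA S_S.
rewrite (@sym_sum (v ^+ 2) (fun j => xz j 1)) => [|j Hj].
  by congr (_ *: _); apply: eq_bigr => j _; rewrite exprM.
rewrite -[xz j.+1 1]/(x j.+1) -(dtx D Hj) !mulrA S_t // -!mulrA t_S //.
by rewrite -!scaleAr -scaleAl scalerA !mulrA.
Qed.

Let S_xi_sum : psum (-1) * S = (\sum_(0 <= j < N) (v ^- 2) ^+ j) *: (S * xi 0%N * S).
Proof.
have -> : psum (-1) * S = S * psum (-1) * S by rewrite -psum_comm -mulrA S_S.
rewrite (@sym_sum (v ^- 2) (fun j => xz j (-1))) => // j Hj.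
rewrite -[xz j.+1 (-1)]/(xi j.+1) -[xz j (-1)]/(xi j).
have -> : xi j.+1 = ti j * xi j * ti j.
  by rewrite (ti_xi D Hj) -mulrA (dtV D Hj) mulr1.
rewrite !mulrA S_ti // -!mulrA ti_S // -!scaleAr -scaleAl scalerA.
by rewrite !mulrA expr2 invfM.
Qed.

(** [cure 0] is a multiple of a symmetric function of the Y_j, which commutes
    with Y_1 and with S. *)
Lemma curf_cure0 m : curf m * cure 0 - cure 0 * curf m
  = (qnum v N)^-1 *: (S * y 0%N * (xz 0 m * yisum - yisum * xz 0 m) * S).
Proof.
have Cy : y 0%N * yisum = yisum * y 0%N.
  apply: comm_sum_seq => j; rewrite mem_index_iota => /andP[_ Hj].
  exact: (y_yi D).
rewrite cure0 -scaleAr -scaleAl -scalerBr; congr (_ *: _).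
rewrite mulrBr mulrBl; congr (_ - _).
  by rewrite /curf yisum_comm -!mulrA (mulA21 S_S) -yisum_comm.
by rewrite /curf -!mulrA (mulA21 S_S) (mulA22 Cy) (mulA22 yisum_comm).
Qed.

(** The commutator is a multiple of c = S Y_1 X_1 Y_1^-1 S. The conjugate of X_1
    by Y_1 is found from that of the power sum, in which the conjugates of the
    other X_j are reduced to that of X_2 by [sum_conj]. *)
Lemma curf1_cure0 :
  curf 1 * cure 0 - cure 0 * curf 1
  = ((q - 1) * v ^+ (2 * M) / qnum v N ^+ 2) *: (psum 1 * S).
Proof.
rewrite curf_cure0 -[xz 0 1]/(x 0%N) (yisum_x0 D) opprD addrA subrr sub0r.
pose c := S * y 0%N * x 0%N * yi 0%N * S.
have -> : S * y 0%N * (- ((q^-1 - 1) *: (x 0%N * yi 0%N))) * S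
    = (1 - q^-1) *: c.
  by rewrite /c; nc.
suff -> : c = (q * v ^+ (2 * M) / qnum v N) *: (psum 1 * S).
  by rewrite !scalerA; congr (_ *: _); field; rewrite q_neq0 qN_neq0.
have E : y 0%N * x 0%N * yi 0%N
    = q *: (psum 1 - \sum_(1 <= j < N) (y 0%N * x j * yi 0%N)).
  have : psum 1 = y 0%N * (psum 1 + (q^-1 - 1) *: x 0%N) * yi 0%N.
    by rewrite -(psum_y0 D 1) -mulrA (dyV D N_gt0) mulr1.
  have -> : psum 1 + (q^-1 - 1) *: x 0%N
      = q^-1 *: x 0%N + \sum_(1 <= j < N) x j.
    rewrite -[psum 1]/(\sum_(0 <= j < N) x j) (big_ltn N_gt0).
    set s := \sum_(_ <= _ < _) _.
    by nc.
  rewrite mulrDr mulrDl mulr_sumr mulr_suml => ->.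
  rewrite addrK -scaleAr -scaleAl scalerA divff // scale1r //.
have -> : c = q *: (psum 1 * S - n1 *: (S * x 0%N * S)).
  rewrite /c -!mulrA [y 0%N * _]mulrA [y 0%N * x 0%N * _]mulrA E.
  rewrite -scaleAl -scaleAr; congr (_ *: _); rewrite mulrBl mulrBr.
  congr (_ - _); first by rewrite mulrA -psum_comm -mulrA S_S.
  have -> : S * ((\sum_(1 <= j < N) y 0%N * x j * yi 0%N) * S)
      = n1 *: (S * (y 0%N * x 1%N * yi 0%N) * S).
    have := @sum_conj (fun j => y 0%N * x j * yi 0%N) 1 1 tail_comm1 tail_comm1.
    rewrite !mulr1 !mul1r [S * (_ * S)]mulrA; apply => j j0 Hj.
    rewrite -(dtx D Hj) !mulrA (tail_comm_y0 j0 Hj) -!mulrA.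
    by rewrite (tail_comm_yi0 j0 Hj).
  have [N1|/n1_0 ->] := boolP (1 < N)%N; last by rewrite !scale0r.
  congr (_ *: _); rewrite (y0_x1 D N1) -!mulrA (mulA20 (dyV D N_gt0)).
  by rewrite mulrA S_t // ti_S // -scaleAl -!scaleAr scalerA divff // scale1r.
have -> : S * x 0%N * S = (qnum v N)^-1 *: (psum 1 * S).
  by rewrite S_x_sum scalerA mulVf // scale1r.
rewrite pN; set s := psum 1 * S.
have -> : 1 + (v ^+ 2 - 1) * n1 = qnum v N - n1 by rewrite qN; ring.
by ncf; rewrite ?qN_neq0.
Qed.

Lemma curfN1_cure0 :
  curf (-1) * cure 0 - cure 0 * curf (-1)
  = ((q^-1 - 1) * v ^+ (2 * M) / qnum v N ^+ 2) *: (psum (-1) * S).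
Proof.
rewrite curf_cure0 -[xz 0 (-1)]/(xi 0%N).
have E : xi 0%N * yisum - yisum * xi 0%N = (q^-1 - 1) *: (yi 0%N * xi 0%N).
  have := congr1 (fun u => xi 0%N * u * xi 0%N) (yisum_x0 D).
  rewrite mulrDr mulrDl -scaleAr -scaleAl !mulrA (dVx D N_gt0) !mul1r.
  rewrite -[_ * x 0%N * xi 0%N]mulrA (dxV D N_gt0) mulr1 => ->.
  by rewrite addrC addKr.
rewrite E -scaleAr -scaleAl S_xi_sum qNVE !scalerA.
have -> : S * y 0%N * (yi 0%N * xi 0%N) * S = S * xi 0%N * S.
  by rewrite -!mulrA (mulA20 (dyV D N_gt0)).
congr (_ *: _); field; rewrite ?qN_neq0 ?expf_neq0 //.
Qed.

End Spherical.

(** * The Cartan currents *)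

Section Currents.

Variables (K : fieldType) (A0 : pzalg K).
Local Notation A := (kalg A0).
Variable g : nat -> K.

Definition zw (a b : int -> A) (m n : int) : A :=
  \sum_(k < 4) g k *: (a (m + k%:Z) * b (n + 3 - k%:Z)).
Definition wz (a b : int -> A) (m n : int) : A :=
  \sum_(k < 4) g k *: (a (m + 3 - k%:Z) * b (n + k%:Z)).

(** The two half currents of G, with the common constant term u; they are scaled
    such that their difference is (g 1 + g 2) G when G 0 = 0. *)
Definition cartan (u : A) (G : int -> A) (s : bool) (k : int) : A :=
  if k == 0 then u
  else if s then (if 0 < k then (g 1 + g 2) *: G k else 0)
  else (if k < 0 then - ((g 1 + g 2) *: G k) else 0).

Lemma zwE a b m n : zw a b m n
  = g 0 *: (a m * b (n + 3)) + g 1 *: (a (m + 1) * b (n + 2))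
    + g 2 *: (a (m + 2) * b (n + 1)) + g 3 *: (a (m + 3) * b n).
Proof.
rewrite /zw !big_ord_recl big_ord0 /= /bump /= !add1n !addrA addr0.
by congr (_ + _ + _ + _); congr (_ *: (a _ * b _)); lia.
Qed.

Lemma zw_opp a b m n :
  wz a b m n = zw (fun k => a (- k)) (fun k => b (- k)) (- m - 3) (- n - 3).
Proof.
apply: eq_bigr => k _; congr (_ *: (a _ * b _)); lia.
Qed.

Hypotheses (g0 : g 0 = -1) (g3 : g 3 = 1) (two_neq0 : (2 : K) != 0).

(** The exchange relation with e is proved for the full current G first. The two
    halves of G meet in the index 0 only, which leaves finitely many indices to
    be checked. *)
Section HalfCurrent.

Variables (e f G : int -> A) (u : A).
Hypothesis eE : forall m n, zw e e m n = - zw e e n m.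
Hypothesis ef : forall m n, e m * f n - f n * e m = G (m + n).
Hypothesis G0 : G 0 = 0.
Hypothesis Ge1 : forall m, G 1 * e m - e m * G 1 = - e (m + 1).
Hypothesis GeN1 : forall m, G (-1) * e m - e m * G (-1) = - e (m - 1).
Hypotheses (ue : forall m, u * e m = e m) (eu : forall m, e m * u = e m).

Let X m n := zw G e m n + zw e G n m.

(** The bracket of the quadratic relation for e with f_j. *)
Let X_shift j m n : X (m + j) n = - X (n + j) m.
Proof.
have B m' n' : zw e e m' n' * f j - f j * zw e e m' n'
    = zw (fun k => G (k + j)) e m' n' + zw e (fun k => G (k + j)) m' n'.
  rewrite /zw mulr_suml mulr_sumr -sumrB -big_split; apply: eq_bigr => k _ /=.
  rewrite -!ef; set a := e (m' + k); set b := e (n' + 3 - k).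
  by nc.
have := B m n; rewrite eE mulNr mulrN -opprD B => /eqP.
rewrite eq_sym -addr_eq0 => /eqP E.
have sh a b : zw (fun k => G (k + j)) e a b = zw G e (a + j) b.
  by apply: eq_bigr => k _; congr (_ *: (G _ * e _)); lia.
have sh' a b : zw e (fun k => G (k + j)) a b = zw e G a (b + j).
  by apply: eq_bigr => k _; congr (_ *: (e _ * G _)); lia.
apply/eqP; rewrite -addr_eq0 /X -!sh -!sh' -{}E; apply/eqP.
by nc.
Qed.

(** By [X_shift] the defect X m n depends on m + n only, and it is antisymmetric
    in m and n. *)
Lemma current_exchange m n : zw G e m n = - zw e G n m.
Proof.
have S1 a b : X (a + 1) b = X a (b + 1).
  by rewrite X_shift; have := X_shift 0 (b + 1) a; rewrite !addr0 => ->; rewrite opprK.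
have S2 j a b : X (a + j) b = X a (b + j).
  elim/int_ind: j a b => [|j IH|j IH] a b; first by rewrite !addr0.
    rewrite -addn1 PoszD addrA S1 IH; congr X; lia.
  have := S1 (a - j.+1%:Z) (b - 1).
  have -> : a - j.+1%:Z + 1 = a - j%:Z by lia.
  by rewrite IH subrK => <-; congr X; lia.
have E : X m n = X n m.
  have -> : X m n = X (n + (m - n)) n by congr X; lia.
  by rewrite S2; congr X; lia.
have := X_shift 0 m n; rewrite !addr0 -E => /eqP.
rewrite -addr_eq0 -mulr2n -scaler_nat => /eqP E2.
have : X m n = 0 by rewrite -[X m n]scale1r -(mulVf two_neq0) -scalerA E2 scaler0.
by move=> /eqP; rewrite addr_eq0 => /eqP.
Qed.

Local Notation psi := (cartan u G).

Let psiG k : psi true k - psi false k = (g 1 + g 2) *: G k.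
Proof.
rewrite /cartan; case: eqP => [->|k0]; first by rewrite G0 scaler0 subrr.
case: ltrgtP => Hk; rewrite ?subr0 ?sub0r ?opprK //.
by case: k0.
Qed.

(** The defects W of the two halves are equal by [current_exchange], and for each
    m one of them has only terms with indices outside of the half, or, for four
    values of m, terms that are covered by the hypotheses on u, G 1 and G (-1). *)
Lemma cartan_exchange s m n : zw (psi s) e m n = - zw e (psi s) n m.
Proof.
apply/eqP; rewrite -addr_eq0; apply/eqP.
pose W s := zw (psi s) e m n + zw e (psi s) n m; rewrite -/(W s).
have WW : W true = W false.
  apply/subr0_eq; transitivity ((g 1 + g 2) *: X m n); last first.
    by rewrite /X current_exchange addNr scaler0.
  rewrite /W /X opprD addrACA /zw -!sumrB scalerDr !scaler_sumr.
  congr (_ + _); apply: eq_bigr => k _; rewrite -scalerBr.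
    by rewrite -mulrBl psiG -scaleAl !scalerA mulrC.
  by rewrite -mulrBr psiG -scaleAr !scalerA mulrC.
suff : W true = 0 \/ W false = 0 by case: s; case; rewrite ?WW // -WW.
have psi0 s' k : (if s' then k < 0 else 0 < k) -> psi s' k = 0.
  by case: s' => Hk; rewrite /cartan !ifF //; lia.
have u0 s' : psi s' 0 = u by [].
case: (ltrP 0 m) => [m0|m0].
  right; rewrite /W /zw !big1 ?addr0 // => k _; rewrite psi0 ?mul0r ?mulr0 ?scaler0 //.
    by have := ltn_ord k; lia.
  by lia.
case: (ltrP m (-3)) => [m3|m3].
  left; rewrite /W /zw !big1 ?addr0 // => k _; rewrite psi0 ?mul0r ?mulr0 ?scaler0 //.
    by have := ltn_ord k; lia.
  by have := ltn_ord k; lia.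
have : (m == -3) || (m == -2) || (m == -1) || (m == 0) by lia.
have P1 : psi true 1 = (g 1 + g 2) *: G 1 by [].
have N1 : psi false (-1) = - ((g 1 + g 2) *: G (-1)) by [].
rewrite /W !zwE g0 g3.
case/orP => [/orP[/orP[]|]|] /eqP ->.
- left; rewrite (psi0 true (-3)) // (psi0 true (-3 + 1)) // (psi0 true (-3 + 2)) //.
  have -> : -3 + 3 = 0 :> int by [].
  by rewrite u0 ue eu; nc.
- left; rewrite (psi0 true (-2)) // (psi0 true (-2 + 1)) //.
  have -> : -2 + 2 = 0 :> int by []. have -> : -2 + 3 = 1 :> int by [].
  rewrite u0 ue eu P1.
  have := Ge1 n; move: (e (n + 1)) => b /(canRL (subrK _)).
  rewrite -!scaleAl -!scaleAr => ->.
  by nc.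
- right; rewrite (psi0 false (-1 + 2)) // (psi0 false (-1 + 3)) //.
  have -> : -1 + 1 = 0 :> int by [].
  rewrite u0 ue eu N1.
  have := GeN1 (n + 3); have -> : n + 3 - 1 = n + 2 by lia.
  move: (e (n + 2)) => b /(canRL (subrK _)).
  rewrite !mulNr !mulrN -!scaleAl -!scaleAr => ->.
  by nc.
right; rewrite (psi0 false (0 + 1)) // (psi0 false (0 + 2)) // (psi0 false (0 + 3)) //.
by rewrite u0 ue eu; nc.
Qed.

End HalfCurrent.

(** If psi is moved across a product e f or f e by the two exchange relations,
    then the same polynomial in the indices appears on both sides; the
    difference of the two identities is the quadratic relation [K2] of psi with
    G = [e, f]. *)
Section CartanCommute.

Variables (e f G psi : int -> A).
Hypothesis ef : forall m n, e m * f n - f n * e m = G (m + n).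
Hypothesis psi_e : forall m n, zw psi e m n = - zw e psi n m.
Hypothesis psi_f : forall m n, wz psi f m n = - wz f psi n m.
Hypothesis psi_neg : forall k, k < 0 -> psi k = 0.

Let eI (c d : K) (x y z : A) : c *: (d *: (x * y) * z) = (c * d) *: (x * (y * z)).
Proof. by rewrite -scaleAl scalerA mulrA. Qed.

Let eI' (c d : K) (x y z : A) : c *: (z * (d *: (x * y))) = (c * d) *: (z * (x * y)).
Proof. by rewrite -scaleAr scalerA. Qed.

Let psi_ef k m n :
  \sum_(i < 4) \sum_(j < 4)
    (g i * g j) *: (psi (k + 3 + i%:Z - j%:Z) * (e (m + 3 - i%:Z) * f (n + j%:Z)))
  = \sum_(i < 4) \sum_(j < 4)
    (g i * g j) *: (e (m + i%:Z) * (f (n + 3 - j%:Z) * psi (k + 3 - i%:Z + j%:Z))).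
Proof.
transitivity (\sum_(j < 4) g j *: (zw psi e (k + 3 - j%:Z) m * f (n + j%:Z))).
  rewrite exchange_big; apply: eq_bigr => j _ /=.
  rewrite mulr_suml scaler_sumr; apply: eq_bigr => i _.
  by rewrite eI mulrC; congr (_ *: (psi _ * _)); lia.
transitivity (- \sum_(i < 4) g i *: (e (m + i%:Z) * wz psi f (k + 3 - i%:Z) n)).
  rewrite -sumrN; under eq_bigr => j _ do rewrite psi_e mulNr scalerN mulr_suml scaler_sumr.
  rewrite [LHS]sumrN [RHS]sumrN; congr (- _); rewrite exchange_big; apply: eq_bigr => i _ /=.
  rewrite mulr_sumr scaler_sumr; apply: eq_bigr => j _.
  by rewrite eI eI' mulrC; congr (_ *: (_ * (psi _ * _))); lia.
rewrite -sumrN; apply: eq_bigr => i _; rewrite psi_f mulrN scalerN opprK.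
rewrite mulr_sumr scaler_sumr; apply: eq_bigr => j _.
by rewrite eI'.
Qed.

Let psi_fe k m n :
  \sum_(i < 4) \sum_(j < 4)
    (g i * g j) *: (psi (k + 3 + i%:Z - j%:Z) * (f (n + j%:Z) * e (m + 3 - i%:Z)))
  = \sum_(i < 4) \sum_(j < 4)
    (g i * g j) *: (f (n + 3 - j%:Z) * (e (m + i%:Z) * psi (k + 3 - i%:Z + j%:Z))).
Proof.
transitivity (\sum_(i < 4) g i *: (wz psi f (k + i%:Z) n * e (m + 3 - i%:Z))).
  apply: eq_bigr => i _.
  rewrite mulr_suml scaler_sumr; apply: eq_bigr => j _.
  by rewrite eI; congr (_ *: (psi _ * _)); lia.
transitivity (- \sum_(j < 4) g j *: (f (n + 3 - j%:Z) * zw psi e (k + j%:Z) m)).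
  rewrite -sumrN; under eq_bigr => i _ do rewrite psi_f mulNr scalerN mulr_suml scaler_sumr.
  rewrite [LHS]sumrN [RHS]sumrN; congr (- _); rewrite exchange_big; apply: eq_bigr => j _ /=.
  rewrite mulr_sumr scaler_sumr; apply: eq_bigr => i _.
  by rewrite eI eI' mulrC; congr (_ *: (_ * (psi _ * _))); lia.
rewrite -sumrN exchange_big; apply: eq_bigr => j _ /=.
rewrite psi_e mulrN scalerN opprK mulr_sumr scaler_sumr; apply: eq_bigr => i _.
by rewrite eI' mulrC; congr (_ *: (_ * (_ * psi _))); lia.
Qed.

Let K2 k m : \sum_(i < 4) \sum_(j < 4)
    (g i * g j) *: (psi (k + 3 + i%:Z - j%:Z) * G (m + 3 - i%:Z + j%:Z)
                    - G (m + 3 - i%:Z + j%:Z) * psi (k + 3 + i%:Z - j%:Z)) = 0.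
Proof.
pose F x y i j : A := (g i * g j) *: (psi (k + 3 + i%:Z - j%:Z) * (x * y)).
transitivity (\sum_(i < 4) \sum_(j < 4)
    (g i * g j) *: (psi (k + 3 + i%:Z - j%:Z) * G (m + 3 - i%:Z + j%:Z))
  - \sum_(i < 4) \sum_(j < 4)
    (g i * g j) *: (G (m + i%:Z + (0 + 3 - j%:Z)) * psi (k + 3 - i%:Z + j%:Z))).
  rewrite [X in _ - X]exchange_big -sumrB; apply: eq_bigr => i _.
  rewrite -sumrB; apply: eq_bigr => j _ /=; rewrite scalerBr; congr (_ - _).
  by rewrite mulrC; congr (_ *: (G _ * psi _)); lia.
apply/eqP; rewrite subr_eq0; apply/eqP.
transitivity (\sum_(i < 4) \sum_(j < 4) (g i * g j) *:
    (psi (k + 3 + i%:Z - j%:Z) * (e (m + 3 - i%:Z) * f (0 + j%:Z)))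
  - \sum_(i < 4) \sum_(j < 4) (g i * g j) *:
    (psi (k + 3 + i%:Z - j%:Z) * (f (0 + j%:Z) * e (m + 3 - i%:Z)))).
  rewrite -sumrB; apply: eq_bigr => i _; rewrite -sumrB; apply: eq_bigr => j _.
  by rewrite -scalerBr -mulrBr ef add0r.
rewrite psi_ef psi_fe -sumrB; apply: eq_bigr => i _; rewrite -sumrB.
apply: eq_bigr => j _.
by rewrite -scalerBr !mulrA -mulrBl ef.
Qed.

(** In [K2] the term with the largest index of psi has coefficient -1; the other
    ones vanish by induction. *)
Lemma cartan_comm k m : psi k * G m = G m * psi k.
Proof.
case: k => k; last by rewrite psi_neg ?mul0r ?mulr0.
elim/ltn_ind: k m => k IH m.
have low (l : int) n : l < k%:Z -> psi l * G n - G n * psi l = 0.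
  case: l => l Hl; last by rewrite psi_neg // mul0r mulr0 subrr.
  by rewrite IH ?subrr //; lia.
have := K2 (k%:Z - 6) m.
rewrite (bigD1 (@ord_max 3)) //= (bigD1 (@ord0 3)) //=.
rewrite big1 => [|j j0]; last first.
  by rewrite low ?scaler0 //; move: j0; rewrite -val_eqE /=; lia.
rewrite [X in _ + X]big1 => [|i i3]; last first.
  apply: big1 => j _; rewrite low ?scaler0 //; move: i3; have := ltn_ord i.
  by rewrite -val_eqE /=; lia.
rewrite !addr0 g0 g3 mul1r scaleN1r.
rewrite [k%:Z - 6 + 3 + _](_ : _ = k%:Z); last by rewrite /=; lia.
rewrite [m + 3 - _](_ : _ = m); last by rewrite /=; lia.
by move/eqP; rewrite oppr_eq0 subr_eq0 => /eqP.
Qed.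

End CartanCommute.

(** The conditions on e, f and P under which the currents psi exist. They are
    symmetric under the exchange of e and f together with the inversion of all
    indices: what is proved for e and psi^+ holds for f and psi^-. *)
Section CurrentPair.

Variables (e f P : int -> A) (u : A) (a : int -> K) (b b' : K).
Hypotheses (eE : forall m n, zw e e m n = - zw e e n m)
  (fE : forall m n, wz f f m n = - wz f f n m).
Hypotheses (Pe : forall l m, P l * e m - e m * P l = a l *: e (l + m))
  (Pf : forall l m, P l * f m - f m * P l = - a l *: f (l + m))
  (PP : forall k l, P k * P l = P l * P k)
  (a_neq0 : forall l, l != 0 -> a l != 0).
Hypotheses (ef0 : e 0 * f 0 = f 0 * e 0)
  (ef1 : e 0 * f 1 - f 1 * e 0 = b *: P 1)
  (efN1 : e 0 * f (-1) - f (-1) * e 0 = b' *: P (-1))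
  (ba : b * a 1 = -1) (ba' : b' * a (-1) = -1).
Hypotheses (ue : forall m, u * e m = e m) (eu : forall m, e m * u = e m)
  (uf : forall m, u * f m = f m) (fu : forall m, f m * u = f m).

Definition bracket m : A := e m * f 0 - f 0 * e m.

Let G2 m n := e m * f n - f n * e m.

Let PG2 l m n : P l * G2 m n - G2 m n * P l
  = a l *: (G2 (l + m) n - G2 m (l + n)).
Proof.
transitivity ((P l * e m - e m * P l) * f n - f n * (P l * e m - e m * P l)
  + (e m * (P l * f n - f n * P l) - (P l * f n - f n * P l) * e m)).
  by rewrite /G2; nc.
by rewrite Pe Pf /G2; nc.
Qed.

(** [a l] is invertible: if P l commutes with [e_m, f_n] then the shifts of the
    two indices by l have the same effect. *)
Let PG2_eq l m n : l != 0 -> P l * G2 m n = G2 m n * P l ->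
  G2 (l + m) n = G2 m (l + n).
Proof.
move=> l0 E; have := PG2 l m n; rewrite E subrr => /esym /eqP.
rewrite scaler_eq0 (negbTE (a_neq0 l0)) subr_eq0.
by move=> /eqP.
Qed.

Let G2_0 l : G2 l 0 = G2 0 l.
Proof.
have [->//|l0] := eqVneq l 0.
have := @PG2_eq l 0 0 l0; rewrite !addr0; apply.
by rewrite /G2 ef0 subrr mulr0 mul0r.
Qed.

Let G2_1 l : G2 l 1 = G2 0 (l + 1).
Proof.
have [->|l0] := eqVneq l 0; first by rewrite add0r.
rewrite -[l in LHS]addr0; apply: PG2_eq => //.
by rewrite /G2 ef1 -scaleAr -scaleAl PP.
Qed.

Let G2_N1 l : G2 l (-1) = G2 0 (l - 1).
Proof.
have [->|l0] := eqVneq l 0; first by rewrite add0r.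
rewrite -[l in LHS]addr0; apply: PG2_eq => //.
by rewrite /G2 efN1 -scaleAr -scaleAl PP.
Qed.

Let P1_bracket m : P 1 * bracket m = bracket m * P 1.
Proof.
apply/subr0_eq; rewrite -/(G2 m 0) PG2 addr0 G2_0 G2_1.
by rewrite [1 + m]addrC subrr scaler0.
Qed.

Let PN1_bracket m : P (-1) * bracket m = bracket m * P (-1).
Proof.
apply/subr0_eq; rewrite -/(G2 m 0) PG2 addr0 G2_0 G2_N1.
by rewrite [-1 + m]addrC subrr scaler0.
Qed.

(** The index n is reached from 0 by steps of one: [e_m, f_0] commutes with P 1
    and P (-1), so that by [PG2_eq] all the brackets along the way are of this
    form. *)
Lemma bracket_ef m n : e m * f n - f n * e m = bracket (m + n).
Proof.
rewrite -/(G2 m n); elim/int_ind: n m => [|n IH|n IH] m; first by rewrite addr0.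
  have E : G2 (1 + m) n = G2 m (1 + n%:Z).
    by apply: PG2_eq => //; rewrite IH P1_bracket.
  rewrite (_ : n.+1%:Z = 1 + n%:Z) // -E IH; congr bracket; lia.
have E : G2 (-1 + m) (- n%:Z) = G2 m (-1 + (- n%:Z)).
  by apply: PG2_eq => //; rewrite IH PN1_bracket.
have -> : - n.+1%:Z = -1 + - n%:Z by lia.
by rewrite -E IH; congr bracket; lia.
Qed.

Let bracket0 : bracket 0 = 0.
Proof. by rewrite /bracket ef0 subrr. Qed.

Let bracket1 : bracket 1 = b *: P 1.
Proof. by rewrite -ef1 bracket_ef. Qed.

Let bracketN1 : bracket (-1) = b' *: P (-1).
Proof. by rewrite -efN1 bracket_ef. Qed.

Local Notation psi := (cartan u bracket).

Lemma psi_e s m n : zw (psi s) e m n = - zw e (psi s) n m.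
Proof.
apply: (@cartan_exchange e f bracket u) => // [|k|k].
- exact: bracket_ef.
- rewrite bracket1 -scaleAl -scaleAr -scalerBr Pe scalerA ba scaleN1r.
  by rewrite addrC.
rewrite bracketN1 -scaleAl -scaleAr -scalerBr Pe scalerA ba' scaleN1r.
by rewrite addrC.
Qed.

Let cartan_opp s k :
  cartan u (fun k => - bracket (- k)) s k = psi (~~ s) (- k).
Proof.
rewrite /cartan oppr_eq0; case: s; rewrite /= ?oppr_lt0 ?oppr_gt0 //.
  by rewrite scalerN.
by rewrite scalerN opprK.
Qed.

Lemma psi_f s m n : wz (psi s) f m n = - wz f (psi s) n m.
Proof.
have E c d m' n' : zw (fun k => c (- k)) (fun k => d (- k)) m' n'
    = wz c d (- m' - 3) (- n' - 3).
  by rewrite zw_opp; congr zw; lia.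
have X c c' d d' m' n' : c =1 c' -> d =1 d' -> zw c d m' n' = zw c' d' m' n'.
  by move=> Ec Ed; apply: eq_bigr => k _; rewrite Ec Ed.
have psiE : (fun k => psi s (- k)) =1 cartan u (fun k => - bracket (- k)) (~~ s).
  by move=> k; rewrite cartan_opp negbK.
rewrite !zw_opp (X _ _ _ _ _ _ psiE (frefl _)).
rewrite [in RHS](X _ _ _ _ _ _ (frefl _) psiE).
apply: (@cartan_exchange (fun k => f (- k)) (fun k => e (- k))
  (fun k => - bracket (- k)) u) => // [k l|k l||k|k].
- by rewrite !E fE.
- by rewrite -[LHS]opprB bracket_ef; congr (- bracket _); lia.
- by rewrite oppr0 bracket0 oppr0.
- rewrite bracketN1 mulNr mulrN opprK addrC -scaleAl -scaleAr -scalerN -scalerDr.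
  rewrite -opprB Pf scaleNr opprK scalerA ba' scaleN1r.
  by congr (- f _); lia.
rewrite opprK bracket1 mulNr mulrN opprK addrC -scaleAl -scaleAr -scalerN -scalerDr.
rewrite -opprB Pf scaleNr opprK scalerA ba scaleN1r.
by congr (- f _); lia.
Qed.

Let u_bracket k : u * bracket k = bracket k * u.
Proof.
by rewrite /bracket mulrBr mulrBl !mulrA ue uf -!mulrA eu fu.
Qed.

Let psi_bracket s k m : psi s k * bracket m = bracket m * psi s k.
Proof.
case: s.
  apply: (@cartan_comm e f) => //.
  - exact: bracket_ef.
  - exact: psi_e.
  - exact: psi_f.
  by move=> l l0; rewrite /cartan !ifF //; lia.
have X c c' d d' m' n' : c =1 c' -> d =1 d' -> zw c d m' n' = zw c' d' m' n'.
  by move=> Ec Ed; apply: eq_bigr => i _; rewrite Ec Ed.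
have E c d m' n' : zw (fun k => c (- k)) (fun k => d (- k)) m' n'
    = wz c d (- m' - 3) (- n' - 3).
  by rewrite zw_opp; congr zw; lia.
have E' c d m' n' : wz (fun k => c (- k)) (fun k => d (- k)) m' n'
    = zw c d (- m' - 3) (- n' - 3).
  by rewrite zw_opp; apply: X => i; rewrite opprK.
have := @cartan_comm (fun k => f (- k)) (fun k => e (- k))
  (fun k => - bracket (- k)) (fun k => psi false (- k)) _ _ _ _ (- k) (- m).
rewrite !opprK mulrN mulNr => H; apply: oppr_inj; apply: H => [i j|i j|i j|i i0].
- by rewrite -[LHS]opprB bracket_ef; congr (- bracket _); lia.
- by rewrite !E psi_f.
- by rewrite !E' psi_e.
by rewrite /cartan !ifF //; lia.
Qed.

Lemma psi_psi s s' k m : psi s k * psi s' m = psi s' m * psi s k.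
Proof.
have C a0 : (forall m, a0 * bracket m = bracket m * a0) -> a0 * u = u * a0 ->
    a0 * psi s' m = psi s' m * a0.
  move=> H Hu; rewrite {1 2}/cartan; case: ifP => // _.
  case: s' => //; case: ifP => // _; rewrite ?mulr0 ?mul0r //.
    by rewrite -scaleAr -scaleAl H.
  by rewrite mulrN mulNr -scaleAr -scaleAl H.
apply: C => [j|]; first exact: psi_bracket.
rewrite {1 2}/cartan; case: ifP => // _.
case: s => //; case: ifP => // _; rewrite ?mulr0 ?mul0r //.
  by rewrite -scaleAr -scaleAl u_bracket.
by rewrite mulrN mulNr -scaleAr -scaleAl u_bracket.
Qed.

Lemma psi_ef m n : g 1 + g 2 != 0 ->
  e m * f n - f n * e m
  = (g 1 + g 2)^-1 *: (psi true (m + n) - psi false (m + n)).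
Proof.
move=> g_neq0; rewrite bracket_ef.
suff -> : psi true (m + n) - psi false (m + n) = (g 1 + g 2) *: bracket (m + n).
  by rewrite scalerA mulVf // scale1r.
rewrite /cartan; case: eqP => [->|k0]; first by rewrite bracket0 scaler0 subrr.
case: ltrgtP => Hk; rewrite ?subr0 ?sub0r ?opprK //.
by case: k0.
Qed.

End CurrentPair.

End Currents.

(** * Reduced words of permutations and the Hecke symmetrizer *)

Section Inversions.

Variable N : nat.
Implicit Types (w : 'S_N) (i j : 'I_N.-1) (s : seq 'I_N.-1).
Local Notation si i := (tperm (fst_idx i) (snd_idx i)).

Definition inversions w : nat :=
  \sum_(p : 'I_N * 'I_N) ((p.1 < p.2) && (w p.2 < w p.1))%N.

Definition descent i w : bool := (w (snd_idx i) < w (fst_idx i))%N.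

Lemma word_perm_cons i s : word_perm (i :: s) = (si i * word_perm s)%g.
Proof. by rewrite /word_perm big_cons. Qed.

Lemma simple_lt i (x y : 'I_N) :
  (x, y) != (fst_idx i, snd_idx i) -> (x, y) != (snd_idx i, fst_idx i) ->
  (si i x < si i y)%N = (x < y)%N.
Proof.
rewrite !xpair_eqE -!val_eqE /=.
by case: tpermP => [->|->|/eqP + /eqP]; case: tpermP => [->|->|/eqP + /eqP];
  rewrite -?val_eqE /=; lia.
Qed.

(** Multiplication by a simple transposition permutes the pairs, except that it
    reverses the pair of the two exchanged indices. *)
Lemma inversions_simple i w : (inversions (si i * w) + descent i w
  = inversions w + (w (fst_idx i) < w (snd_idx i)))%N.
Proof.
set a := fst_idx i; set b := snd_idx i.
have ab : (a, b) != (b, a) by rewrite xpair_eqE -val_eqE /=; lia.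
rewrite /inversions (reindex_inj (h := fun p => (si i p.1, si i p.2))); last first.
  by move=> [x y] [x' y'] /= [/perm_inj -> /perm_inj ->].
rewrite (bigD1 (a, b)) //= (bigD1 (b, a)) ?(eq_sym (b, a)) //=.
rewrite [in RHS](bigD1 (a, b)) //= [in RHS](bigD1 (b, a)) ?(eq_sym (b, a)) //=.
rewrite -/a -/b tpermL tpermR !permM tpermL tpermR.
rewrite (_ : (b < a)%N = false) /=; last by apply/negbTE; rewrite /=; lia.
rewrite (_ : (a < b)%N) //= !add0n /descent -/a -/b.
rewrite [LHS]addnAC [RHS]addnAC; congr (_ + _)%N; first exact: addnC.
apply: eq_bigr => [[x y]] /andP[n1 n2] /=.
by rewrite simple_lt // !permM !tpermK.
Qed.

Lemma descent_simple i w : descent i (si i * w) = ~~ descent i w.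
Proof.
rewrite /descent !permM tpermL tpermR; case: ltngtP => // /val_inj /perm_inj.
by move=> /(congr1 val) /=; lia.
Qed.

Lemma inversions_up i w : ~~ descent i w ->
  inversions (si i * w) = (inversions w).+1.
Proof.
move=> di; have := inversions_simple i w; rewrite (negbTE di) addn0 => ->.
move: di; rewrite /descent -leqNgt leq_eqVlt => /orP[|->]; last by rewrite addn1.
by move=> /eqP/val_inj/perm_inj/(congr1 val) /=; lia.
Qed.

Lemma inversions_down i w : descent i w ->
  inversions w = (inversions (si i * w)).+1.
Proof.
move=> di; have := inversions_simple i w; rewrite di addn1 => ->.
by rewrite ltnNge ltnW // addn0.
Qed.

Lemma inversions1 : inversions 1 = 0%N.
Proof.
rewrite /inversions big1 // => p _; rewrite !perm1.
by case: ltngtP.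
Qed.

Lemma inversions_word s : (inversions (word_perm s) <= size s)%N.
Proof.
elim: s => [|i s IH]; first by rewrite /word_perm big_nil inversions1.
rewrite word_perm_cons; have [d|d] := boolP (descent i (word_perm s)).
  by move: IH; rewrite (inversions_down d) /=; lia.
by rewrite inversions_up.
Qed.

(** Without descents w is increasing. *)
Lemma no_descent w : (forall i, ~~ descent i w) -> w = 1%g.
Proof.
move=> nd.
have step (x y : 'I_N) : y = x.+1 :> nat -> (w x < w y)%N.
  move=> E; have Hx : (x < N.-1)%N by have := ltn_ord y; lia.
  have := nd (Ordinal Hx); rewrite /descent -leqNgt.
  have -> : fst_idx (Ordinal Hx) = x by exact: val_inj.
  have -> : snd_idx (Ordinal Hx) = y by exact: val_inj.
  rewrite leq_eqVlt => /orP[|//].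
  by move=> /eqP/val_inj/perm_inj/(congr1 val) /=; lia.
have mono k (x y : 'I_N) : y = (x + k)%N :> nat -> (w x + k <= w y)%N.
  elim: k y => [|k IH] y E; first by rewrite addn0 (_ : x = y) //; apply: val_inj; rewrite /= E addn0.
  have Hz : (x + k < N)%N by have := ltn_ord y; lia.
  have := IH (Ordinal Hz) erefl; have := @step (Ordinal Hz) y; rewrite /=; lia.
apply/permP => x; rewrite perm1; apply: val_inj => /=.
have N0 : (0 < N)%N by apply: leq_ltn_trans (ltn_ord x).
have HM : (N.-1 < N)%N by lia.
have := @mono x (Ordinal N0) x erefl.
have := @mono (N.-1 - x)%N x (Ordinal HM).
have := ltn_ord x; have := ltn_ord (w (Ordinal HM)); rewrite /=; lia.
Qed.

Lemma inversions_wordP w : exists2 s, word_perm s = w & size s = inversions w.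
Proof.
move: {2}(inversions w) (erefl (inversions w)) => n.
elim: n w => [|n IH] w E.
  exists [::]; last by rewrite E.
  rewrite /word_perm big_nil [w]no_descent // => i.
  by apply/negP => /inversions_down; rewrite E.
have [i di] : exists i, descent i w.
  have [/existsP//|] := boolP [exists i, descent i w].
  rewrite negb_exists => /forallP /no_descent w1.
  by move: E; rewrite w1 inversions1.
have [|s sw sz] := IH (si i * w)%g; first by have := inversions_down di; lia.
exists (i :: s); last by rewrite /= sz -inversions_down.
by rewrite word_perm_cons sw mulgA tperm2 mul1g.
Qed.

(** A letter changes the number of inversions by one, and every permutation
    except 1 has a descent, which a letter removes. *)
Lemma reducedE w s : reduced w s <-> word_perm s = w /\ size s = inversions w.
Proof.
split=> [[sw smin]|[sw sz]].
  split=> //; have [s' sw' sz'] := inversions_wordP w.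
  by apply/eqP; rewrite eqn_leq -{1}sz' smin //= -{1}sw inversions_word.
by split=> // s' sw'; rewrite sz -sw' inversions_word.
Qed.

Lemma perm_lengthE w : perm_length w = inversions w.
Proof. by have /reducedE[] := reduced_wordP w. Qed.

Lemma reduced_uncons w i s : reduced w (i :: s) ->
  descent i w /\ reduced (si i * w) s.
Proof.
move=> /reducedE[]; rewrite word_perm_cons => E /= sz.
have sE : word_perm s = (si i * w)%g by rewrite -E mulgA tperm2 mul1g.
have := inversions_word s; rewrite sE.
have [d|d] := boolP (descent i w); last by rewrite inversions_up //; lia.
by move=> _; split=> //; apply/reducedE; split=> //; have := inversions_down d; lia.
Qed.

Lemma reduced_cons w i s : descent i w -> reduced (si i * w) s -> reduced w (i :: s).
Proof.
move=> d /reducedE[E sz]; apply/reducedE; split.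
  by rewrite word_perm_cons E mulgA tperm2 mul1g.
by rewrite /= sz -inversions_down.
Qed.

Lemma reduced_up w i s : ~~ descent i w -> reduced w s ->
  reduced (si i * w) (i :: s).
Proof.
move=> d /reducedE[E sz]; apply/reducedE.
by rewrite word_perm_cons E /= sz inversions_up.
Qed.

Lemma inversionsV w : inversions w^-1 = inversions w.
Proof.
rewrite /inversions (reindex_inj (h := fun p => (w p.2, w p.1))); last first.
  by move=> [x y] [x' y'] /= [/perm_inj -> /perm_inj ->].
by apply: eq_bigr => p _ /=; rewrite !permK andbC.
Qed.

Lemma word_perm_rev s : word_perm (rev s) = (word_perm s)^-1%g.
Proof.
elim: s => [|i s IH]; first by rewrite /word_perm !big_nil invg1.
rewrite rev_cons -cats1 word_perm_cons invMg tpermV -IH /word_perm.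
by rewrite big_cat big_seq1.
Qed.

Lemma reduced_rev w s : reduced w s -> reduced w^-1 (rev s).
Proof.
move=> /reducedE[E sz]; apply/reducedE.
by rewrite word_perm_rev E size_rev inversionsV.
Qed.

(** Two reduced words of w that start with i and with j are linked through
    words that start with the longest word in i and j: both i and j are
    descents of w. *)
Section Matsumoto.

Variables (A : pzRingType) (T : 'I_N.-1 -> A).
Hypothesis Tbraid : forall i k : 'I_N.-1, k = i.+1 :> nat ->
  T i * T k * T i = T k * T i * T k.
Hypothesis Tcomm : forall i k : 'I_N.-1, (i.+1 < k)%N -> T i * T k = T k * T i.

Theorem matsumoto w s s' : reduced w s -> reduced w s' ->
  \prod_(i <- s) T i = \prod_(i <- s') T i.
Proof.
move: {2}(inversions w) (leqnn (inversions w)) => n.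
elim: n w s s' => [|n IH] w s s' wn rs rs'.
  have /reducedE[_ sz] := rs; have /reducedE[_ sz'] := rs'.
  have /size0nil -> : size s = 0%N by lia.
  by have /size0nil -> : size s' = 0%N by lia.
case: s s' rs rs' => [|i s] [|j s'] // rs rs'.
- by have /reducedE[_ sz] := rs; have /reducedE[_] := rs'; rewrite -sz.
- by have /reducedE[_ sz] := rs; have /reducedE[_] := rs'; rewrite -sz.
have [neq|] := eqVneq i j; last first.
  wlog ij : i j s s' rs rs' / (i < j)%N => [wlog|_].
    move=> neq; case: (ltngtP i j) => H.
    - exact: wlog.
    - by apply/esym/wlog => //; rewrite eq_sym.
    - by move/eqP: neq => []; exact: val_inj.
  have [di ri] := reduced_uncons rs; have [dj rj] := reduced_uncons rs'.
  have wi := inversions_down di; have wj := inversions_down dj.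
  rewrite !big_cons.
  set a := fst_idx i; set b := snd_idx i; set c := fst_idx j; set d := snd_idx j.
  have ne (x y : 'I_N) : val x != val y -> (x == y) = false.
    by rewrite val_eqE => /negbTE.
  case: (ltngtP i.+1 j) => [ij1|ji|E]; [|lia|].
    have C : (si i * si j = si j * si i)%g.
      have := tpermJ a b (si j); rewrite !tpermD ?ne //=; [|lia..].
      by rewrite /conjg tpermV => {1}<-; rewrite -!mulgA tperm2 mulg1.
    have [r rw rsz] := inversions_wordP (si i * (si j * w))%g.
    have rr : reduced (si i * (si j * w)) r by apply/reducedE; split.
    have di' : descent i (si j * w).
      by rewrite /descent !permM !tpermD // ?ne //=; lia.
    have dj' : descent j (si i * w).
      by rewrite /descent !permM !tpermD // ?ne //=; lia.
    have r1 : reduced (si i * w) (j :: r).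
      by apply: reduced_cons => //; rewrite mulgA -C -mulgA.
    have r2 : reduced (si j * w) (i :: r) by apply: reduced_cons.
    rewrite (IH _ _ _ _ ri r1); last by lia.
    rewrite (IH _ _ _ _ rj r2); last by lia.
    by rewrite !big_cons !mulrA Tcomm.
  have cb : c = b by apply: val_inj; rewrite /= E.
  have C : (si i * (si j * si i) = si j * (si i * si j))%g.
    have := tpermJ b d (si i); have := tpermJ a b (si j).
    rewrite -?/a -?/b -?/c -?/d cb tpermL tpermR /conjg !tpermV.
    rewrite tpermD ?ne //=; [|lia..].
    by rewrite tpermD ?ne //=; [|lia..]; move=> -> ->.
  have dj1 : descent j (si i * w).
    move: di dj; rewrite /descent !permM -?/a -?/b -?/c -?/d cb tpermR.
    by rewrite tpermD ?ne //=; lia.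
  have di2 : descent i (si j * (si i * w)).
    move: di dj; rewrite /descent !permM -?/a -?/b -?/c -?/d cb tpermL.
    rewrite [tperm b d a]tpermD ?ne //=; [|lia..].
    by rewrite tpermL [tperm a b d]tpermD ?ne //=; lia.
  have di1 : descent i (si j * w).
    move: di dj; rewrite /descent !permM -?/a -?/b -?/c -?/d cb tpermL.
    by rewrite tpermD ?ne //=; lia.
  have dj2 : descent j (si i * (si j * w)).
    move: di dj; rewrite /descent !permM -?/a -?/b -?/c -?/d cb tpermR.
    rewrite [tperm a b d]tpermD ?ne //=; [|lia..].
    by rewrite tpermR [tperm b d a]tpermD ?ne //=; lia.
  have [r rw rsz] := inversions_wordP (si i * (si j * (si i * w)))%g.
  have rr : reduced (si i * (si j * (si i * w))) r by apply/reducedE; split.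
  have r1 : reduced (si i * w) [:: j, i & r] by do 2 apply: reduced_cons => //.
  have r2 : reduced (si j * w) [:: i, j & r].
    do 2 apply: reduced_cons => //.
    by move/(congr1 (mulg^~ w)): C; rewrite /= -!mulgA => <-.
  rewrite (IH _ _ _ _ ri r1); last by lia.
  rewrite (IH _ _ _ _ rj r2); last by lia.
  by rewrite !big_cons !mulrA Tbraid.
rewrite -neq in rs' *; rewrite !big_cons; congr (_ * _).
have [di ri] := reduced_uncons rs; have [_ rj] := reduced_uncons rs'.
by apply: IH ri rj; have := inversions_down di; lia.
Qed.

End Matsumoto.

End Inversions.

Section Poincare.

Lemma sum_ltn n i : (i <= n)%N -> (\sum_(j < n) (j < i) = i)%N.
Proof.
move=> Hi; rewrite -big_mkcond -(big_ord_widen _ (fun=> 1%N)) //.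
by rewrite sum_nat_const card_ord muln1.
Qed.

Lemma inversions_lift n (i : 'I_n.+1) (s : 'S_n) :
  inversions (lift_perm ord0 i s) = (i + inversions s)%N.
Proof.
have H (w : 'S_n.+1) : inversions w
    = (\sum_(a < n.+1) \sum_(b < n.+1) ((a < b) && (w b < w a)))%N.
  by rewrite /inversions pair_bigA.
rewrite H big_ord_recl big_ord_recl add0n; congr (_ + _)%N.
  transitivity (\sum_(j < n) (s j < i))%N.
    apply: eq_bigr => j _; rewrite lift_perm_id lift_perm_lift /=.
    by congr nat_of_bool; rewrite /bump; case: leqP; lia.
  rewrite -[RHS](@sum_ltn n i); last by rewrite -ltnS.
  by rewrite [RHS](reindex_inj (@perm_inj _ s)).
rewrite /inversions -(pair_bigA _ (fun a b : 'I_n => nat_of_bool ((a < b) && (s b < s a))%N)).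
apply: eq_bigr => a _; rewrite big_ord_recl add0n; apply: eq_bigr => b _.
by rewrite !lift_perm_lift /= /bump !add1n ltnS !(ltnNge _ (_ + _)) leq_bump2 -ltnNge.
Qed.

(** Recording the value at 0 of a permutation removes the factor [n] from
    the length generating function of 'S_n. *)
Lemma sum_inversions (K : comNzRingType) (x : K) n :
  \sum_(w : 'S_n) x ^+ inversions w
  = \prod_(1 <= i < n.+1) \sum_(0 <= k < i) x ^+ k.
Proof.
elim: n => [|n IH].
  rewrite big_geq // (big_pred1 1%g) ?inversions1 // => w.
  by apply/esym/eqP/permP => -[].
rewrite big_nat_recr //= -IH.
pose hh (p : 'I_n.+1 * 'S_n) := lift_perm ord0 p.1 p.2.
have hh_bij : bijective hh.
  apply: inj_card_bij; last first.
    by rewrite card_prod !card_Sn card_ord factS.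
  move=> [i s] [i' s'] /permP E; rewrite /hh /= in E.
  have := E ord0; rewrite !lift_perm_id => Ei; rewrite {}Ei in E *.
  congr pair; apply/permP => j; have := E (lift ord0 j).
  by rewrite !lift_perm_lift => /lift_inj.
rewrite (reindex hh); last exact: onW_bij.
rewrite -(pair_bigA _ (fun i s => x ^+ inversions (hh (i, s)))) /= exchange_big /=.
rewrite mulr_suml; apply: eq_bigr => s _; rewrite big_mkord mulr_sumr.
by apply: eq_bigr => i _; rewrite inversions_lift exprD mulrC.
Qed.

End Poincare.

Section HeckeSymmetrizer.

Variables (K : fieldType) (q v : K) (N : nat) (A0 : pzalg K).
Local Notation A := (kalg A0).
Variables t ti x xi y yi : nat -> A.
Hypothesis D : daha_family q v N t ti x xi y yi.
Implicit Types (w : 'S_N) (i : 'I_N.-1).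
Local Notation si i := (tperm (fst_idx i) (snd_idx i)).

Definition hecke_T w : A := \prod_(i <- reduced_word w) t i.

Let iN i : (i.+1 < N)%N. Proof. exact: ltn_ord (snd_idx i). Qed.

Lemma hecke_T_reduced w s : reduced w s -> \prod_(i <- s) t i = hecke_T w.
Proof.
move=> rs; apply: (matsumoto (T := fun i : 'I_N.-1 => t i)) rs (reduced_wordP w).
  move=> i k E; have := iN k; rewrite E => Hi.
  exact: (dbraid D Hi).
by move=> i k ik; exact: (dttC D ik (iN k)).
Qed.

Lemma hecke_T_up i w : ~~ descent i w -> t i * hecke_T w = hecke_T (si i * w).
Proof.
move=> d; rewrite -(hecke_T_reduced (reduced_up d (reduced_wordP w))).
by rewrite big_cons.
Qed.

Lemma hecke_T_upr i w : ~~ descent i w^-1 -> hecke_T w * t i = hecke_T (w * si i).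
Proof.
move=> d.
have := reduced_rev (reduced_up d (reduced_rev (reduced_wordP w))).
rewrite invMg invgK tpermV rev_cons revK => /hecke_T_reduced <-.
by rewrite -cats1 big_cat big_seq1.
Qed.

Let sum_pairs i (F : 'S_N -> A) :
  \sum_w F w = \sum_(w | ~~ descent i w) (F w + F (si i * w)%g).
Proof.
rewrite (bigID (descent i)) /= addrC big_split; congr (_ + _).
rewrite (reindex_inj (mulgI (si i))) /=; apply: eq_bigl => w.
exact: descent_simple.
Qed.

Definition hecke_sum : A := \sum_w v ^+ inversions w *: hecke_T w.

Let v_neq0 := daha_v D.

Let tt_ i : t i * t i = (v - v^-1) *: t i + 1.
Proof. by rewrite (tt D (iN i)) addrC. Qed.

(** The permutations w and s_i w are taken together: on the span of T_w and
    T_(s_i w) the element T_i acts by a two by two matrix, for which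
    T_w + v T_(s_i w) is an eigenvector. *)
Lemma t_hecke_sum i : t i * hecke_sum = v *: hecke_sum.
Proof.
rewrite /hecke_sum (sum_pairs i) mulr_sumr scaler_sumr; apply: eq_bigr => w d.
rewrite inversions_up // -hecke_T_up // exprS.
move: (hecke_T w) (v ^+ _) => z c.
rewrite mulrDr -!scaleAr (mulrA (t i)) tt_ mulrDl mul1r -scaleAl.
by ncf.
Qed.

Lemma hecke_sum_t i : hecke_sum * t i = v *: hecke_sum.
Proof.
have E : hecke_sum = \sum_w v ^+ inversions w *: hecke_T w^-1.
  rewrite /hecke_sum (reindex_inj invg_inj) /=.
  by apply: eq_bigr => w _; rewrite inversionsV.
rewrite E (sum_pairs i) mulr_suml scaler_sumr; apply: eq_bigr => w d.
rewrite inversions_up // invMg tpermV -hecke_T_upr ?invgK // exprS.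
move: (hecke_T _) (v ^+ _) => z c.
rewrite mulrDl -!scaleAl -(mulrA z) tt_ mulrDr mulr1 -scaleAr.
by ncf.
Qed.

Definition poincare := \prod_(1 <= i < N.+1) qnum v i.

Hypothesis poincare_neq0 : poincare != 0.

(** The normalization is the value of the sum on a vector on which every T_i
    acts by v, that is the generating function [sum_inversions] at v^2. *)
Lemma hecke_symmetrizer : symmetrizer v N t (poincare^-1 *: hecke_sum).
Proof.
split.
- move=> i Hi; have Hi' : (i < N.-1)%N by lia.
  by rewrite -scaleAr (t_hecke_sum (Ordinal Hi')) !scalerA mulrC.
- move=> i Hi; have Hi' : (i < N.-1)%N by lia.
  by rewrite -scaleAl (hecke_sum_t (Ordinal Hi')) !scalerA mulrC.
- move=> z Hz.
  have Tz w : hecke_T w * z = v ^+ inversions w *: z.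
    rewrite -perm_lengthE /perm_length /hecke_T.
    elim: (reduced_word w) => [|i s IH]; first by rewrite big_nil mul1r scale1r.
    by rewrite big_cons -mulrA IH -scaleAr Hz ?iN // scalerA -exprSr.
  rewrite -scaleAl mulr_suml.
  under eq_bigr => w _ do rewrite -scaleAl Tz scalerA -expr2 -exprM mulnC exprM.
  rewrite -scaler_suml sum_inversions scalerA.
  suff -> : \prod_(1 <= i < N.+1) \sum_(0 <= k < i) (v ^+ 2) ^+ k = poincare.
    by rewrite mulVf // scale1r.
  by apply: eq_bigr => i _; apply: eq_bigr => k _; rewrite exprM.
move=> z Hz; rewrite /GRing.comm -scaleAr -scaleAl; congr (_ *: _).
rewrite mulr_sumr mulr_suml; apply: eq_bigr => w _; rewrite -scaleAr -scaleAl.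
congr (_ *: _); apply: comm_prod_seq => i _; exact: Hz (iN i).
Qed.

End HeckeSymmetrizer.

(** * Homomorphisms from an algebra given by generators and relations *)

Section Evaluation.

Variables (F : fieldType) (I : choiceType) (A0 : pzalg F).
Local Notation A := (kalg A0).
Variables (S : A) (gen : I -> A).
Hypotheses (SS : S * S = S) (Sg : forall i, S * gen i = gen i)
  (gS : forall i, gen i * S = gen i).

Let mon (k : {fmonom I}) : A := S * \prod_(i <- fmonom_val k) gen i.

(** The homomorphism from the free algebra to the corner S A S, whose unit
    is S, that sends the generators to [gen]. *)
Definition corner_eval (x : free_alg F I) : A :=
  \sum_(k <- msupp x) x@_k *: mon k.

Let evalEw (d : {fset {fmonom I}}) x : (msupp x `<=` d)%fset ->
  corner_eval x = \sum_(k <- d) x@_k *: mon k.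
Proof.
move=> le; rewrite /corner_eval (big_fset_incl _ le) // => k _ /mcoeff_outdom ->.
by rewrite scale0r.
Qed.

Lemma corner_evalD : {morph corner_eval : x y / x + y}.
Proof.
move=> x y; pose d := (msupp x `|` msupp y)%fset.
rewrite (@evalEw d x) ?fsubsetUl // (@evalEw d y) ?fsubsetUr //.
rewrite (@evalEw d) ?msuppD_le // -big_split; apply: eq_bigr => k _.
by rewrite mcoeffD scalerDl.
Qed.

Lemma corner_evalZ c x : corner_eval (c *: x) = c *: corner_eval x.
Proof.
rewrite (@evalEw (msupp x)) ?msuppZ_le // scaler_sumr; apply: eq_bigr => k _.
by rewrite mcoeffZ scalerA.
Qed.

Lemma corner_eval0 : corner_eval 0 = 0.
Proof. by rewrite -(scale0r 0) corner_evalZ scale0r. Qed.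

Lemma corner_evalN : {morph corner_eval : x / - x}.
Proof. by move=> x; rewrite -scaleN1r corner_evalZ scaleN1r. Qed.

Lemma corner_evalB : {morph corner_eval : x y / x - y}.
Proof. by move=> x y; rewrite corner_evalD corner_evalN. Qed.

Lemma corner_eval_sum (J : Type) (r : seq J) (P : pred J) (G : J -> free_alg F I) :
  corner_eval (\sum_(j <- r | P j) G j) = \sum_(j <- r | P j) corner_eval (G j).
Proof. exact: (big_morph _ corner_evalD corner_eval0). Qed.

Let evalU c k : corner_eval << c *g k >> = c *: mon k.
Proof. by rewrite (evalEw msuppU_le) big_seq_fset1 mcoeffUU. Qed.

Lemma corner_eval_gen i : corner_eval (free_gen F i) = gen i.
Proof.
by rewrite /free_gen evalU scale1r /mon [fmu i]fmE big_seq1 Sg.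
Qed.

Lemma corner_eval1 : corner_eval 1 = S.
Proof.
have -> : 1 = << (1 : F) *g fmone I >> :> free_alg F I by [].
by rewrite evalU scale1r /mon [fmone I]fmE big_nil mulr1.
Qed.

Let monM (k l : {fmonom I}) : mon (mmul k l) = mon k * mon l.
Proof.
have SmonS s : \prod_(i <- s) gen i * S = S * \prod_(i <- s) gen i.
  elim: s => [|i s IH]; first by rewrite big_nil mul1r mulr1.
  by rewrite big_cons -mulrA IH !mulrA gS Sg.
rewrite /mon; have -> : mmul k l = fmmul k l by [].
rewrite /fmmul fmE big_cat /=.
by rewrite (mulrA _ S) -(mulrA S _ S) SmonS !mulrA SS.
Qed.

Lemma corner_evalM : {morph corner_eval : x y / x * y}.
Proof.
move=> x y; rewrite malgME corner_eval_sum {2}/corner_eval mulr_suml.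
apply: eq_bigr => k _; rewrite corner_eval_sum /corner_eval mulr_sumr.
apply: eq_bigr => l _.
by rewrite -/(corner_eval _) evalU monM -scaleAl -scaleAr scalerA.
Qed.

Lemma corner_eval_idl x : S * corner_eval x = corner_eval x.
Proof. by rewrite -{1}corner_eval1 -corner_evalM mul1r. Qed.

Lemma corner_eval_idr x : corner_eval x * S = corner_eval x.
Proof. by rewrite -{1}corner_eval1 -corner_evalM mulr1. Qed.

Variable rel : free_alg F I -> free_alg F I -> Prop.
Hypothesis rel_eval : forall a b, rel a b -> corner_eval a = corner_eval b.

Definition presented_eval (x : presented rel) : A := corner_eval (generic_quotient.repr x).

Lemma presented_evalE x : presented_eval (presented_pi rel x) = corner_eval x.
Proof.
apply/eqP; rewrite -subr_eq0 -corner_evalB; apply/eqP.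
have /presented_pi_eqP H : presented_pi rel (generic_quotient.repr (presented_pi rel x))
   = presented_pi rel x by rewrite presented_pi_repr.
apply: (H [set z | corner_eval z = 0]%classic) => [|a b /rel_eval E]; last first.
  by rewrite /= corner_evalB E subrr.
split=> [|a b /= Ea Eb|a z b /= E]; first exact: corner_eval0.
  by rewrite corner_evalB Ea Eb subrr.
by rewrite !corner_evalM E mulr0 mul0r.
Qed.

Lemma presented_eval_linear c : {morph presented_eval : x y / c *: x + y}.
Proof.
move=> x y; rewrite -[x]presented_pi_repr -[y]presented_pi_repr.
by rewrite -linearP !presented_evalE corner_evalD corner_evalZ.
Qed.

Lemma presented_evalM : {morph presented_eval : x y / x * y}.
Proof.
move=> x y; rewrite -[x]presented_pi_repr -[y]presented_pi_repr.
by rewrite -rmorphM !presented_evalE corner_evalM.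
Qed.

Lemma presented_eval1 : presented_eval 1 = S.
Proof. by rewrite [1]/(presented_pi rel 1) presented_evalE corner_eval1. Qed.

Lemma presented_eval_gen i : presented_eval (presented_gen rel i) = gen i.
Proof. by rewrite presented_evalE corner_eval_gen. Qed.

End Evaluation.

(** * The homomorphism to the spherical subalgebra *)

Section Homomorphism.

Variables (K : fieldType) (q v : K) (N : nat) (A0 : pzalg K).
Local Notation A := (kalg A0).
Variables t ti x xi y yi : nat -> A.
Hypothesis D : daha_family q v N t ti x xi y yi.
Variable S : A.
Hypothesis SS : symmetrizer v N t S.
Hypotheses (qN_neq0 : qnum v N != 0) (two_neq0 : (2 : K) != 0)
  (q_gen : forall l : int, l != 0 -> q ^ l != 1)
  (g11_neq0 : (gpoly q (v ^- 2)).[1] != 0).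

Let v_neq0 := daha_v D.
Let q_neq0 := daha_q D.

Local Notation M := N.-1.
Definition gcoef (k : nat) : K := (gpoly q (v ^- 2))`_k.
Local Notation g := gcoef.
Local Notation e := (cure x xi yi S).
Local Notation P := (fun l : int => psum N x xi l * S).

(** This normalization makes the brackets [e 0, f 1] and [e 0, f (-1)] compatible
    with the eigenvalues of the power sums, see [qgl_e0f1]. *)
Definition f_scale : K :=
  ((q - 1) * v ^+ (2 * M) / qnum v N ^+ 2 * (1 - q^-1))^-1.

Definition scaled_curf m : A := f_scale *: curf x xi y S m.
Local Notation f := scaled_curf.

(** The coefficients of the structure function, for q_2 = q^-1 v^2. *)
Lemma gpolyE k : g k = if k is 0 then -1
  else if k is 1 then v ^+ 2 + q * v ^- 2 + q^-1
  else if k is 2 then - (q + q^-1 * v ^+ 2 + v ^- 2)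
  else if k is 3 then 1 else 0.
Proof.
rewrite /g /gpoly invrK.
have expand (a b c : K) : ('X - a%:P) * ('X - b%:P) * ('X - c%:P)
  = 'X^3 + (- (a + b + c))%:P * 'X^2 + (a * b + a * c + b * c)%:P * 'X
    - (a * b * c)%:P.
  by rewrite !(polyCD, polyCN, polyCM); ring.
rewrite expand.
have -> : q * (q^-1 * v ^+ 2) * v ^- 2 = 1 by field; rewrite ?v_neq0 ?q_neq0.
have -> : q * (q^-1 * v ^+ 2) = v ^+ 2 by field.
have -> : (q^-1 * v ^+ 2) * v ^- 2 = q^-1 by field; rewrite ?v_neq0 ?q_neq0.
rewrite !coefD coefN !coefCM !coefXn coefX coefC.
by case: k => [|[|[|[|k]]]] /=; rewrite ?(mulr0, mulr1, addr0, add0r, subr0, oppr0).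
Qed.

Let g0 : g 0 = -1. Proof. by rewrite gpolyE. Qed.
Let g3 : g 3 = 1. Proof. by rewrite gpolyE. Qed.

Lemma gpoly_at1 : (gpoly q (v ^- 2)).[1] = g 1 + g 2.
Proof.
rewrite (@horner_coef_wide _ 4); last first.
  rewrite /gpoly; apply: (leq_trans (size_polyMleq _ _)).
  rewrite size_XsubC addn2 /=.
  apply: (leq_ltn_trans (size_polyMleq _ _)).
  by rewrite !size_XsubC.
rewrite !big_ord_recl big_ord0 /= !expr1n !mulr1 addr0.
by rewrite -/(g 0) -/(g 1) -/(g 2) -/(g 3) g0 g3; ring.
Qed.

Let eE m n : zw g e e m n = - zw g e e n m.
Proof.
have H0 : let r (m n : int) := e m * e (n + 1) - q^-1 *: (e (m + 1) * e n) in
  let T (m n : int) := r (m + 2) n - (q^-1 * v ^+ 2 + v ^- 2) *: r (m + 1) (n + 1)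
    + q^-1 *: r m (n + 2) in T m n + T n m = 0.
  exact (cure_exchange D SS qN_neq0 m n).
move: H0 => /=.
have i1 (a : int) : a + 2 + 1 = a + 3 by lia.
have i2 (a : int) : a + 1 + 1 = a + 2 by lia.
rewrite !i1 !i2 => H.
apply/eqP; rewrite -addr_eq0 !zwE (gpolyE 0) (gpolyE 1) (gpolyE 2) (gpolyE 3); apply/eqP.
rewrite -[RHS]oppr0 -[in RHS](scaler0 _ q) -[in RHS]H.
by ncf; rewrite ?v_neq0 ?q_neq0.
Qed.

Let fE m n : wz g f f m n = - wz g f f n m.
Proof.
pose f0 := curf x xi y S.
have H0 : let r (m n : int) := f0 (m + 1) * f0 n - q^-1 *: (f0 m * f0 (n + 1)) in
  let T (m n : int) := r (m + 2) n - (q * v ^- 2 + v ^+ 2) *: r (m + 1) (n + 1)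
    + q *: r m (n + 2) in T m n + T n m = 0.
  exact (curf_exchange D SS qN_neq0 m n).
move: H0 => /=.
have i1 (a : int) : a + 2 + 1 = a + 3 by lia.
have i2 (a : int) : a + 1 + 1 = a + 2 by lia.
rewrite !i1 !i2 => H.
have wzE (a b : int -> A) m' n' : wz g a b m' n'
    = g 0 *: (a (m' + 3) * b n') + g 1 *: (a (m' + 2) * b (n' + 1))
    + g 2 *: (a (m' + 1) * b (n' + 2)) + g 3 *: (a m' * b (n' + 3)).
  rewrite /wz !big_ord_recl big_ord0 /= /bump /= !add1n !addrA addr0.
  by congr (_ + _ + _ + _); congr (_ *: (a _ * b _)); lia.
apply/eqP; rewrite -addr_eq0; apply/eqP.
rewrite !wzE (gpolyE 0) (gpolyE 1) (gpolyE 2) (gpolyE 3) /f -/f0.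
rewrite -[RHS]oppr0 -[in RHS](scaler0 _ (f_scale ^+ 2)) -[in RHS]H.
by ncf; rewrite ?v_neq0 ?q_neq0.
Qed.

Let a (l : int) : K := 1 - q ^ (- l).

Let a_neq0 l : l != 0 -> a l != 0.
Proof. by move=> l0; rewrite subr_eq0 eq_sym q_gen // oppr_eq0. Qed.

Let Pe l m : P l * e m - e m * P l = a l *: e (l + m).
Proof. exact (psum_cure D SS l m). Qed.

Let Pf l m : P l * f m - f m * P l = - a l *: f (l + m).
Proof.
rewrite /f -scaleAr -scaleAl -scalerBr (psum_curf D SS) !scalerA mulrC.
by rewrite /a opprB.
Qed.

Let PP k l : P k * P l = P l * P k.
Proof. exact (psum_psum D SS k l). Qed.

Let ef0 : e 0 * f 0 = f 0 * e 0.
Proof. by rewrite /f -scaleAr -scaleAl (cure0_curf0 D SS). Qed.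

Let mu : K := (q - 1) * v ^+ (2 * M) / qnum v N ^+ 2.

Let q1_neq0 : q - 1 != 0.
Proof. by rewrite subr_eq0 -[q]expr1z q_gen. Qed.

Lemma f_scale_neq0 : f_scale != 0.
Proof.
have qV : 1 - q^-1 != 0.
  by rewrite -oppr_eq0 opprB subr_eq0 -exprN1 q_gen.
by rewrite invr_eq0 !mulf_neq0 // ?invr_eq0 ?expf_neq0.
Qed.

Let b := - (f_scale * mu).
Let b' := - (f_scale * ((q^-1 - 1) * v ^+ (2 * M) / qnum v N ^+ 2)).

Lemma qgl_e0f1 : e 0 * f 1 - f 1 * e 0 = b *: P 1.
Proof.
rewrite /f -scaleAr -scaleAl -scalerBr -opprB (curf1_cure0 D SS qN_neq0).
by rewrite scalerN scalerA scaleNr.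
Qed.

Lemma qgl_e0fN1 : e 0 * f (-1) - f (-1) * e 0 = b' *: P (-1).
Proof.
rewrite /f -scaleAr -scaleAl -scalerBr -opprB (curfN1_cure0 D SS qN_neq0).
by rewrite scalerN scalerA scaleNr.
Qed.

Let ba : b * a 1 = -1.
Proof.
rewrite /b /a /f_scale /mu exprN1; have := expf_neq0 (2 * M) v_neq0.
move: (v ^+ _) (qnum v N) qN_neq0 => w n n0 w0.
by field; rewrite ?q1_neq0 ?q_neq0 ?n0 ?w0.
Qed.

Let ba' : b' * a (-1) = -1.
Proof.
rewrite /b' /a /f_scale /mu opprK expr1z; have := expf_neq0 (2 * M) v_neq0.
move: (v ^+ _) (qnum v N) qN_neq0 => w n n0 w0.
by field; rewrite ?q1_neq0 ?q_neq0 ?n0 ?w0.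
Qed.

Let SeS := S_S SS.

Let Se m : S * e m = e m. Proof. by rewrite /cure !mulrA SeS. Qed.
Let eS m : e m * S = e m. Proof. by rewrite /cure -!mulrA SeS. Qed.
Let Sf m : S * f m = f m. Proof. by rewrite /f -scaleAr /curf !mulrA SeS. Qed.
Let fS m : f m * S = f m. Proof. by rewrite /f -scaleAl /curf -!mulrA SeS. Qed.

Local Notation G := (bracket e f).
Local Notation psi := (cartan g S G).

Let SG m : S * G m = G m.
Proof. by rewrite /bracket mulrBr (mulrA S (e m)) (mulrA S (f 0)) Se Sf. Qed.
Let GS m : G m * S = G m.
Proof.
by rewrite /bracket mulrBl -(mulrA (e m) (f 0)) -(mulrA (f 0) (e m)) eS fS.
Qed.

Let Spsi s m : S * psi s m = psi s m.
Proof.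
rewrite /cartan; case: ifP => _ //; case: s; case: ifP => _; rewrite ?mulr0 //.
  by rewrite -scaleAr SG.
by rewrite mulrN -scaleAr SG.
Qed.
Let psiS s m : psi s m * S = psi s m.
Proof.
rewrite /cartan; case: ifP => _ //; case: s; case: ifP => _; rewrite ?mul0r //.
  by rewrite -scaleAl GS.
by rewrite mulNr -scaleAl GS.
Qed.

Definition qgl_image (c : qgl_gen) : A :=
  match c with
  | inl (inl (inl i)) => e i
  | inl (inl (inr i)) => f i
  | inl (inr (s, j)) => psi s (if s then j%:Z else - j%:Z)
  | inr _ => S
  end.

Lemma qgl_image_idl c : S * qgl_image c = qgl_image c.
Proof. by case: c => [[[i|i]|[s j]]|s] /=. Qed.

Lemma qgl_image_idr c : qgl_image c * S = qgl_image c.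
Proof. by case: c => [[[i|i]|[s j]]|s] /=. Qed.

Local Notation ev := (corner_eval S qgl_image).

Let ev_gen c : ev (free_gen K c) = qgl_image c.
Proof. exact: (corner_eval_gen qgl_image_idl). Qed.

Let evM := corner_evalM SeS qgl_image_idl qgl_image_idr.

Let ev_psi s i : ev (current_psi K s i) = psi s i.
Proof.
by case: s i => [] [[|j]|j]; rewrite /= ?ev_gen ?corner_eval0.
Qed.

Let ev_zw a1 b1 a2 b2 m n : (forall i, ev (a1 i) = a2 i) ->
  (forall i, ev (b1 i) = b2 i) ->
  ev (g_zw q (v ^- 2) a1 b1 m n) = zw g a2 b2 m n.
Proof.
move=> Ha Hb; rewrite /g_zw corner_eval_sum; apply: eq_bigr => k _.
by rewrite corner_evalZ evM Ha Hb.
Qed.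

Let ev_wz a1 b1 a2 b2 m n : (forall i, ev (a1 i) = a2 i) ->
  (forall i, ev (b1 i) = b2 i) ->
  ev (g_wz q (v ^- 2) a1 b1 m n) = wz g a2 b2 m n.
Proof.
move=> Ha Hb; rewrite /g_wz corner_eval_sum; apply: eq_bigr => k _.
by rewrite corner_evalZ evM Ha Hb.
Qed.

Let ev_opp a1 b1 a2 b2 : ev a1 = a2 -> ev b1 = b2 -> a2 = - b2 ->
  ev a1 = ev (- b1).
Proof. by move=> -> Eb ->; rewrite -Eb; apply/esym/corner_evalN. Qed.

Let ev_mul a1 b1 a2 b2 : ev a1 = a2 -> ev b1 = b2 -> ev (a1 * b1) = a2 * b2.
Proof. by move=> Ea Eb; rewrite evM Ea Eb. Qed.

Let ev_comm a1 b1 a2 b2 : ev a1 = a2 -> ev b1 = b2 ->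
  ev (a1 * b1 - b1 * a1) = a2 * b2 - b2 * a2.
Proof.
move=> Ea Eb; rewrite -(ev_mul Ea Eb) -(ev_mul Eb Ea).
exact: corner_evalB.
Qed.

Let ev_diff c a1 b1 a2 b2 : ev a1 = a2 -> ev b1 = b2 ->
  ev (c *: (a1 - b1)) = c *: (a2 - b2).
Proof. by move=> Ea Eb; rewrite corner_evalZ corner_evalB Ea Eb. Qed.

Let ev_e i : ev (current_e K i) = e i. Proof. exact: ev_gen. Qed.
Let ev_f i : ev (current_f K i) = f i. Proof. exact: ev_gen. Qed.

(** Every relation has been proved for the images of the generators; here they
    are matched with the formal relations. *)
Lemma qgl_rel_eval a1 b1 : qgl_rel q (v ^- 2) a1 b1 -> ev a1 = ev b1.
Proof.
have psi_eE := psi_e g0 g3 two_neq0 eE Pe Pf PP a_neq0 ef0 qgl_e0f1 qgl_e0fN1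
  ba ba' Se eS.
have psi_fE := psi_f g0 g3 two_neq0 fE Pe Pf PP a_neq0 ef0 qgl_e0f1 qgl_e0fN1
  ba ba' Sf fS.
have psi_psiE := psi_psi g0 g3 two_neq0 eE fE Pe Pf PP a_neq0 ef0 qgl_e0f1
  qgl_e0fN1 ba ba' Se eS Sf fS.
have psi_efE := @psi_ef _ _ g two_neq0 _ _ _ S _ _ _ Pe Pf PP a_neq0 ef0
  qgl_e0f1 qgl_e0fN1.
case=> [m n|m n|s m n|s m n|m n|s s' i j|s|s||].
- apply: (ev_opp (ev_zw m n ev_e ev_e) (ev_zw n m ev_e ev_e)); exact: eE.
- apply: (ev_opp (ev_wz m n ev_f ev_f) (ev_wz n m ev_f ev_f)); exact: fE.
- apply: (ev_opp (ev_zw m n (ev_psi s) ev_e) (ev_zw n m ev_e (ev_psi s))).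
  exact: psi_eE.
- apply: (ev_opp (ev_wz m n (ev_psi s) ev_f) (ev_wz n m ev_f (ev_psi s))).
  exact: psi_fE.
- rewrite (ev_comm (ev_e m) (ev_f n)) psi_efE -?gpoly_at1 // gpoly_at1.
  by rewrite (ev_diff _ (ev_psi true _) (ev_psi false _)).
- by rewrite (ev_comm (ev_psi s i) (ev_psi s' j)) psi_psiE subrr corner_eval0.
- by rewrite (ev_mul (ev_psi s 0) (ev_gen _)) corner_eval1 SeS.
- by rewrite (ev_mul (ev_gen _) (ev_psi s 0)) corner_eval1 SeS.
- rewrite (ev_comm (ev_e 0) (ev_comm (ev_e 1) (ev_e (-1)))) corner_eval0.
  by rewrite (cure_serre D SS qN_neq0) subrr.
rewrite (ev_comm (ev_f 0) (ev_comm (ev_f 1) (ev_f (-1)))) corner_eval0.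
have := curf_serre D SS qN_neq0; rewrite /f.
move: (curf x xi y S 0) (curf x xi y S 1) (curf x xi y S (-1)) => c0 c1 c2 E.
rewrite -!scaleAl -!scaleAr -!scalerBr -!scaleAl -!scaleAr E.
by rewrite subrr scaler0.
Qed.

End Homomorphism.

(** * Spans over a local ring *)

Section LocalSpan.

Variables (K : fieldType) (O : K -> Prop) (eps : K).
Hypotheses (O1 : O 1) (OD : forall a b, O a -> O b -> O (a + b))
  (ON : forall a, O a -> O (- a)) (OM : forall a b, O a -> O b -> O (a * b))
  (Oeps : O eps) (Oloc : forall c, O c -> 1 - eps * c != 0).

Lemma O0 : O 0.
Proof. by rewrite -(subrr 1); apply: OD => //; apply: ON. Qed.

Lemma O_exp a n : O a -> O (a ^+ n).
Proof. by move=> Oa; elim: n => [|n IH]; rewrite ?expr0 // exprS; apply: OM. Qed.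

Lemma O_nat n : O n%:R.
Proof. by elim: n => [|n IH]; [exact: O0|rewrite -natr1; apply: OD]. Qed.
Lemma O_sum (I : Type) (r : seq I) (P : pred I) (F : I -> K) :
  (forall i, P i -> O (F i)) -> O (\sum_(i <- r | P i) F i).
Proof. by move=> H; apply: big_ind => //; exact: O0. Qed.

Lemma O_prod (I : Type) (r : seq I) (P : pred I) (F : I -> K) :
  (forall i, P i -> O (F i)) -> O (\prod_(i <- r | P i) F i).
Proof. by move=> H; apply: big_ind. Qed.

(** The determinant is 1 modulo eps, and such elements of O are not zero. *)
Let det_mod n (C : 'M[K]_n) : (forall i j, O (C i j)) -> \det (1%:M - eps *: C) != 0.
Proof.
move=> OC; pose B : 'M[K]_n := 1%:M - eps *: C.
have Oid i j : O ((1%:M : 'M[K]_n) i j).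
  by rewrite mxE; case: (i == j) => /=; [exact: O1|exact: O0].
have OB i j : O (B i j).
  have -> : B i j = (1%:M : 'M[K]_n) i j - eps * C i j by rewrite !mxE.
  by apply: OD => //; apply/ON/OM.
have [c Oc E] : exists2 c, O c & \det B - \det (1%:M : 'M[K]_n) = eps * c.
  rewrite /determinant -sumrB.
  apply: (big_ind (fun z => exists2 c, O c & z = eps * c)).
  - by exists 0; [exact: O0|rewrite mulr0].
  - by move=> _ _ [c Oc ->] [d Od ->]; exists (c + d); [apply: OD|rewrite mulrDr].
  move=> s _; rewrite -mulrBr.
  have [c Oc ->] : exists2 c, O c &
      \prod_i B i (s i) - \prod_i (1%:M : 'M[K]_n) i (s i) = eps * c.
    have [] : [/\ O (\prod_i B i (s i)), O (\prod_i (1%:M : 'M[K]_n) i (s i)) &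
        exists2 c, O c & \prod_i B i (s i) - \prod_i (1%:M : 'M[K]_n) i (s i) = eps * c].
      apply: (big_ind2 (fun a b => [/\ O a, O b & exists2 c, O c & a - b = eps * c])).
      - by split=> //; exists 0; [exact: O0|rewrite subrr mulr0].
      - move=> a b a' b' [Oa Ob [c Oc E]] [Oa' Ob' [c' Oc' E']]; split.
        + exact: OM.
        + exact: OM.
        exists (c * a' + b * c'); first by apply: OD; apply: OM.
        rewrite mulrDr mulrA -E mulrCA -E'; ring.
      move=> i _; split=> //; exists (- C i (s i)); first exact: ON.
      by rewrite !mxE; ring.
    by move=> _ _ [c Oc E]; exists c.
  exists ((-1) ^+ s * c); last by rewrite mulrCA.
  by apply: OM => //; apply/O_exp/ON.
rewrite -/B (canRL (subrK _) E) det1 addrC -[eps * c]opprK -mulrN.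
exact/Oloc/ON.
Qed.

Variable V : lmodType K.
Implicit Types (L : seq V) (z : V).

Definition Ospan L z : Prop :=
  exists2 c : nat -> K, (forall i, O (c i)) & z = \sum_(0 <= i < size L) c i *: L`_i.

Lemma Ospan0 L : Ospan L 0.
Proof.
exists (fun=> 0) => [i|]; first exact: O0.
by rewrite big1 // => i _; rewrite scale0r.
Qed.

Lemma OspanD L z z' : Ospan L z -> Ospan L z' -> Ospan L (z + z').
Proof.
move=> [c Oc ->] [c' Oc' ->]; exists (fun i => c i + c' i) => [i|].
  exact: OD.
by rewrite -big_split; apply: eq_bigr => i _; rewrite scalerDl.
Qed.

Lemma OspanZ L a z : O a -> Ospan L z -> Ospan L (a *: z).
Proof.
move=> Oa [c Oc ->]; exists (fun i => a * c i) => [i|]; first exact: OM.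
by rewrite scaler_sumr; apply: eq_bigr => i _; rewrite scalerA.
Qed.

Lemma Ospan_mem L z : z \in L -> Ospan L z.
Proof.
move=> zL; exists (fun i => (i == index z L)%:R) => [i|]; first exact: O_nat.
have Hz : (index z L < size L)%N by rewrite index_mem.
rewrite big_mkord (bigD1 (Ordinal Hz)) //= eqxx scale1r nth_index //.
rewrite big1 ?addr0 // => i /negbTE; rewrite -val_eqE /= => ->.
by rewrite scale0r.
Qed.

(** Nakayama's lemma: the matrix that expresses a system of generators modulo
    the subspace [W] is invertible, since it is the identity modulo [eps]. *)
Lemma nakayama L (W : V -> Prop) : W 0 ->
  (forall z z', W z -> W z' -> W (z + z')) -> (forall a z, W z -> W (a *: z)) ->
  {in L, forall z, exists2 a, W a & exists2 g, Ospan L g & z = a + eps *: g} ->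
  {in L, forall z, W z}.
Proof.
move=> W_0 W_D W_Z HL.
pose n := size L; pose l (i : 'I_n) := L`_i.
have Hl i : exists p : V * (nat -> K), [/\ W p.1, forall j, O (p.2 j) &
    l i = p.1 + eps *: \sum_(j < n) p.2 j *: l j].
  have [a Wa [g [c Oc gE] E]] := HL (l i) (mem_nth 0 (ltn_ord i)).
  by exists (a, c); split=> //; rewrite E gE big_mkord.
have [p Hp] := fin_all_exists Hl.
pose C : 'M[K]_n := \matrix_(i, j) (p i).2 j.
pose B : 'M[K]_n := 1%:M - eps *: C.
have dB : \det B != 0 by apply: det_mod => i j; rewrite mxE; case: (Hp i).
have BE i : \sum_j B i j *: l j = (p i).1.
  have [_ _ E] := Hp i.
  under eq_bigr => j _ do rewrite !mxE scalerBl.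
  rewrite sumrB (bigD1 i) //= eqxx scale1r big1 ?addr0; last first.
    by move=> j /negbTE; rewrite eq_sym => ->; rewrite scale0r.
  rewrite {1}E -[RHS]addr0 -addrA; congr (_ + _); apply/eqP; rewrite subr_eq0; apply/eqP.
  by rewrite scaler_sumr; apply: eq_bigr => j _; rewrite scalerA.
move=> z zL; have Hi : (index z L < n)%N by rewrite index_mem.
have -> : z = l (Ordinal Hi) by rewrite /l nth_index.
move: (Ordinal Hi) => k.
have -> : l k = (\det B)^-1 *: \sum_i \adj B k i *: (p i).1.
  under eq_bigr => i _ do rewrite -BE scaler_sumr.
  rewrite exchange_big /=.
  under eq_bigr => j _ do under eq_bigr => i _ do rewrite scalerA.
  under eq_bigr => j _ do rewrite -scaler_suml.
  have adjE j : \sum_i \adj B k i * B i j = \det B *+ (k == j).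
    have := congr1 (fun M : 'M_n => M k j) (mul_adj_mx B).
    by rewrite !mxE => <-; apply: eq_bigr.
  under eq_bigr => j _ do rewrite adjE.
  rewrite (bigD1 k) //= eqxx mulr1n big1 ?addr0 ?scalerA ?mulVf ?scale1r //.
  by move=> j /negbTE; rewrite eq_sym => ->; rewrite mulr0n scale0r.
apply: (W_Z); apply: big_ind => // i _; apply: (W_Z).
by case: (Hp i).
Qed.

End LocalSpan.

Lemma absz_step (f : bool) (a : int) :
  (absz (if f then a - 1 else a + 1)%R <= (absz a).+1)%N.
Proof. by case: f; lia. Qed.

(** * Surjectivity *)

(** The properties of the ring O of the functions that are regular at v = 1, for
    generic q; by [lr_loc] an element of O that is 1 modulo v - 1 is not zero. *)
Record generic_at_one (K : fieldType) (q v : K) (O : K -> Prop) : Prop :=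
  GenericAtOne {
  lr1 : O 1;
  lrD : forall a b, O a -> O b -> O (a + b);
  lrN : forall a, O a -> O (- a);
  lrM : forall a b, O a -> O b -> O (a * b);
  lr_loc : forall c, O c -> 1 - (v - 1) * c != 0;
  lr_v : O v;
  lr_vV : O v^-1;
  lr_q : O q;
  lr_qV : O q^-1;
  lr_qpow : forall a : int, a != 0 -> q ^ a - 1 != 0 /\ O (q ^ a - 1)^-1;
  lr_qnum : forall n, (0 < n)%N -> qnum v n != 0 /\ O (qnum v n)^-1;
  lr_nat : forall n, (0 < n)%N -> (n%:R : K) != 0 /\ O (n%:R)^-1
}.

Section Filtration.

Variables (K : fieldType) (q v : K) (N : nat) (A0 : pzalg K).
Local Notation A := (kalg A0).
Variables t ti x xi y yi : nat -> A.
Hypothesis D : daha_family q v N t ti x xi y yi.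
Variable O : K -> Prop.
Hypothesis HO : generic_at_one q v O.

Local Notation eps := (v - 1).
Local Notation h := (v - v^-1).
Local Notation si i := (tperm (fst_idx i) (snd_idx i)).

Let N_gt0 := daha_N D.
Let v_neq0 := daha_v D.
Let q_neq0 := daha_q D.

Let O1 : O 1 := lr1 HO.
Let OD a b : O a -> O b -> O (a + b). Proof. exact (@lrD _ _ _ _ HO a b). Qed.
Let ON a : O a -> O (- a). Proof. exact (@lrN _ _ _ _ HO a). Qed.
Let OM a b : O a -> O b -> O (a * b). Proof. exact (@lrM _ _ _ _ HO a b). Qed.
Let Ov := lr_v HO.
Let OvV := lr_vV HO.

Lemma O_eps : O eps.
Proof. by apply: OD => //; apply: ON. Qed.

Lemma O_h : O h.
Proof. by apply: OD => //; apply: ON. Qed.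

Lemma h_eps : h = eps * (1 + v^-1).
Proof. by field. Qed.

Lemma O_h_eps : O (1 + v^-1).
Proof. exact: OD. Qed.

Lemma O_zpow a : O (q ^ a).
Proof.
case: a => n; first by apply: O_exp => //; exact (lr_q HO).
by rewrite NegzE -exprnN -exprVn; by apply: O_exp => //; exact (lr_qV HO).
Qed.

(** A letter ((b, c), i): the Boolean b tells Y_i from X_i, and c marks the
    inverses. *)
Definition letter : Type := ((bool * bool) * 'I_N)%type.

Definition letter_val (l : letter) : A :=
  let i : nat := l.2 in
  match l.1 with
  | (false, false) => x i
  | (false, true) => xi i
  | (true, false) => y i
  | (true, true) => yi i
  end.

Local Notation lv := letter_val.

Definition hecke_list : seq A := [seq hecke_T t w | w : 'S_N].

(** Products of at most d letters with elements T_w in front of them and between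
    them: a finite list, as Nakayama's lemma requires. *)
Fixpoint word_list d : seq A :=
  if d is e.+1 then
    word_list e ++
    [seq b * z | b <- hecke_list, z <- [seq lv l * m | l <- enum {: letter}, m <- word_list e]]
  else hecke_list.

Definition G d : A -> Prop := Ospan O (word_list d).

Lemma G_0 d : G d 0.
Proof. exact (Ospan0 O1 OD ON (word_list d)). Qed.

Lemma GD d z z' : G d z -> G d z' -> G d (z + z').
Proof. move=> H H'; exact (OspanD OD H H'). Qed.

Lemma GZ d a z : O a -> G d z -> G d (a *: z).
Proof. move=> Oa H; exact (OspanZ OM Oa H). Qed.

Lemma GN d z : G d z -> G d (- z).
Proof. by move=> Gz; rewrite -scaleN1r; apply: GZ => //; exact: ON. Qed.

Lemma GB d z z' : G d z -> G d z' -> G d (z - z').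
Proof. by move=> Gz Gz'; apply: GD => //; apply: GN. Qed.

Lemma G_sum d (I : Type) (r : seq I) (P : pred I) (F : I -> A) :
  (forall i, P i -> G d (F i)) -> G d (\sum_(i <- r | P i) F i).
Proof. by move=> H; apply: big_ind => //; [exact: G_0|exact: GD]. Qed.

Lemma G_mem d z : z \in word_list d -> G d z.
Proof. move=> H; exact (Ospan_mem O1 OD ON H). Qed.

Lemma G_mull d e a z : {in word_list d, forall m, G e (a * m)} ->
  G d z -> G e (a * z).
Proof.
move=> H [c Oc ->]; rewrite big_mkord mulr_sumr; apply: G_sum => i _.
by rewrite -scaleAr; apply: GZ => //; apply/H/mem_nth.
Qed.

Lemma G_mulr d e a z : {in word_list d, forall m, G e (m * a)} ->
  G d z -> G e (z * a).
Proof.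
move=> H [c Oc ->]; rewrite big_mkord mulr_suml; apply: G_sum => i _.
by rewrite -scaleAl; apply: GZ => //; apply/H/mem_nth.
Qed.

Lemma GS d z : G d z -> G d.+1 z.
Proof.
rewrite -{2}[z]mul1r; apply: G_mull => m Hm; rewrite mul1r.
by apply: G_mem; rewrite mem_cat Hm.
Qed.

Lemma G_leq d e z : (d <= e)%N -> G d z -> G e z.
Proof.
by move=> /subnK <-; elim: (e - d)%N => // k IH Gz; rewrite addSn; apply/GS/IH.
Qed.

Lemma G_hecke (w : 'S_N) : G 0 (hecke_T t w).
Proof. by apply: G_mem; apply/mapP; exists w; rewrite ?mem_enum. Qed.

Lemma hecke_T1 : hecke_T t (1%g : 'S_N) = 1.
Proof.
have /reducedE[_ sz] := reduced_wordP (1%g : 'S_N).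
by rewrite /hecke_T (size0nil (s := reduced_word _)) ?big_nil // sz inversions1.
Qed.

Lemma G_1 d : G d 1.
Proof. by apply: (@G_leq 0) => //; rewrite -hecke_T1; exact: G_hecke. Qed.

(** For a descent the quadratic relation is needed, the coefficients of which are
    in O. *)
Lemma G_th (k : 'I_N.-1) (w : 'S_N) : G 0 (t k * hecke_T t w).
Proof.
have [d|d] := boolP (descent k w); last first.
  by rewrite (hecke_T_up D d); exact: G_hecke.
have -> : w = (si k * (si k * w))%g by rewrite mulgA tperm2 mul1g.
have d' : ~~ descent k (si k * w) by rewrite descent_simple negbK.
rewrite -(hecke_T_up D d') mulrA (tt D (ltn_ord (snd_idx k))) mulrDl mul1r.
rewrite -scaleAl (hecke_T_up D d'); apply: GD; first exact: G_hecke.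
by apply: GZ; [exact: O_h|exact: G_hecke].
Qed.

Lemma G_t d (k : 'I_N.-1) z : G d z -> G d (t k * z).
Proof.
have t0 : {in word_list 0, forall m, G 0 (t k * m)}.
  by move=> _ /mapP[w _ ->]; exact: G_th.
apply: G_mull; elim: d => // e IH m; rewrite mem_cat => /orP[Hm|]; first exact/GS/IH.
case/allpairsP => -[b z'] /= [Hb Hz ->]; rewrite mulrA.
move: (t0 b Hb); apply: G_mulr => b' Hb'.
by apply: G_mem; rewrite mem_cat allpairs_f ?orbT.
Qed.

Lemma G_lv d l z : G d z -> G d.+1 (lv l * z).
Proof.
apply: G_mull => m Hm.
apply: G_mem; rewrite mem_cat -[_ * _]mul1r -hecke_T1 allpairs_f ?orbT //.
  by apply/mapP; exists 1%g; rewrite ?mem_enum.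
by apply/allpairsP; exists (l, m); rewrite mem_enum.
Qed.

Lemma GM d e z z' : G d z -> G e z' -> G (d + e) (z * z').
Proof.
move=> Gz Gz';
have hM f b (w : 'S_N) : G f b -> G f (hecke_T t w * b).
  rewrite /hecke_T; elim: (reduced_word w) => [|k s IHs] Gb.
    by rewrite big_nil mul1r.
  by rewrite big_cons -mulrA; apply/G_t/IHs.
move: z Gz; elim: d => [|d IH] z; apply: G_mulr => m.
  by case/mapP => w _ ->; exact: hM.
rewrite mem_cat => /orP[/G_mem/IH H|]; first exact: GS.
case/allpairsP => -[b z''] /= [/mapP[w _ ->] /allpairsP[[l m'] /= [_ Hm ->]] ->].
by rewrite -!mulrA; apply/hM/G_lv/IH/G_mem.
Qed.

Lemma G_letter l : G 1 (lv l).
Proof. by rewrite -[lv l]mulr1; apply/G_lv/G_1. Qed.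

Lemma G_t1 k : (k.+1 < N)%N -> G 0 (t k).
Proof.
move=> Hk; have Hk' : (k < N.-1)%N by lia.
by rewrite -[t k]mulr1; apply: (@G_t 0 (Ordinal Hk')); exact: G_1.
Qed.

Lemma G_ti1 k : (k.+1 < N)%N -> G 0 (ti k).
Proof.
move=> Hk; rewrite (tiE D Hk); apply: GB; first exact: G_t1.
by apply: GZ; [exact: O_h|exact: G_1].
Qed.

Lemma G_prod0 (I : eqType) (r : seq I) (F : I -> A) :
  (forall i, i \in r -> G 0 (F i)) -> G 0 (\prod_(i <- r) F i).
Proof.
move=> H; rewrite big_seq; apply: big_ind => //; first exact: G_1.
by move=> a b Ga Gb; apply: (@GM 0 0).
Qed.

Lemma G_exp d k z : G d z -> G (k * d) (z ^+ k).
Proof.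
by move=> Gz; elim: k => [|k IH]; [exact: G_1|rewrite exprS mulSn; exact: GM].
Qed.

(** The quotient by v - 1 must be taken of the O-module G d, and not of the
    algebra, in which v - 1 is invertible. *)
Definition cg d z z' : Prop := exists2 g, G d g & z - z' = eps *: g.

Lemma cg_refl d z : cg d z z.
Proof. by exists 0; [exact: G_0|rewrite subrr scaler0]. Qed.

Lemma cg_sym d z z' : cg d z z' -> cg d z' z.
Proof. by move=> [g Gg E]; exists (- g); [exact: GN|rewrite -opprB E scalerN]. Qed.

Lemma cg_trans d z1 z2 z3 : cg d z1 z2 -> cg d z2 z3 -> cg d z1 z3.
Proof.
move=> [g Gg E] [g' Gg' E']; exists (g + g'); first exact: GD.
by rewrite scalerDr -E -E' addrA subrK.
Qed.

Lemma cg_leq d e z z' : (d <= e)%N -> cg d z z' -> cg e z z'.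
Proof. by move=> le [g Gg E]; exists g => //; exact: G_leq Gg. Qed.

Lemma cgD d z1 z2 z3 z4 : cg d z1 z2 -> cg d z3 z4 -> cg d (z1 + z3) (z2 + z4).
Proof.
move=> [g Gg E] [g' Gg' E']; exists (g + g'); first exact: GD.
by rewrite scalerDr -E -E' opprD addrACA.
Qed.

Lemma cg_sum d (I : Type) (r : seq I) (P : pred I) (F F' : I -> A) :
  (forall i, P i -> cg d (F i) (F' i)) ->
  cg d (\sum_(i <- r | P i) F i) (\sum_(i <- r | P i) F' i).
Proof.
move=> H; apply: big_ind2 => //; first exact: cg_refl.
by move=> z1 z2 z3 z4; exact: cgD.
Qed.

Lemma cgZ d a z z' : O a -> cg d z z' -> cg d (a *: z) (a *: z').
Proof.
move=> Oa [g Gg E]; exists (a *: g); first exact: GZ.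
by rewrite -scalerBr E !scalerA mulrC.
Qed.

Lemma cgN d z z' : cg d z z' -> cg d (- z) (- z').
Proof.
move=> [g Gg E]; exists (- g); first exact: GN.
by rewrite -opprD E scalerN.
Qed.

Lemma cgB d z1 z2 z3 z4 : cg d z1 z2 -> cg d z3 z4 -> cg d (z1 - z3) (z2 - z4).
Proof. by move=> H H'; apply: cgD => //; exact: cgN. Qed.

Lemma cgMl d e a z z' : G e a -> cg d z z' -> cg (e + d) (a * z) (a * z').
Proof.
move=> Ga [g Gg E]; exists (a * g); first exact: GM.
by rewrite -mulrBr E scaleAr.
Qed.

Lemma cgMr d e a z z' : G e a -> cg d z z' -> cg (d + e) (z * a) (z' * a).
Proof.
move=> Ga [g Gg E]; exists (g * a); first exact: GM.
by rewrite -mulrBl E scaleAl.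
Qed.

Lemma cgM d e z z' w w' : G d z -> G e w' -> cg d z z' -> cg e w w' ->
  cg (d + e) (z * w) (z' * w').
Proof.
move=> Gz Gw Hz Hw; apply: (@cg_trans _ _ (z * w')); first exact: cgMl.
exact: cgMr.
Qed.

Lemma cg_G d z z' : cg d z z' -> G d z' -> G d z.
Proof.
move=> [g Gg E] Gz'; rewrite (canRL (subrK _) E); apply: GD => //.
by apply: GZ => //; exact: O_eps.
Qed.

Lemma cg_h d z : G d z -> cg d (h *: z) 0.
Proof.
move=> Gz; exists ((1 + v^-1) *: z); first exact: GZ O_h_eps Gz.
by rewrite subr0 scalerA -h_eps.
Qed.

Lemma cg_exp d z z' n : G d z -> G d z' -> cg d z z' -> cg (n * d) (z ^+ n) (z' ^+ n).
Proof.
move=> Gz Gz' H; elim: n => [|n IH]; first exact: cg_refl.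
by rewrite !exprS mulSn; apply: cgM => //; exact: G_exp.
Qed.

Lemma cg_ti k : (k.+1 < N)%N -> cg 0 (ti k) (t k).
Proof.
move=> Hk; rewrite (tiE D Hk) -[X in cg 0 _ X]subr0.
by apply: cgB; [exact: cg_refl|apply/cg_h/G_1].
Qed.

Lemma cg_tt k : (k.+1 < N)%N -> cg 0 (t k * t k) 1.
Proof.
move=> Hk; rewrite (tt D Hk) -[X in cg 0 _ X]addr0.
by apply: cgD; [exact: cg_refl|apply/cg_h/G_t1].
Qed.

(** * The algebra modulo v - 1 *)

(** Modulo [v - 1] the elements T_k permute the letters and have square 1, and
    the letters commute up to powers of q. *)
Lemma cg_swap k a b : (k.+1 < N)%N -> G 1 a -> G 1 b ->
  cg 1 (t k * a) (b * t k) -> cg 1 (t k * b) (a * t k).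
Proof.
move=> Hk Ga Gb E; have T := G_t1 Hk; have T2 := cg_sym (cg_tt Hk).
apply: (@cg_trans _ _ (t k * b * (t k * t k))).
  by rewrite -[X in cg _ X _]mulr1; apply: (@cgMl 0 1) => //; apply: (@GM 0 1).
apply: (@cg_trans _ _ (t k * t k * (a * t k))); last first.
  rewrite -[X in cg _ _ X]mul1r; apply: (@cgMr 0 1); first exact: (@GM 1 0).
  exact: cg_tt.
rewrite -!mulrA; apply: (@cgMl 1 0) => //; rewrite !mulrA.
by apply: (@cgMr 1 0) => //; exact: cg_sym.
Qed.

Lemma G_x j : (j < N)%N -> G 1 (x j).
Proof. by move=> Hj; exact: (G_letter ((false, false), Ordinal Hj)). Qed.

Lemma G_xi j : (j < N)%N -> G 1 (xi j).
Proof. by move=> Hj; exact: (G_letter ((false, true), Ordinal Hj)). Qed.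

Lemma G_y j : (j < N)%N -> G 1 (y j).
Proof. by move=> Hj; exact: (G_letter ((true, false), Ordinal Hj)). Qed.

Lemma G_yi j : (j < N)%N -> G 1 (yi j).
Proof. by move=> Hj; exact: (G_letter ((true, true), Ordinal Hj)). Qed.

Definition act (s : 'S_N) (l : letter) : letter := (l.1, s l.2).

Lemma cg_t_letter (k : 'I_N.-1) l : cg 1 (t k * lv l) (lv (act (si k) l) * t k).
Proof.
have Hk : (k.+1 < N)%N := ltn_ord (snd_idx k).
have Hk' : (k < N)%N := ltnW Hk.
have T := G_t1 Hk; have TI := cg_ti Hk.
have up ty : cg 1 (t k * lv (ty, fst_idx k)) (lv (ty, snd_idx k) * t k) ->
    forall l', l'.1 = ty -> cg 1 (t k * lv l') (lv (act (si k) l') * t k).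
  move=> E [_ j] /= ->; rewrite /act /=.
  case: tpermP => [->|->|/eqP n1 /eqP n2] //.
    by apply: cg_swap E => //; exact: G_letter.
  suff -> : t k * lv (ty, j) = lv (ty, j) * t k by exact: cg_refl.
  move: n1 n2; rewrite -!val_eqE /= => n1 n2; have Hj := ltn_ord j.
  case: ty {E} => [[] []]; rewrite /letter_val /=; apply/commr_sym.
  - exact: (yi_tcomm D).
  - exact: (y_comm D).
  - exact: (xi_tcomm D).
  exact: (x_comm D).
case: l => -[[] []] j; apply: (up _ _ (_, j) erefl); rewrite /letter_val /=.
- have -> : t k * yi k = yi k.+1 * ti k.
    by rewrite (yi_S D Hk) -mulrA (dtV D Hk) mulr1.
  by apply: (@cgMl 0 1) => //; exact: G_yi.
- rewrite (y_t D Hk); apply: (@cgMr 0 1); first exact: G_y.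
  exact: cg_sym.
- rewrite -(ti_xi D Hk); apply: (@cgMr 0 1); first exact: G_xi.
  exact: cg_sym.
rewrite (t_x D Hk); apply: (@cgMl 0 1) => //.
exact: G_x.
Qed.

Definition qsgn (a b : bool) : K := if a == b then q else q^-1.

Let i0 : 'I_N := Ordinal N_gt0.

Definition xl (b : bool) (i : 'I_N) : A := lv ((false, b), i).
Definition yl (b : bool) (i : 'I_N) : A := lv ((true, b), i).

Let G_xl b i : G 1 (xl b i). Proof. exact: G_letter. Qed.
Let G_yl b i : G 1 (yl b i). Proof. exact: G_letter. Qed.

Let dn : 0%N = i0 :> nat. Proof. by []. Qed.

Let G_tprod (r : seq nat) (F : nat -> A) : (forall k, (k.+1 < N)%N -> G 0 (F k)) ->
  (forall k, k \in r -> (k.+1 < N)%N) -> G 0 (\prod_(k <- r) F k).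
Proof. by move=> H Hr; apply: G_prod0 => k /Hr /H. Qed.

Let G_tup a b : (b < N)%N -> G 0 (tup t a b).
Proof.
move=> Hb; apply: G_tprod G_t1 _ => k; rewrite mem_index_iota => Hk; lia.
Qed.

Let G_tdn a b : (b < N)%N -> G 0 (tdn t a b).
Proof.
move=> Hb; apply: G_tprod G_t1 _ => k; rewrite mem_rev mem_index_iota => Hk; lia.
Qed.

Let G_tupI a b : (b < N)%N -> G 0 (tupI ti a b).
Proof.
move=> Hb; apply: G_tprod G_ti1 _ => k; rewrite mem_rev mem_index_iota => Hk; lia.
Qed.

Let G_tdnI a b : (b < N)%N -> G 0 (tdnI ti a b).
Proof.
move=> Hb; apply: G_tprod G_ti1 _ => k; rewrite mem_index_iota => Hk; lia.
Qed.

Let G_x0 : G 1 (x 0%N). Proof. exact: G_x. Qed.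
Let G_xi0 : G 1 (xi 0%N). Proof. exact: G_xi. Qed.
Let G_y0 : G 1 (y 0%N). Proof. exact: G_y. Qed.
Let G_yi0 : G 1 (yi 0%N). Proof. exact: G_yi. Qed.

Let G_w : G 1 (w N ti y).
Proof. by rewrite wE; apply: (@GM 0 1) G_y0; apply: G_tupI; exact: MN D. Qed.

Let G_wi : G 1 (wi N t yi).
Proof. by rewrite wiE; apply: (@GM 1 0) => //; apply: G_tup; exact: MN D. Qed.

Let G_ycorr j : (j < N)%N -> G 1 (ycorr N t ti yi j).
Proof.
move=> Hj; apply: (@GM 0 1); first exact: G_tdn.
by apply: (@GM 1 0) => //; apply: G_tupI; exact: MN D.
Qed.

Let G_ycorr' j : (j < N)%N -> G 1 (ycorr' N t ti y j).
Proof.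
move=> Hj; apply: (@GM 0 1); first by apply: G_tup; exact: MN D.
by apply: (@GM 1 0) => //; exact: G_tdnI.
Qed.

Let sum_ycorr := \sum_(1 <= j < N) ycorr N t ti yi j.
Let sum_ycorr' := \sum_(1 <= j < N) ycorr' N t ti y j.

Let G_sum_ycorr : G 1 sum_ycorr.
Proof.
rewrite /sum_ycorr big_seq; apply: G_sum => j; rewrite mem_index_iota => /andP[_ Hj].
exact: G_ycorr.
Qed.

Let G_sum_ycorr' : G 1 sum_ycorr'.
Proof.
rewrite /sum_ycorr' big_seq; apply: G_sum => j; rewrite mem_index_iota => /andP[_ Hj].
exact: G_ycorr'.
Qed.

Let xix0 : x 0%N * xi 0%N = 1 := dxV D N_gt0.
Let xxi0 : xi 0%N * x 0%N = 1 := dVx D N_gt0.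

Let yyi0 : y 0%N * yi 0%N = 1 := dyV D N_gt0.
Let yiy0 : yi 0%N * y 0%N = 1 := dVy D N_gt0.

Let yi0_x0' : yi 0%N * x 0%N = q^-1 *: (x 0%N * yi 0%N) - h *: (sum_ycorr * x 0%N).
Proof. by rewrite (yi0_x0 D) mulr_suml. Qed.

Let y0_xi0' : y 0%N * xi 0%N
  = q^-1 *: (xi 0%N * y 0%N) - (q^-1 * h) *: (xi 0%N * sum_ycorr').
Proof. by rewrite (y0_xi0 D) mulr_sumr. Qed.

(** By the commutation relations the conjugates of Y_1 and of its inverse by X_1
    have degree one rather than three, and the error terms carry the factor h,
    which is divisible by v - 1. *)
Lemma conj_y0 : x 0%N * y 0%N * xi 0%N = q^-1 *: y 0%N - (q^-1 * h) *: sum_ycorr'.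
Proof.
rewrite -mulrA y0_xi0' mulrBr -!scaleAr.
by rewrite !(mulA20 xix0).
Qed.

Lemma conj_yi0 : x 0%N * yi 0%N * xi 0%N = q *: yi 0%N + (q * h) *: sum_ycorr.
Proof.
have E : yi 0%N = q^-1 *: (x 0%N * yi 0%N * xi 0%N) - h *: sum_ycorr.
  rewrite -[LHS]mulr1 -xix0 mulrA yi0_x0' mulrBl -!scaleAl.
  by rewrite -(mulrA sum_ycorr) xix0 mulr1.
rewrite {2}E scalerBr !scalerA mulfV // scale1r.
by rewrite subrK.
Qed.

Lemma cg_conj_y0 : cg 1 (x 0%N * y 0%N * xi 0%N) (q^-1 *: y 0%N).
Proof.
rewrite conj_y0 -[X in cg _ _ X]subr0 mulrC -scalerA.
apply: cgB; first exact: cg_refl.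
by apply/cg_h/GZ => //; exact (lr_qV HO).
Qed.

Lemma cg_conj_yi0 : cg 1 (x 0%N * yi 0%N * xi 0%N) (q *: yi 0%N).
Proof.
rewrite conj_yi0 -[X in cg _ _ X]addr0 mulrC -scalerA.
apply: cgD; first exact: cg_refl.
by apply/cg_h/GZ => //; exact (lr_q HO).
Qed.

Let Oq : O q := lr_q HO.
Let OqV : O q^-1 := lr_qV HO.

Let cg_yx0 a b : cg 2 (yl a i0 * xl b i0) (qsgn a b *: (xl b i0 * yl a i0)).
Proof.
have scl c z z' : O c -> O c^-1 -> c != 0 -> cg 2 z (c *: z') -> cg 2 z' (c^-1 *: z).
  move=> Oc OcV c0 /(cgZ OcV); rewrite scalerA mulVf // scale1r.
  exact: cg_sym.
have q0' : q^-1 != 0 by rewrite invr_eq0.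
case: a b => [] [] /=; rewrite /qsgn /= /xl /yl /letter_val /=.
- rewrite -{1}[q]invrK; apply: scl; rewrite ?invrK //.
  apply: (@cg_trans _ _ (xi 0%N * (q^-1 *: (x 0%N * yi 0%N * xi 0%N)))); last first.
    rewrite -scaleAr -!mulrA (mulA20 xxi0); exact: cg_refl.
  apply: (@cgMl 1 1) => //; apply: cg_sym.
  have := cgZ OqV cg_conj_yi0; rewrite scalerA mulVf // scale1r.
  by [].
- apply: (@cg_trans _ _ (q^-1 *: (x 0%N * yi 0%N * xi 0%N) * x 0%N)); last first.
    rewrite -scaleAl -!mulrA xxi0 mulr1; exact: cg_refl.
  apply: (@cgMr 1 1) => //; apply: cg_sym.
  by have := cgZ OqV cg_conj_yi0; rewrite scalerA mulVf // scale1r.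
- apply: (@cg_trans _ _ (xi 0%N * (x 0%N * y 0%N * xi 0%N))).
    rewrite -!mulrA (mulA20 xxi0); exact: cg_refl.
  by rewrite scaleAr; apply: (@cgMl 1 1) => //; exact: cg_conj_y0.
rewrite -{1}[q]invrK; apply: scl; rewrite ?invrK //.
apply: (@cg_trans _ _ (x 0%N * y 0%N * xi 0%N * x 0%N)).
  rewrite -!mulrA xxi0 mulr1; exact: cg_refl.
by rewrite scaleAl; apply: (@cgMr 1 1) => //; exact: cg_conj_y0.
Qed.

(** * Words in the letters *)

Lemma cg_unitr d z a : G d z -> cg 0 a 1 -> cg d (z * a) z.
Proof.
by move=> Gz H; have := cgMl Gz H; rewrite mulr1 addn0.
Qed.

Lemma cg_unitl d z a : G d z -> cg 0 a 1 -> cg d (a * z) z.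
Proof. by move=> Gz H; have := cgMr Gz H; rewrite mul1r. Qed.

Definition ev (s : seq letter) : A := \prod_(l <- s) lv l.

Lemma ev_cons l s : ev (l :: s) = lv l * ev s.
Proof. by rewrite /ev big_cons. Qed.

Lemma ev_cat s s' : ev (s ++ s') = ev s * ev s'.
Proof. by rewrite /ev big_cat. Qed.

Lemma ev2 l l' : ev [:: l; l'] = lv l * lv l'.
Proof. by rewrite /ev !big_cons big_nil mulr1. Qed.

Lemma G_ev s : G (size s) (ev s).
Proof.
elim: s => [|l s IH]; first by rewrite /ev big_nil; exact: G_1.
by rewrite ev_cons; exact: (GM (G_letter l) IH).
Qed.

Lemma cg_t_ev (k : 'I_N.-1) s :
  cg (size s) (t k * ev s) (ev (map (act (si k)) s) * t k).
Proof.
elim: s => [|l s IH]; first by rewrite /ev big_nil mulr1 mul1r; exact: cg_refl.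
rewrite /= !ev_cons mulrA -(add1n (size s)).
apply: (@cg_trans _ _ (lv (act (si k) l) * t k * ev s)).
  by apply: cgMr (G_ev s) (cg_t_letter k l).
by rewrite -!mulrA; apply: cgMl (G_letter _) IH.
Qed.

Lemma cg_conj (k : 'I_N.-1) s s' : size s' = size s -> cg (size s) (ev s) (ev s') ->
  cg (size s) (ev (map (act (si k)) s)) (ev (map (act (si k)) s')).
Proof.
have Hk : (k.+1 < N)%N := ltn_ord (snd_idx k).
move=> sz H.
rewrite -[X in cg _ X _]mulr1 -[X in cg _ _ X]mulr1 -(dtV D Hk) !mulrA -[size s]addn0.
apply: cgMr; first exact: G_ti1.
apply: cg_trans (cg_sym (cg_t_ev k s)) _.
apply: cg_trans (cgMl (G_t1 Hk) H) _.
by rewrite -sz; exact: cg_t_ev.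
Qed.

Let yx_comm (i j : 'I_N) : Prop :=
  forall a b, cg 2 (ev [:: ((true, a), i); ((false, b), j)])
                   (ev [:: ((false, b), j); ((true, a), i)]).

Let yx_conj (k : 'I_N.-1) i j : yx_comm i j -> yx_comm (si k i) (si k j).
Proof.
move=> H a b; exact: (@cg_conj k [:: ((true, a), i); ((false, b), j)]
  [:: ((false, b), j); ((true, a), i)] erefl (H a b)).
Qed.

(** The squares of T_1 and of its inverse, which separate Y_2 from X_1 in the
    mixed relation, are 1 modulo v - 1. *)
Let yx_10 (i j : 'I_N) : i = 1%N :> nat -> j = 0%N :> nat -> yx_comm i j.
Proof.
move=> Ei Ej a b; have N1 : (1 < N)%N by rewrite -Ei.
have T2 : cg 0 (t 0%N * t 0%N) 1 := cg_tt N1.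
have TI2 : cg 0 (ti 0%N ^+ 2) 1.
  apply: cg_trans T2; rewrite expr2; apply: (@cgM 0 0); rewrite ?G_t1 ?G_ti1 //.
  - exact: G_ti1.
  - exact: G_t1.
  - exact: cg_ti.
  exact: cg_ti.
have R1 := dxy D N1.
have T21 : ti 0%N ^+ 2 * (t 0%N * t 0%N) = 1.
  by rewrite expr2 -!mulrA (mulA20 (dVt D N1)) (dVt D N1).
have R2 : y 1%N * (t 0%N * t 0%N) * x 0%N = x 0%N * y 1%N.
  have E : xi 0%N * y 1%N * (t 0%N * t 0%N) = y 1%N * xi 0%N.
    by rewrite R1 -mulrA T21 mulr1.
  have -> : y 1%N * (t 0%N * t 0%N) = x 0%N * (y 1%N * xi 0%N).
    by rewrite -E -[xi 0%N * _ * _]mulrA (mulA20 xix0).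
  by rewrite -!mulrA xxi0 mulr1.
have yV := dyV D N1; have Vy := dVy D N1.
have R3 : yi 1%N * x 0%N = t 0%N * t 0%N * x 0%N * yi 1%N.
  have -> : yi 1%N * x 0%N = yi 1%N * (x 0%N * y 1%N) * yi 1%N.
    by rewrite -!mulrA yV mulr1.
  by rewrite -R2 -[y 1%N * _ * _]mulrA (mulA20 Vy).
have R4 : yi 1%N * xi 0%N = xi 0%N * ti 0%N ^+ 2 * yi 1%N.
  have -> : yi 1%N * xi 0%N = yi 1%N * (xi 0%N * y 1%N) * yi 1%N.
    by rewrite -!mulrA yV mulr1.
  by rewrite R1 -[y 1%N * _ * _]mulrA (mulA20 Vy).
rewrite !ev2 /letter_val /= Ei Ej; case: a b => [] [] /=.
- rewrite R4; apply: (@cgMr 1 1); first exact: G_yi.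
  exact: cg_unitr.
- rewrite R3; apply: (@cgMr 1 1); first exact: G_yi.
  exact: cg_unitl.
- rewrite R1; apply/cg_sym/cg_unitr => //.
  by apply: (@GM 1 1) => //; exact: G_y.
rewrite -R2; apply: cg_sym; apply: (@cgMr 1 1) => //.
by apply: cg_unitr => //; exact: G_y.
Qed.

(** All pairs of distinct indices are conjugate to (1, 0) by the T_k. *)
Let yx_ne (i j : 'I_N) : i != j -> yx_comm i j.
Proof.
move: {2}(nat_of_ord j) (erefl (nat_of_ord j)) => m.
elim: m i j => [|m IH] i j Ej.
  move: {2}(nat_of_ord i) (erefl (nat_of_ord i)) => n; case: n => [|n] Ei.
    by rewrite -val_eqE /= Ei Ej.
  move=> _; elim: n i Ei => [|n IH] i Ei; first exact: yx_10.
  have Hk : (n.+1 < N.-1)%N by have := ltn_ord i; lia.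
  pose k : 'I_N.-1 := Ordinal Hk.
  have ki : snd_idx k = i by apply: val_inj; rewrite /= Ei.
  have := @yx_conj k (fst_idx k) j (IH (fst_idx k) erefl).
  by rewrite tpermL ki tpermD // -val_eqE /= Ej ?Ei.
have Hk : (m < N.-1)%N by have := ltn_ord j; lia.
pose k : 'I_N.-1 := Ordinal Hk.
have kj : snd_idx k = j by apply: val_inj; rewrite /= Ej.
move=> ij; have ne : si k i != fst_idx k.
  by apply: contra ij => /eqP E; rewrite -(tpermK (fst_idx k) (snd_idx k) i) E tpermL kj.
have := @yx_conj k (si k i) (fst_idx k) (IH _ (fst_idx k) erefl ne).
by rewrite tpermK tpermL kj.
Qed.

Let same_comm (p a b : bool) i j : GRing.comm (lv ((p, a), i)) (lv ((p, b), j)).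
Proof.
have [Hi Hj] := (ltn_ord i, ltn_ord j).
have xx : GRing.comm (x i) (x j) := dxxC D Hi Hj.
have yy : GRing.comm (y i) (y j) := dyyC D Hi Hj.
rewrite /letter_val /=; case: p a b => [] [] [] //=.
- exact: yi_yi D _ _ Hi Hj.
- by apply/commr_sym/(yi_comm D Hi)/commr_sym.
- exact: (yi_comm D Hj).
- by apply/(xi_comm D Hj)/commr_sym/(xi_comm D Hi)/commr_sym.
- by apply/commr_sym/(xi_comm D Hi)/commr_sym.
exact: (xi_comm D Hj).
Qed.

Lemma cg_ne l l' : l.2 != l'.2 -> cg 2 (lv l * lv l') (lv l' * lv l).
Proof.
case: l l' => -[p a] i [[p' b] j] /= ij.
have [Ep|np] := eqVneq p p'; first by rewrite Ep same_comm; exact: cg_refl.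
have H := yx_ne ij a b; have H' : yx_comm j i by apply: yx_ne; rewrite eq_sym.
rewrite -!ev2; case: p p' np => [] [] // _.
by apply/cg_sym/H'.
Qed.

Lemma cg_ne_ev l s : all (fun l' => l.2 != l'.2) s ->
  cg (size s).+1 (lv l * ev s) (ev s * lv l).
Proof.
elim: s => [|l' s IH] /=; first by rewrite /ev big_nil mulr1 mul1r => _; exact: cg_refl.
case/andP => /cg_ne ne /IH H; rewrite ev_cons.
apply: (@cg_trans _ _ (lv l' * lv l * ev s)).
  by rewrite mulrA -(add2n (size s)); apply: cgMr ne; exact: G_ev.
by rewrite -!mulrA -(add1n (size s).+1); apply: cgMl H; exact: G_letter.
Qed.

Lemma cg_gather i s : cg (size s) (ev s)
  (ev ([seq l <- s | l.2 == i] ++ [seq l <- s | l.2 != i])).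
Proof.
elim: s => [|l s IH] /=; first exact: cg_refl.
have H : cg (size s).+1 (ev (l :: s))
    (lv l * ev ([seq l <- s | l.2 == i] ++ [seq l <- s | l.2 != i])).
  by rewrite ev_cons -(add1n (size s)); apply: cgMl IH; exact: G_letter.
case: (eqVneq l.2 i) => li /=; first by rewrite [X in cg _ _ X]ev_cons.
apply: cg_trans H _; rewrite !ev_cat ev_cons mulrA [X in cg _ _ X]mulrA.
set u := filter _ _; set r := filter _ _.
have sz : (size s).+1 = ((size u).+1 + size r)%N.
  rewrite addSn; congr _.+1; rewrite !size_filter -(count_predC (fun l => l.2 == i) s).
  by [].
rewrite sz; apply: cgMr; first exact: G_ev.
apply: cg_ne_ev; apply/allP => l'; rewrite mem_filter => /andP[/eqP -> _].
by [].
Qed.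

(** * Normal order in one pair of variables *)

Let cg_yx_pow a b n : cg n.+1 (yl a i0 * xl b i0 ^+ n)
  (qsgn a b ^+ n *: (xl b i0 ^+ n * yl a i0)).
Proof.
have Oq' : O (qsgn a b) by rewrite /qsgn; case: ifP.
elim: n => [|n IH]; first by rewrite !expr0 mulr1 mul1r scale1r; exact: cg_refl.
rewrite exprS mulrA.
apply: (@cg_trans _ _ (qsgn a b *: (xl b i0 * (yl a i0 * xl b i0 ^+ n)))).
  rewrite mulrA scaleAl -add2n -[X in (2 + X)%N]muln1.
  by apply: cgMr (cg_yx0 a b); exact: G_exp.
rewrite exprS -scalerA -!mulrA; apply: cgZ => //.
by rewrite scaleAr -(add1n n.+1); apply: cgMl IH.
Qed.

Definition mxy (a b : int) : A := xz x xi 0 a * zpow (y 0%N) (yi 0%N) b.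

Lemma G_zpow z zi a : G 1 z -> G 1 zi -> G `|a|%N (zpow z zi a).
Proof.
by move=> Gz Gzi; case: a => n; rewrite /zpow /= -[X in G X]muln1; exact: G_exp.
Qed.

Lemma cg_y_mxy c a b : cg (`|a| + `|b|).+1
  (yl c i0 * mxy a b)
  (q ^ (if c then - a else a) *: (xz x xi 0 a * (yl c i0 * zpow (y 0%N) (yi 0%N) b))).
Proof.
rewrite /mxy mulrA [in X in cg _ _ X]mulrA scaleAl -addSn.
apply: cgMr; first exact: G_zpow.
have [n [s [E1 E2 E3]]] : exists n s, [/\ `|a|%N = n,
    xz x xi 0 a = xl s i0 ^+ n & q ^ (if c then - a else a) = qsgn c s ^+ n].
  case: a => n.
    exists n, false; split=> //; rewrite /qsgn; case: c => //=.
    by rewrite -exprnN -exprVn.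
  exists n.+1, true; split=> //; rewrite /qsgn NegzE; case: c => //=.
  by rewrite -exprnN -exprVn.
by rewrite E1 E2 E3; exact: cg_yx_pow.
Qed.

(** The letters of one index generate a quantum torus modulo v - 1. *)
Lemma cg_normal s : all (fun l => l.2 == i0) s -> exists a b c,
  [/\ (`|a| + `|b| <= size s)%N, O c & cg (size s) (ev s) (c *: mxy a b)].
Proof.
elim: s => [_|[[p f] i] s IH] /=.
  exists 0, 0, 1; split=> //.
  by rewrite /ev big_nil /mxy /xz zpow0 zpow0 mulr1 scale1r; exact: cg_refl.
case/andP => /eqP /= -> /IH [a [b [c [le Oc H]]]].
have H' : cg (size s).+1 (ev (((p, f), i0) :: s)) (c *: (lv ((p, f), i0) * mxy a b)).
  by rewrite ev_cons scaleAr -(add1n (size s)); apply: cgMl H; exact: G_letter.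
case: p H' => H'.
  pose b' : int := if f then b - 1 else b + 1.
  exists a, b', (c * q ^ (if f then - a else a)); split.
  - rewrite /b'; apply: leq_trans (leq_add (leqnn _) (absz_step f b)) _.
    by rewrite addnS ltnS.
  - by apply: OM => //; exact: O_zpow.
  apply: (cg_trans H'); rewrite -scalerA; apply: cgZ => //.
  have -> : mxy a b' = xz x xi 0 a * (yl f i0 * zpow (y 0%N) (yi 0%N) b).
    rewrite /mxy /b' /yl /letter_val; case: f {H' b'} => /=; congr (_ * _).
      by apply: zpowP.
    by rewrite zpowS.
  by apply: cg_leq (cg_y_mxy f a b).
pose a' : int := if f then a - 1 else a + 1.
exists a', b, c; split=> //; first by apply: leq_trans (leq_add (absz_step f a) (leqnn _)) _.
have -> : mxy a' b = lv ((false, f), i0) * mxy a b => //.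
rewrite /mxy /a' /letter_val mulrA; case: f {H' a'} => /=; congr (_ * _).
  by rewrite /xz zpowP.
by rewrite /xz zpowS.
Qed.

(** * Approximation by the image *)

Variable S : A.
Hypotheses (SS : symmetrizer v N t S) (G_S : G 0 S).

Variable W : A -> Prop.
Hypotheses (W0 : W 0) (WD : forall a b, W a -> W b -> W (a + b))
  (WZ : forall c a, W a -> W (c *: a)) (WM : forall a b, W a -> W b -> W (a * b))
  (W_S : W S) (W_e : forall m, W (cure x xi yi S m))
  (W_f : forall m, W (curf x xi y S m)).

Let qN_neq0 : qnum v N != 0 := proj1 (lr_qnum HO N_gt0).
Let O_qNV : O (qnum v N)^-1 := proj2 (lr_qnum HO N_gt0).
Let O_qN : O (qnum v N).
Proof. by apply: O_sum => // k _; exact: O_exp. Qed.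
Let SeS : S * S = S := S_S SS.

Let WB a b : W a -> W b -> W (a - b).
Proof. by move=> Wa Wb; apply: WD => //; rewrite -scaleN1r; apply: WZ. Qed.

(** The elements of degree [d] that the subalgebra [W] attains modulo [v - 1]. *)
Definition E d z : Prop := exists2 a, W a /\ G d a & cg d z a.

Lemma E_W d a : W a -> G d a -> E d a.
Proof. by move=> Wa Ga; exists a; last exact: cg_refl. Qed.

Lemma E_cg d z z' : cg d z z' -> E d z' -> E d z.
Proof. by move=> H [a Ha H']; exists a => //; exact: cg_trans H'. Qed.

Lemma E_G d z : E d z -> G d z.
Proof. by move=> [a [_ Ga] H]; exact: cg_G Ga. Qed.

Lemma E_leq d e z : (d <= e)%N -> E d z -> E e z.
Proof.
move=> le [a [Wa Ga] H]; exists a; last exact: cg_leq H.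
by split=> //; exact: G_leq Ga.
Qed.

Lemma ED d z z' : E d z -> E d z' -> E d (z + z').
Proof.
move=> [a [Wa Ga] H] [a' [Wa' Ga'] H']; exists (a + a'); last exact: cgD.
by split; [exact: WD|exact: GD].
Qed.

Lemma EZ d c z : O c -> E d z -> E d (c *: z).
Proof.
move=> Oc [a [Wa Ga] H]; exists (c *: a); last exact: cgZ.
by split; [exact: WZ|exact: GZ].
Qed.

Lemma EB d z z' : E d z -> E d z' -> E d (z - z').
Proof.
move=> Ez Ez'; apply: ED => //; rewrite -scaleN1r; apply: EZ => //; exact: ON.
Qed.

Lemma E_0 d : E d 0.
Proof. by apply: E_W => //; exact: G_0. Qed.

Lemma E_sum d (I : Type) (r : seq I) (P : pred I) (F : I -> A) :
  (forall i, P i -> E d (F i)) -> E d (\sum_(i <- r | P i) F i).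
Proof. by move=> H; apply: big_ind => //; [exact: E_0|exact: ED]. Qed.

Lemma EM d e z z' : E d z -> E e z' -> E (d + e) (z * z').
Proof.
move=> Ez [a' [Wa' Ga'] H']; have Gz := E_G Ez; case: Ez => a [Wa Ga] H.
exists (a * a'); first by split; [exact: WM|exact: GM].
exact: cgM.
Qed.

Lemma E_unscale d c z : c != 0 -> O c^-1 -> E d (c *: z) -> E d z.
Proof.
by move=> c0 Oc /(EZ Oc); rewrite scalerA mulVf // scale1r.
Qed.

Definition sph z : A := S * z * S.

Lemma G_sph d z : G d z -> G d (sph z).
Proof.
move=> Gz; rewrite /sph -[d]addn0 -[d in G (d + 0)]add0n.
by apply: GM G_S; apply: GM.
Qed.

Lemma cg_sph d z z' : cg d z z' -> cg d (sph z) (sph z').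
Proof.
move=> H; rewrite /sph -[d]addn0 -[d in cg (d + 0)]add0n.
by apply: cgMr G_S _; apply: cgMl.
Qed.

Lemma sphZ c z : sph (c *: z) = c *: sph z.
Proof. by rewrite /sph -scaleAr -scaleAl. Qed.

Lemma sph_sum (I : Type) (r : seq I) (P : pred I) (F : I -> A) :
  sph (\sum_(i <- r | P i) F i) = \sum_(i <- r | P i) sph (F i).
Proof. by rewrite /sph mulr_sumr mulr_suml. Qed.

Lemma sphB z z' : sph (z - z') = sph z - sph z'.
Proof. by rewrite /sph mulrBr mulrBl. Qed.

Lemma sph_mull p z : GRing.comm p S -> p * S * sph z = sph (p * z).
Proof. by move=> C; rewrite /sph !mulrA -(mulrA p S S) SeS C. Qed.

Lemma sph_mulr p z : GRing.comm p S -> sph z * (p * S) = sph (z * p).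
Proof. by move=> C; rewrite /sph C mulrA -(mulrA (S * z)) SeS -!mulrA C. Qed.

(** ** Permutation of the indices *)

(** S absorbs T_k up to the factor v, and T_k permutes the letters. *)
Lemma cg_perm (p : 'S_N) s :
  cg (size s) (sph (ev s)) (sph (ev (map (act p) s))).
Proof.
have [r <-] := word_perm_surj p.
have simple (k : 'I_N.-1) s' :
    cg (size s') (sph (ev s')) (sph (ev (map (act (si k)) s'))).
  have Hk : (k.+1 < N)%N := ltn_ord (snd_idx k).
  have -> : sph (ev s') = v^-1 *: (S * (t k * ev s') * S).
    by rewrite mulrA (sym_tr SS Hk) -!scaleAl scalerA mulVf // scale1r.
  have -> : sph (ev (map (act (si k)) s')) =
      v^-1 *: (S * (ev (map (act (si k)) s') * t k) * S).
    by rewrite -!mulrA (sym_tl SS Hk) -!scaleAr scalerA mulVf // scale1r !mulrA.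
  by apply: cgZ => //; apply/cg_sph/cg_t_ev.
elim: r s => [|k r IH] s.
  have -> : map (act (word_perm [::])) s = s.
    rewrite -[RHS]map_id; apply: eq_map => -[ty i].
    by rewrite /act /word_perm big_nil perm1.
  exact: cg_refl.
apply: cg_trans (simple k s) _; have := IH (map (act (si k)) s).
rewrite size_map -map_comp; congr (cg _ _ (sph (ev _))).
by apply: eq_map => -[ty i]; rewrite /= /act word_perm_cons permM.
Qed.

Lemma cg_sym_comm d z b : (forall k : 'I_N.-1, cg d (t k * z) (z * t k)) ->
  G 0 b -> G d z -> cg d (b * z) (z * b).
Proof.
move=> H [c Oc ->] Gz; rewrite big_mkord mulr_suml mulr_sumr; apply: cg_sum => i _.
rewrite -scaleAl -scaleAr; apply: cgZ => //.
have /mapP[p _ ->] : (word_list 0)`_i \in word_list 0 by apply: mem_nth.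
rewrite /hecke_T; elim: (reduced_word p) => [|k r IH].
  by rewrite big_nil mul1r mulr1; exact: cg_refl.
have Gr : G 0 (\prod_(j <- r) t j).
  by apply: G_prod0 => j _; apply: G_t1; exact: ltn_ord (snd_idx j).
rewrite big_cons; apply: (@cg_trans _ _ (t k * z * \prod_(j <- r) t j)).
  by rewrite -!mulrA; apply: (@cgMl d 0) => //; exact: G_t1 (ltn_ord (snd_idx k)).
by rewrite mulrA -[d]addn0; apply: cgMr.
Qed.

(** ** Monomials in one pair of variables *)

Let P n := psum N x xi n.

Let W_psum1 : W (P 1 * S).
Proof.
have := curf1_cure0 D SS qN_neq0; set mu := _ / _ => E1.
have mu0 : mu != 0.
  have [q1 _] := lr_qpow HO (isT : (1 : int) != 0).
  by rewrite /mu !mulf_neq0 ?invr_eq0 ?expf_neq0.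
have -> : P 1 * S = mu^-1 *: (mu *: (P 1 * S)) by rewrite scalerA mulVf // scale1r.
by rewrite -E1; apply/WZ/WB; apply: WM.
Qed.

Let W_psumN1 : W (P (-1) * S).
Proof.
have := curfN1_cure0 D SS qN_neq0; set mu := _ / _ => E1.
have mu0 : mu != 0.
  have [q1 _] := lr_qpow HO (isT : (-1 : int) != 0).
  by rewrite /mu !mulf_neq0 ?invr_eq0 ?expf_neq0 // -exprN1.
have -> : P (-1) * S = mu^-1 *: (mu *: (P (-1) * S)).
  by rewrite scalerA mulVf // scale1r.
by rewrite -E1; apply/WZ/WB; apply: WM.
Qed.

Let ys (c : bool) : A := \sum_(j < N) yl c j.

Let ysE c : ys c = if c then yisum N yi else ysum N y.
Proof. by rewrite /ys; case: c; rewrite /yisum /ysum big_mkord. Qed.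

Let ys_S c : GRing.comm (ys c) S.
Proof. by rewrite ysE; case: c; [exact (yisum_comm D SS)|exact (ysum_comm D SS)]. Qed.

Let W_ys c : W (ys c * S).
Proof.
rewrite ysE; case: c.
  have -> : yisum N yi * S = qnum v N *: cure x xi yi S 0.
    by rewrite (cure0 D SS qN_neq0) scalerA mulfV // scale1r.
  exact: WZ.
have := curf0 D SS qN_neq0; have := qNV_neq0 D qN_neq0; set mu := \sum_(_ <= _ < _) _.
move=> mu0 E1; have -> : ysum N y * S = mu *: curf x xi y S 0.
  by rewrite E1 scalerA mulfV // scale1r.
exact: WZ.
Qed.

Let G_ys c : G 1 (ys c).
Proof. by apply: G_sum => j _; exact: G_yl. Qed.

Let E_ys c : E 1 (ys c * S).
Proof. by apply: E_W => //; apply: (@GM 1 0). Qed.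

Let pow_comm (z p r : A) n : z * p - p * z = r ->
  z ^+ n * p - p * z ^+ n = \sum_(a < n) z ^+ a * r * z ^+ (n.-1 - a).
Proof.
move=> E1; elim: n => [|n IH]; first by rewrite big_ord0 mulr1 mul1r subrr.
rewrite big_ord_recr /= subnn expr0 mulr1.
have -> : \sum_(a < n) z ^+ a * r * z ^+ (n - a)
    = (\sum_(a < n) z ^+ a * r * z ^+ (n.-1 - a)) * z.
  rewrite mulr_suml; apply: eq_bigr => a _; rewrite -[RHS]mulrA -exprSr.
  by have Ha := ltn_ord a; congr (_ * _ ^+ _); lia.
rewrite -IH -E1 exprSr; nc.
Qed.

Let conj_pow (a b z : A) n : b * a = 1 -> a * b = 1 -> (a * z * b) ^+ n = a * z ^+ n * b.
Proof.
move=> ba ab; elim: n => [|n IH]; first by rewrite !expr0 mulr1 ab.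
by rewrite !exprS IH -!mulrA (mulA20 ba).
Qed.

Let exprZ_ (c : K) (z : A) n : (c *: z) ^+ n = c ^+ n *: z ^+ n.
Proof.
elim: n => [|n IH]; first by rewrite !expr0 scale1r.
by rewrite !exprS IH -scaleAl -scaleAr scalerA.
Qed.

Let cg_powZ z z' c i : G 1 z -> G 1 z' -> O c -> cg 1 z' (c *: z) ->
  cg i (z' ^+ i) (c ^+ i *: z ^+ i).
Proof.
move=> Gz Gz' Oc H; have := @cg_exp 1 z' (c *: z) i Gz' (GZ Oc Gz) H.
by rewrite muln1 exprZ_.
Qed.

Let G_exp1 z i : G 1 z -> G i (z ^+ i).
Proof. by move=> Gz; have := G_exp i Gz; rewrite muln1. Qed.

Let cg_powl z z' c i j n : G 1 z -> G 1 z' -> O c -> cg 1 z' (c *: z) ->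
  (i + j)%N = n -> cg n (z' ^+ i * z ^+ j) (c ^+ i *: z ^+ n).
Proof.
move=> Gz Gz' Oc H <-; rewrite exprD scaleAl.
by apply: cgMr; [exact: G_exp1|exact: cg_powZ].
Qed.

Let cg_powr z z' c i j n : G 1 z -> G 1 z' -> O c -> cg 1 z' (c *: z) ->
  (j + i)%N = n -> cg n (z ^+ j * z' ^+ i) (c ^+ i *: z ^+ n).
Proof.
move=> Gz Gz' Oc H <-; rewrite exprD scaleAr.
by apply: cgMl; [exact: G_exp1|exact: cg_powZ].
Qed.

(** The pattern of the next lemmas: b is a commutator that expands as a sum of
    elements F a, each of which is a multiple of z^n modulo v - 1, and the total
    coefficient u is invertible in O. *)
Let E_pow z n b (F : nat -> A) (c : nat -> K) g u : G 1 z ->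
  W b -> b = g *: \sum_(a < n) sph (F a) -> O g ->
  (forall a, (a < n)%N -> O (c a) /\ cg n (F a) (c a *: z ^+ n)) ->
  g * \sum_(a < n) c a = u -> u != 0 -> O u^-1 -> E n (sph (z ^+ n)).
Proof.
move=> Gz Wb bE Og HF uE u0 OuV; apply: (E_unscale u0 OuV).
have GF a : (a < n)%N -> G n (F a).
  by move=> Ha; have [Oc H] := HF a Ha; apply: cg_G H _; apply/GZ/G_exp1.
apply: (@E_cg _ _ b); last first.
  apply: E_W => //; rewrite bE; apply: GZ => //; apply: G_sum => a _.
  exact/G_sph/GF.
rewrite bE -uE -scalerA; apply: cgZ => //; rewrite scaler_suml; apply: cg_sum => a _.
rewrite -sphZ; apply/cg_sph/cg_sym.
by have [] := HF a (ltn_ord a).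
Qed.

Let geom c n : (c - 1) * \sum_(a < n) c ^+ a = c ^+ n - 1 :> K.
Proof. by rewrite subrX1. Qed.

Let q_unit (a : int) : a != 0 -> q ^ a - 1 != 0 := fun Ha => proj1 (lr_qpow HO Ha).
Let O_qpowV (a : int) : a != 0 -> O (q ^ a - 1)^-1 := fun Ha => proj2 (lr_qpow HO Ha).

Let cg_tup ty m (Hm : (m < N)%N) :
  cg 1 (tup t 0 m * lv (ty, Ordinal Hm)) (lv (ty, i0) * tup t 0 m).
Proof.
elim: m Hm => [|m IH] Hm.
  rewrite /tup big_geq // mul1r mulr1 (_ : Ordinal Hm = i0); first exact: cg_refl.
  exact: val_inj.
have Hm' : (m < N.-1)%N by lia.
pose k : 'I_N.-1 := Ordinal Hm'.
have Hm1 : (m < N)%N by lia.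
have TE : tup t 0 m.+1 = tup t 0 m * t k by rewrite /tup big_nat_recr.
rewrite TE; have := cg_t_letter k (ty, snd_idx k); rewrite /act /= tpermR.
have -> : snd_idx k = Ordinal Hm by exact: val_inj.
have -> : fst_idx k = Ordinal Hm1 by exact: val_inj.
move=> H; apply: (@cg_trans _ _ (tup t 0 m * (lv (ty, Ordinal Hm1) * t k))).
  by rewrite -mulrA; apply: (@cgMl 1 0); [exact: (G_tup 0 Hm1)|exact: H].
by rewrite !mulrA; apply: (@cgMr 1 0); [exact: G_t1|exact: IH].
Qed.

(** Y_1 is w up to a product of T's, and w permutes the X's up to q. *)
Let conj_x0 s : let c := if s then q^-1 else q in
  G 1 (y 0%N * xl s i0 * yi 0%N) /\
  cg 1 (y 0%N * xl s i0 * yi 0%N) (c *: xl s i0).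
Proof.
move=> c; have MN' := MN D.
have Oc : O c by rewrite /c; case: (s).
have -> : y 0%N * xl s i0 * yi 0%N
    = c *: (tup t 0 N.-1 * lv ((false, s), Ordinal MN') * tupI ti 0 N.-1).
  rewrite (y0E D) (yi0E D).
  have Ew : w N ti y * xl s i0 = c *: (lv ((false, s), Ordinal MN') * w N ti y).
    rewrite scaleAl /xl /c /letter_val; case: (s) => /=; [exact (w_xi0 D)|exact (w_x0 D)].
  rewrite -!mulrA (mulrA (w N ti y) (xl s i0)) Ew -!scaleAl -!scaleAr.
  by rewrite -!mulrA (mulA20 (w_wi D)).
have H : cg 1 (tup t 0 N.-1 * lv ((false, s), Ordinal MN') * tupI ti 0 N.-1) (xl s i0).
  have := @cgMr 1 0 (tupI ti 0 N.-1) _ _ (G_tupI 0 MN') (cg_tup (false, s) MN').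
  by rewrite -(mulrA (lv _)) (tupIr D) // mulr1.
split; last exact: cgZ.
by apply: GZ => //; exact: cg_G H (G_xl _ _).
Qed.

(** The commutator of [curf n] and [cure 0] is that of X_1^n with the sum of the
    inverses of the Y_j, which acts on X_1 as in [yisum_x0]. *)
Let E_x n : (0 < n)%N -> E n (sph (x 0%N ^+ n)).
Proof.
move=> n0; have [GX cX] := conj_x0 false.
have n0' : (n%:Z : int) != 0 by lia.
pose F a := (y 0%N * x 0%N * yi 0%N) ^+ a.+1 * x 0%N ^+ (n.-1 - a).
apply: (@E_pow _ n (curf x xi y S n%:Z * cure x xi yi S 0 - cure x xi yi S 0 * curf x xi y S n%:Z)
  F (fun a => q ^+ a.+1) ((qnum v N)^-1 * (1 - q^-1)) ((qnum v N)^-1 * (q ^ n%:Z - 1))) => //.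
- by apply: WB; apply: WM.
- rewrite (curf_cure0 D SS qN_neq0) -scalerA; congr (_ *: _).
  have -> : xz x xi 0 n%:Z = x 0%N ^+ n by [].
  rewrite (@pow_comm _ _ ((1 - q^-1) *: (x 0%N * yi 0%N))); last first.
    by rewrite (yisum_x0 D) opprD addNKr -scaleNr opprB.
  rewrite -sph_sum -sphZ /sph -(mulrA S (y 0%N)); congr (_ * _ * _).
  rewrite mulr_sumr scaler_sumr; apply: eq_bigr => a _; rewrite /F conj_pow //.
  by rewrite exprSr; nc.
- by apply: OM => //; apply: OD => //; apply: ON.
- move=> a Ha; split; first exact: O_exp.
  by apply: cg_powl => //; lia.
- rewrite -mulrA; congr (_ * _); rewrite -(geom q n) mulr_sumr mulr_sumr.
  by apply: eq_bigr => a _; rewrite exprS; field.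
- by rewrite mulf_neq0 ?invr_eq0 ?q_unit.
by rewrite invfM invrK; apply: OM => //; exact: O_qpowV.
Qed.

Let E_xi n : (0 < n)%N -> E n (sph (xi 0%N ^+ n)).
Proof.
move=> n0; have [GX cX] := conj_x0 true.
have n0' : (- n%:Z : int) != 0 by lia.
have En : q ^ (- n%:Z) = q^-1 ^+ n by rewrite -exprnN -exprVn.
have xzE : xz x xi 0 (- n%:Z) = xi 0%N ^+ n by case: (n).
pose F a := (y 0%N * xi 0%N * yi 0%N) ^+ a * xi 0%N ^+ (n - a).
apply: (@E_pow _ n (curf x xi y S (- n%:Z) * cure x xi yi S 0 - cure x xi yi S 0 * curf x xi y S (- n%:Z))
  F (fun a => q^-1 ^+ a) ((qnum v N)^-1 * (q^-1 - 1))
  ((qnum v N)^-1 * (q ^ (- n%:Z) - 1))) => //.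
- by apply: WB; apply: WM.
- rewrite (curf_cure0 D SS qN_neq0) -scalerA; congr (_ *: _).
  have E1 : xi 0%N * yisum N yi - yisum N yi * xi 0%N
      = (q^-1 - 1) *: (yi 0%N * xi 0%N).
    have := congr1 (fun u => xi 0%N * u * xi 0%N) (yisum_x0 D).
    rewrite mulrDr mulrDl -!(scaleAr, scaleAl) -!mulrA !(mulA20 xxi0) xix0 mulr1 => ->.
    by rewrite addrAC subrr add0r.
  rewrite xzE (pow_comm _ E1).
  rewrite -sph_sum -sphZ /sph -(mulrA S (y 0%N)); congr (_ * _ * _).
  rewrite mulr_sumr scaler_sumr; apply: eq_bigr => a _; rewrite /F conj_pow //.
  have -> : (n - a)%N = (n.-1 - a).+1 by have := ltn_ord a; lia.
  by rewrite exprS; nc.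
- by apply: OM => //; apply: OD => //; apply: ON.
- move=> a Ha; split; first exact: O_exp.
  by apply: cg_powl => //; lia.
- by rewrite -mulrA; congr (_ * _); rewrite geom En.
- by rewrite mulf_neq0 ?invr_eq0 ?q_unit.
by rewrite invfM invrK; apply: OM => //; exact: O_qpowV.
Qed.

(** Bracketing with the sum of the Y_j raises the power of Y_1. *)
Let W_yx n : W (sph (y 0%N ^+ n.+1 * xi 0%N)).
Proof.
elim: n => [|n IH].
  by have := W_f (-1); rewrite /curf /sph -(mulrA S (y 0%N)).
have E1 := ysum_xi0 D; set Y := ysum N y in E1.
have YS : GRing.comm Y S by exact (ysum_comm D SS).
have WY : W (Y * S) by have := W_ys false; rewrite ysE.
have Yy : GRing.comm Y (y 0%N).
  apply/commr_sym/comm_sum_seq => j; rewrite mem_index_iota => /andP[_ Hj].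
  by apply: (dyyC D).
have q1 : 1 - q != 0.
  by rewrite -opprB oppr_eq0 -[q]expr1z; exact: q_unit.
suff E2 : Y * S * sph (y 0%N ^+ n.+1 * xi 0%N) - sph (y 0%N ^+ n.+1 * xi 0%N) * (Y * S)
    = (1 - q) *: sph (y 0%N ^+ n.+2 * xi 0%N).
  rewrite -[sph _]scale1r -(mulVf q1) -scalerA -E2; apply/WZ/WB; exact: WM.
have C : Y * y 0%N ^+ n.+1 = y 0%N ^+ n.+1 * Y by exact: commrX.
rewrite [y 0%N ^+ n.+2]exprSr; move: (y 0%N ^+ n.+1) C {IH} => p C.
rewrite sph_mull // sph_mulr // -sphB -sphZ; congr (sph _).
by rewrite mulrA C -!mulrA -mulrBr E1 addrAC subrr add0r -scaleAr.
Qed.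

Let W_xyi n : W (sph (x 0%N * yi 0%N ^+ n.+1)).
Proof.
elim: n => [|n IH].
  by have := W_e 1; rewrite /cure /sph -(mulrA S (xz _ _ _ _)).
have E1 := yisum_x0 D; set Y := yisum N yi in E1.
have YS : GRing.comm Y S by exact (yisum_comm D SS).
have WY : W (Y * S) by have := W_ys true; rewrite ysE.
have Yy : GRing.comm Y (yi 0%N).
  apply/commr_sym/comm_sum_seq => j; rewrite mem_index_iota => /andP[_ Hj].
  by apply: (yi_yi D).
have q1 : q^-1 - 1 != 0.
  by rewrite -exprN1; exact: q_unit.
suff E2 : Y * S * sph (x 0%N * yi 0%N ^+ n.+1) - sph (x 0%N * yi 0%N ^+ n.+1) * (Y * S)
    = (q^-1 - 1) *: sph (x 0%N * yi 0%N ^+ n.+2).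
  rewrite -[sph _]scale1r -(mulVf q1) -scalerA -E2; apply/WZ/WB; exact: WM.
have C : Y * yi 0%N ^+ n.+1 = yi 0%N ^+ n.+1 * Y by exact: commrX.
rewrite [yi 0%N ^+ n.+2]exprS; move: (yi 0%N ^+ n.+1) C {IH} => p C.
rewrite sph_mull // sph_mulr // -sphB -sphZ; congr (sph _).
by rewrite -mulrA -C !mulrA -mulrBl E1 addrAC subrr add0r -scaleAl.
Qed.

Let P_S n : GRing.comm (P n) S. Proof. exact (psum_comm D SS n). Qed.

(** The commutator of P 1 with the element of [W_yx] removes the factor X_1^-1. *)
Let E_y n : (0 < n)%N -> E n (sph (y 0%N ^+ n)).
Proof.
move=> n0; have n0' : (- n%:Z : int) != 0 by lia.
have En : q ^ (- n%:Z) = q^-1 ^+ n by rewrite -exprnN -exprVn.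
pose F a := y 0%N ^+ a.+1 * (x 0%N * y 0%N * xi 0%N) ^+ (n.-1 - a).
have GY : G 1 (x 0%N * y 0%N * xi 0%N) by apply: cg_G cg_conj_y0 _; exact: GZ.
apply: (@E_pow _ n (sph (y 0%N ^+ n * xi 0%N) * (P 1 * S) - P 1 * S * sph (y 0%N ^+ n * xi 0%N))
  F (fun a => q^-1 ^+ (n.-1 - a)) (1 - q^-1) (- (q ^ (- n%:Z) - 1))) => //.
- have := W_yx n.-1; rewrite prednK // => Wn.
  by apply: WB; apply: WM.
- have E1 : y 0%N * P 1 - P 1 * y 0%N = (1 - q^-1) *: (y 0%N * x 0%N).
    rewrite (psum_y0 D 1) mulrDr opprD addNKr -scaleAr -scaleNr opprB.
    by rewrite exprN1 -[xz x xi 0 1]/(x 0%N).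
  have C : P 1 * xi 0%N = xi 0%N * P 1.
    exact: (esym (psum_xz D (-1) 1 N_gt0)).
  rewrite (sph_mulr _ (P_S 1)) (sph_mull _ (P_S 1)) -sphB -sph_sum -sphZ.
  rewrite -mulrA -C !mulrA -mulrBl (pow_comm _ E1); congr (sph _).
  rewrite mulr_suml scaler_sumr; apply: eq_bigr => a _; rewrite /F conj_pow //.
  by rewrite exprSr; nc.
- by apply: OD => //; apply: ON.
- move=> a Ha; split; first exact: O_exp.
  by apply: cg_powr => //; [exact: cg_conj_y0|lia].
- rewrite En -(geom q^-1 n) -mulNr opprB; congr (_ * _).
  rewrite (reindex_inj rev_ord_inj) /=; apply: eq_bigr => a _.
  by have := ltn_ord a => Ha; congr (_ ^+ _); lia.
- by rewrite oppr_eq0 q_unit.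
by rewrite invrN; apply/ON/O_qpowV.
Qed.

Let E_yi n : (0 < n)%N -> E n (sph (yi 0%N ^+ n)).
Proof.
move=> n0; have n0' : (n%:Z : int) != 0 by lia.
pose F a := (x 0%N * yi 0%N * xi 0%N) ^+ a * yi 0%N ^+ (n - a).
have GY : G 1 (x 0%N * yi 0%N * xi 0%N) by apply: cg_G cg_conj_yi0 _; exact: GZ.
apply: (@E_pow _ n (sph (x 0%N * yi 0%N ^+ n) * (P (-1) * S) - P (-1) * S * sph (x 0%N * yi 0%N ^+ n))
  F (fun a => q ^+ a) (q - 1) (q ^ n%:Z - 1)) => //.
- have := W_xyi n.-1; rewrite prednK // => Wn.
  by apply: WB; apply: WM.
- have E1 : yi 0%N * P (-1) - P (-1) * yi 0%N = (q - 1) *: (xi 0%N * yi 0%N).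
    rewrite (yi0_psum D (-1)) mulrDl addrAC subrr add0r -scaleAl.
    by rewrite opprK expr1z -[xz x xi 0 (-1)]/(xi 0%N).
  have C : P (-1) * x 0%N = x 0%N * P (-1).
    exact: (esym (psum_xz D 1 (-1) N_gt0)).
  rewrite (sph_mulr _ (P_S (-1))) (sph_mull _ (P_S (-1))) -sphB -sph_sum -sphZ.
  rewrite [P (-1) * _]mulrA C -!mulrA -mulrBr (pow_comm _ E1); congr (sph _).
  rewrite mulr_sumr scaler_sumr; apply: eq_bigr => a _; rewrite /F conj_pow //.
  have -> : (n - a)%N = (n.-1 - a).+1 by have := ltn_ord a; lia.
  by rewrite exprS; nc.
- by apply: OD => //; apply: ON.
- move=> a Ha; split; first exact: O_exp.
  by apply: cg_powl => //; [exact: cg_conj_yi0|lia].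
- exact: q_unit.
exact (O_qpowV n0').
Qed.

Let cg_ys c a : cg (`|a|).+1 (ys c * xz x xi 0 a - xz x xi 0 a * ys c)
  ((q ^ (if c then - a else a) - 1) *: (xz x xi 0 a * yl c i0)).
Proof.
have -> : (q ^ (if c then - a else a) - 1) *: (xz x xi 0 a * yl c i0)
    = q ^ (if c then - a else a) *: (xz x xi 0 a * yl c i0)
      + \sum_(j < N | j != i0) xz x xi 0 a * yl c j - xz x xi 0 a * ys c.
  have -> : xz x xi 0 a * ys c = xz x xi 0 a * yl c i0
      + \sum_(j < N | j != i0) xz x xi 0 a * yl c j.
    by rewrite /ys mulr_sumr (bigD1 i0).
  by rewrite scalerBl scale1r opprD addrACA addrN addr0.
apply: cgB; last exact: cg_refl.
rewrite /ys mulr_suml (bigD1 i0) //=; apply: cgD.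
  have := cg_y_mxy c a 0; rewrite /mxy /zpow /= !mulr1 addn0.
  by [].
apply: cg_sum => j ji.
have [n [s [-> E2]]] : exists n s, `|a|%N = n /\ xz x xi 0 a = xl s i0 ^+ n.
  case: a => n; first by exists n, false.
  by exists n.+1, true.
rewrite E2 (_ : xl s i0 ^+ n = ev (nseq n ((false, s), i0))); last first.
  elim: (n) => [|m IH]; first by rewrite /ev big_nil.
  by rewrite exprS /= ev_cons IH.
have := @cg_ne_ev ((true, c), j) (nseq n ((false, s), i0)).
rewrite size_nseq; apply.
by apply/allP => l /nseqP[-> _].
Qed.

Let ys_yz c b : ys c * zpow (y 0%N) (yi 0%N) b = zpow (y 0%N) (yi 0%N) b * ys c.
Proof.
have C f : GRing.comm (ys c) (yl f i0).
  by apply/commr_sym/commr_sum => j _; exact: same_comm.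
by apply: comm_zpow; [exact: (C false)|exact: (C true)].
Qed.

(** The bracket with the sum of the Y_j (of their inverses, for c = true)
    multiplies a monomial by one more letter Y_1 and by q^a - 1 or q^-a - 1: modulo
    v - 1 only the term of index 1 does not commute with X_1. *)
Let climb c a b : a != 0 -> let b' := if c then b - 1 else b + 1 in
  `|b'|%N = (`|b|).+1 -> E (`|a| + `|b|) (sph (mxy a b)) ->
  E (`|a| + `|b'|) (sph (mxy a b')).
Proof.
move=> a0 b' b'E H.
have ca0 : (if c then - a else a) != 0 by case: (c); rewrite ?oppr_eq0.
apply: (E_unscale (q_unit ca0) (O_qpowV ca0)); rewrite -sphZ b'E addnS.
have mE : mxy a b' = xz x xi 0 a * yl c i0 * zpow (y 0%N) (yi 0%N) b.
  rewrite /mxy /b' /yl /letter_val -mulrA; congr (_ * _).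
  by case: (c) => /=; rewrite ?zpowP ?zpowS.
have Z : E (`|a| + `|b|).+1 (sph ((ys c * xz x xi 0 a - xz x xi 0 a * ys c)
    * zpow (y 0%N) (yi 0%N) b)).
  have -> : (ys c * xz x xi 0 a - xz x xi 0 a * ys c) * zpow (y 0%N) (yi 0%N) b
     = ys c * mxy a b - mxy a b * ys c.
    by rewrite mulrBl /mxy -!(mulrA (xz _ _ _ _)) ys_yz mulrA.
  rewrite sphB -(sph_mull _ (ys_S c)) -(sph_mulr _ (ys_S c)).
  apply: EB; first by rewrite -add1n; exact: EM.
  by rewrite -addn1; exact: EM.
apply: E_cg Z; apply/cg_sph/cg_sym; rewrite mE scaleAl -addSn.
by apply: cgMr; [exact: G_zpow|exact: cg_ys].
Qed.

Let E_mxy a b : E (`|a| + `|b|) (sph (mxy a b)).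
Proof.
have [->|a0] := eqVneq a 0.
  rewrite /mxy mul1r; case: b => [[|n]|n].
  - by rewrite /sph mulr1 SeS; apply: E_W.
  - exact: E_y.
  exact: E_yi.
have base : E (`|a| + 0) (sph (mxy a 0)).
  rewrite /mxy mulr1 addn0; case: a a0 => [[|n]|n] // _; first exact: E_x.
  exact: E_xi.
case: b => n.
  elim: n => [//|n IH].
  have := @climb false a n%:Z a0; rewrite /= addn1 => H.
  have := H erefl IH; have -> : n%:Z + 1 = n.+1%:Z by lia.
  by [].
elim: n => [|n IH].
  by have := @climb true a 0 a0; rewrite /= => H; exact: (H erefl base).
have := @climb true a (Negz n) a0.
have -> : Negz n - 1 = Negz n.+1 by lia.
by move=> H; exact: (H erefl IH).
Qed.

(** ** Words in several indices *)

Let E_single (i : 'I_N) (s : seq letter) : all (fun l => l.2 == i) s -> E (size s) (sph (ev s)).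
Proof.
move=> Hs; pose s0 := map (act (tperm i i0)) s.
have Hs0 : all (fun l => l.2 == i0) s0.
  apply/allP => _ /mapP[l /(allP Hs) /eqP li ->]; rewrite /act /= li tpermL.
  by [].
apply: E_cg (cg_perm (tperm i i0) s) _; rewrite -/s0.
have sz : size s0 = size s by rewrite size_map.
have [a [b [c [le Oc H]]]] := cg_normal Hs0; rewrite -sz.
apply: E_cg (cg_sph H) _; rewrite sphZ; apply: EZ => //.
by apply: E_leq le _; exact: E_mxy.
Qed.

Let idx (s : seq letter) : seq 'I_N := undup [seq l.2 | l <- s].

(** Modulo v - 1 the element [S u S r S] is the average over j of [S u_j r S],
    where u_j is u with its index changed to j. If j occurs in r then this word
    has fewer indices than u r; otherwise it is conjugate to u r. *)
Let E_split (i : 'I_N) (u r : seq letter) : all (fun l => l.2 == i) u -> all (fun l => l.2 != i) r ->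
  (forall s, (size s <= size u + size r)%N -> {subset idx s <= idx r} ->
    E (size s) (sph (ev s))) ->
  E (size u + size r) (sph (ev (u ++ r))).
Proof.
move=> Hu Hr HE; pose U (j : 'I_N) : seq letter := map (fun l : letter => (l.1, j)) u.
have szU j : size (U j) = size u by rewrite size_map.
have UE : U i = u.
  rewrite -[RHS]map_id; apply/eq_in_map => -[ty j] /(allP Hu) /eqP /= ->.
  by [].
have actU (p : 'S_N) j : map (act p) (U j) = U (p j).
  by rewrite /U -map_comp.
pose Z := \sum_j ev (U j).
have GZ' : G (size u) Z by apply: G_sum => j _; rewrite -(szU j); exact: G_ev.
have ZT (k : 'I_N.-1) : cg (size u) (t k * Z) (Z * t k).
  rewrite /Z mulr_sumr [in X in cg _ _ X](reindex_inj (@perm_inj _ (si k))) /= mulr_suml.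
  by apply: cg_sum => j _; rewrite -(szU j) -actU; exact: cg_t_ev.
have ZS : cg (size u) (S * Z) (Z * S) by apply: cg_sym_comm.
have SZ : cg (size u) (N%:R *: sph (ev u)) (S * Z).
  have H1 : cg (size u) (N%:R *: sph (ev u)) (\sum_j sph (ev (U j))).
    rewrite scaler_nat -[X in _ *+ X]card_ord -sumr_const; apply: cg_sum => j _.
    have := cg_perm (tperm i j) (U i); rewrite actU tpermL UE.
    by [].
  apply: cg_trans H1 _; rewrite -sph_sum -/Z.
  apply: (@cg_trans _ _ (S * (S * Z))); last by rewrite mulrA SeS; exact: cg_refl.
  by rewrite /sph -mulrA; apply: (@cgMl _ 0) => //; exact: cg_sym.
have Eu : E (size u) (sph (ev u)).
  exact: E_single Hu.
have Er : E (size r) (sph (ev r)) by apply: HE => //; rewrite leq_addl.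
have prod : cg (size u + size r) (N%:R *: (sph (ev u) * sph (ev r)))
    (\sum_j sph (ev (U j ++ r))).
  apply: (@cg_trans _ _ (S * Z * sph (ev r))).
    by rewrite scaleAl; apply: cgMr SZ; apply/G_sph/G_ev.
  apply: (@cg_trans _ _ (S * (S * Z) * (ev r * S))).
    rewrite /sph -(mulrA S (ev r) S) mulrA -(mulrA S Z S).
    apply: cgMr; first by rewrite -[size r]addn0; apply: GM => //; exact: G_ev.
    by apply: (@cgMl _ 0) => //; exact: cg_sym.
  rewrite (mulrA S S Z) SeS /Z mulr_sumr mulr_suml; apply: cg_sum => j _.
  by rewrite /sph ev_cat !mulrA; exact: cg_refl.
have Eall : E (size u + size r) (\sum_j sph (ev (U j ++ r))).
  apply: E_cg (cg_sym prod) _; apply: EZ; first exact: O_nat.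
  exact: EM.
pose J := [pred j | j \in idx r].
have iJ : i \notin idx r.
  rewrite mem_undup; apply/negP => /mapP[l /(allP Hr) /= + E0].
  by rewrite -E0 eqxx.
rewrite (bigID J) /= in Eall.
have Ein : E (size u + size r) (\sum_(j | J j) sph (ev (U j ++ r))).
  apply: E_sum => j Hj; have sz : size (U j ++ r) = (size u + size r)%N.
    by rewrite size_cat szU.
  rewrite -sz; apply: HE; first by rewrite sz.
  move=> l; rewrite !mem_undup map_cat mem_cat => /orP[|//].
  move=> /mapP[l' /mapP[l'' _ ->] /= ->].
  by move: Hj; rewrite /J /= mem_undup.
have Eout : E (size u + size r) (\sum_(j | ~~ J j) sph (ev (U j ++ r))).
  have := EB Eall Ein; rewrite addrAC subrr add0r.
  by [].
pose m := #|[pred j | ~~ J j]|.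
have m0 : (0 < m)%N by apply/card_gt0P; exists i.
have [mn0 OmV] := lr_nat HO m0.
apply: (E_unscale mn0 OmV); apply: E_cg Eout.
rewrite scaler_nat -sumr_const; apply: cg_sum => j Hj.
have actu : map (act (tperm i j)) u = U j by rewrite -[in LHS]UE actU tpermL.
have := cg_perm (tperm i j) (u ++ r); rewrite size_cat map_cat actu.
suff -> : map (act (tperm i j)) r = r by [].
rewrite -[RHS]map_id; apply/eq_in_map => -[ty k] Hk; rewrite /act /=.
have kr : k \in idx r by rewrite mem_undup; apply/mapP; exists (ty, k).
rewrite tpermD //; first by apply: contraNneq iJ => ->.
by apply: contraNneq Hj => ->.
Qed.

Lemma E_word s : E (size s) (sph (ev s)).
Proof.
move: {2}(size (idx s)) (leqnn (size (idx s))) => n.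
elim: n s => [|n IH] s Hn; case: s Hn => [_|l s Hn].
- by apply: (@E_single i0).
- have : l.2 \in idx (l :: s) by rewrite mem_undup mem_head.
  by move: Hn; rewrite leqn0 size_eq0 => /eqP ->.
- by apply: (@E_single i0).
set s' := l :: s in Hn *; pose i := l.2.
pose u := [seq l' <- s' | l'.2 == i]; pose r := [seq l' <- s' | l'.2 != i].
have sz : (size u + size r = size s')%N.
  by rewrite !size_filter -(count_predC (fun l' => l'.2 == i) s').
apply: E_cg (cg_sph (cg_gather i s')) _; rewrite -/u -/r -sz.
apply: (@E_split i); [exact: filter_all|exact: filter_all|].
move=> s1 _ sub; apply: IH; rewrite -ltnS; apply: leq_trans Hn.
have iu : i \in idx s' by rewrite mem_undup mem_head.
have ir : i \notin idx r.
  by rewrite mem_undup; apply/negP => /mapP[l']; rewrite mem_filter => /andP[+ _ E0]; rewrite -E0 eqxx.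
apply: (@uniq_leq_size _ (i :: idx s1)).
  rewrite /= undup_uniq andbT; apply: contra ir; exact: sub.
move=> j; rewrite inE => /orP[/eqP -> //|/sub].
rewrite !mem_undup => /mapP[l']; rewrite mem_filter => /andP[_ Hl'] ->.
exact: map_f.
Qed.

(** * The spherical elements of bounded degree *)

(** T_w can be moved to the left, where S absorbs it. *)
Let E_th (p : seq 'I_N.-1) s z d : G d z -> exists s',
  size s' = size s /\ cg (size s + d) (S * ev s * (\prod_(k <- p) t k * z) * S)
    (v ^+ size p *: (S * ev s' * z * S)).
Proof.
move=> Gz; elim: p s => [|k p IH] s.
  exists s; split=> //; rewrite big_nil mul1r scale1r; exact: cg_refl.
have Hk : (k.+1 < N)%N := ltn_ord (snd_idx k).
have [s' [sz H]] := IH (map (act (si k)) s).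
exists s'; split; first by rewrite sz size_map.
rewrite big_cons exprS -scalerA.
have Gp : G 0 (\prod_(j <- p) t j).
  by apply: G_prod0 => j _; apply: G_t1; exact: ltn_ord (snd_idx j).
rewrite size_map in H; apply: cg_trans (cgZ Ov H).
have -> : v *: (S * ev (map (act (si k)) s) * (\prod_(j <- p) t j * z) * S)
   = S * (t k * ev (map (act (si k)) s)) * (\prod_(j <- p) t j * z) * S.
  by rewrite (mulrA S (t k)) (sym_tr SS Hk) -!scaleAl.
have HH : cg (size s) (ev s * t k) (t k * ev (map (act (si k)) s)).
  have inv : map (act (si k)) (map (act (si k)) s) = s.
    rewrite -map_comp -[RHS]map_id; apply: eq_map => -[ty j].
    by rewrite /act /= tpermK.
  have := cg_t_ev k (map (act (si k)) s); rewrite size_map inv.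
  exact: cg_sym.
rewrite -[(_ + d)%N]addn0; apply: cgMr => //.
move: (\prod_(j <- p) t j) Gp => T GT.
have -> : S * ev s * (t k * T * z) = S * (ev s * t k) * (T * z) by rewrite !mulrA.
apply: cgMr; first exact: (@GM 0 d).
by apply: (@cgMl _ 0).
Qed.

Let E_list d s z : z \in word_list d -> E (size s + d) (S * ev s * z * S).
Proof.
elim: d s z => [|d IH] s z.
  case/mapP => p _ ->; rewrite addn0 /hecke_T.
  have [s' [sz H]] := @E_th (reduced_word p) s 1 0 (G_1 0).
  rewrite addn0 !mulr1 in H; apply: E_cg H _; apply: EZ; first exact: O_exp.
  by rewrite -sz; exact: E_word.
rewrite mem_cat => /orP[Hz|]; first by apply: E_leq (IH s z Hz); rewrite leq_add2l.
case/allpairsP => -[b z'] /= [/mapP[p _ ->] /allpairsP[[l m] /= [_ Hm ->]] ->].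
have Gm := G_mem Hm; have Glm := G_lv l Gm.
have [s' [sz H]] := @E_th (reduced_word p) s _ _ Glm.
apply: E_cg H _; apply: EZ; first exact: O_exp.
have := IH (rcons s' l) m Hm; rewrite size_rcons sz addSn -addnS.
by rewrite -cats1 ev_cat /ev big_seq1 !mulrA.
Qed.

Hypotheses (W_Sl : forall a, W a -> S * a = a) (W_Sr : forall a, W a -> a * S = a).

(** The elements S m S, for m in the finite list, satisfy the hypothesis of
    Nakayama's lemma: a remainder (v - 1) g with g in G d can be replaced by
    (v - 1) S g S. *)
Lemma W_word d z : z \in word_list d -> W (sph z).
Proof.
move=> Hz; pose L := [seq sph m | m <- word_list d].
apply: (@nakayama K O (v - 1) O1 OD ON OM O_eps (lr_loc HO) A L W) => //; last first.
  exact: map_f.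
move=> _ /mapP[m Hm ->]; have := @E_list d [::] m Hm.
rewrite /ev big_nil mulr1 -/(sph m) => -[a [Wa Ga] [g Gg gE]].
exists a => //; exists (sph g); last first.
  have : sph (sph m - a) = sph ((v - 1) *: g) by rewrite gE.
  have sa : sph a = a by rewrite /sph W_Sl // W_Sr.
  have ss : sph (sph m) = sph m.
    by rewrite /sph !mulrA SeS -(mulrA _ S S) SeS.
  by rewrite sphB sphZ sa ss => <-; rewrite addrC subrK.
case: Gg => c Oc ->; exists c => //; rewrite size_map sph_sum.
apply: eq_big_nat => i /andP[_ Hi]; rewrite sphZ; congr (_ *: _).
by rewrite (nth_map 0).
Qed.

Lemma W_G d z : G d z -> W (sph z).
Proof.
case=> c Oc ->; rewrite big_mkord sph_sum; apply: big_ind => // i _.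
by rewrite sphZ; apply/WZ/(W_word (d := d))/mem_nth.
Qed.
End Filtration.

(** * The local ring at v = 1 *)

Lemma sub_mul_div (K : fieldType) (x y z : K) : y != 0 ->
  1 - z * (x / y) = (y - z * x) / y.
Proof. by move=> y0; rewrite mulrBl mulfV // mulrA. Qed.

Section LocalRing.

Variable C : fieldType.
Hypothesis C_char0 : forall n, (0 < n)%N -> (n%:R : C) != 0.

Variables (F : fieldType) (tf : {rmorphism {poly {poly C}} -> F}).
Hypothesis tf_eq0 : forall p, (tf p == 0) = (p == 0).
Local Notation q := (tf ('X%:P)).
Local Notation v := (tf 'X).

(** The rational functions that are regular at v = 1, for generic q. *)
Definition regular_at_one (c : F) : Prop :=
  exists f g : {poly {poly C}}, g.[1] != 0 /\ c = tf f / tf g.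

Local Notation O := regular_at_one.

Let nz (g : {poly {poly C}}) : g.[1] != 0 -> tf g != 0.
Proof. by move=> g1; rewrite tf_eq0; apply: contraNneq g1 => ->; rewrite horner0. Qed.

Lemma regular_poly f : O (tf f).
Proof. by exists f, 1; rewrite hornerC oner_eq0 rmorph1 divr1. Qed.

Lemma regular_inv f : f.[1] != 0 -> tf f != 0 /\ O (tf f)^-1.
Proof.
by move=> f1; split; [exact: nz|exists 1, f; rewrite rmorph1 div1r].
Qed.

Lemma regularD a b : O a -> O b -> O (a + b).
Proof.
move=> [f [g [g1 ->]]] [f' [g' [g'1 ->]]].
exists (f * g' + f' * g), (g * g'); rewrite hornerM mulf_neq0 //; split=> //.
by rewrite rmorphD !rmorphM; apply: addf_div; exact: nz.
Qed.

Lemma regularN a : O a -> O (- a).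
Proof.
by move=> [f [g [g1 ->]]]; exists (- f), g; rewrite rmorphN mulNr.
Qed.

Lemma regularM a b : O a -> O b -> O (a * b).
Proof.
move=> [f [g [g1 ->]]] [f' [g' [g'1 ->]]].
exists (f * f'), (g * g'); rewrite hornerM mulf_neq0 //; split=> //.
by rewrite !rmorphM; exact: mulf_div.
Qed.

Let nat_neq0 n : (0 < n)%N -> (n%:R : {poly C}) != 0.
Proof. by move=> n0; rewrite -polyC_natr polyC_eq0 C_char0. Qed.

Let X_neq0 : ('X : {poly C}) != 0. Proof. by rewrite polyX_eq0. Qed.

Let q_neq0 : q != 0.
Proof. by rewrite tf_eq0 polyC_eq0 polyX_eq0. Qed.

Let qpow_pos n : (0 < n)%N -> q ^+ n - 1 != 0 /\ O (q ^+ n - 1)^-1.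
Proof.
move=> n0; have -> : q ^+ n - 1 = tf (('X^n - 1)%:P).
  by rewrite polyCB rmorphB rmorph1 /= !rmorphXn.
by apply: regular_inv; rewrite hornerC; rewrite monic_neq0 // (monicXnsubC 1 n0).
Qed.

Lemma generic_regular : generic_at_one q v O.
Proof.
split.
- by rewrite -(rmorph1 tf); exact: regular_poly.
- exact: regularD.
- exact: regularN.
- exact: regularM.
- move=> _ [f [g [g1 ->]]]; have g0 := nz g1.
  have -> : 1 - (v - 1) * (tf f / tf g) = tf (g - ('X - 1) * f) / tf g.
    by rewrite rmorphB rmorphM rmorphB rmorph1; exact: sub_mul_div.
  rewrite mulf_neq0 ?invr_eq0 //; apply: nz.
  by rewrite hornerD hornerN hornerM hornerD hornerN hornerX hornerC subrr mul0r subr0.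
- exact: regular_poly.
- by apply: (proj2 (regular_inv _)); rewrite hornerX oner_eq0.
- exact: regular_poly.
- by apply: (proj2 (regular_inv _)); rewrite hornerC.
- case=> n n0; first by apply: qpow_pos; rewrite lt0n; apply: contra n0 => /eqP ->.
  have [p1 p2] := @qpow_pos n.+1 isT; rewrite NegzE -exprnN.
  have -> : q ^- n.+1 - 1 = - (q ^- n.+1 * (q ^+ n.+1 - 1)).
    by rewrite mulrBr mulr1 mulVf ?expf_neq0 // opprB.
  rewrite oppr_eq0 mulf_neq0 ?invr_eq0 ?expf_neq0 //; split=> //.
  rewrite invrN invfM invrK; apply: regularN; apply: regularM => //.
  by rewrite -(rmorphXn tf); exact: regular_poly.
- move=> n n0; have -> : qnum v n = tf (\sum_(0 <= k < n) 'X^(2 * k)).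
    by rewrite rmorph_sum; apply: eq_bigr => k _; rewrite /= rmorphXn.
  apply: regular_inv; rewrite horner_sum.
  under eq_bigr => k _ do rewrite hornerXn expr1n.
  by rewrite sumr_const_nat subn0; exact: nat_neq0.
move=> n n0; rewrite -(rmorph_nat tf); apply: regular_inv.
by rewrite -polyC_natr hornerC; exact: nat_neq0.
Qed.

Lemma gpoly_generic : (gpoly q (v ^- 2)).[1] != 0.
Proof.
rewrite /gpoly !hornerM !hornerXsubC invrK !mulf_neq0 //.
- have [] := qpow_pos (n := 1) isT; rewrite expr1 => + _.
  by rewrite -opprB oppr_eq0.
- have -> : 1 - q^-1 * v ^+ 2 = q^-1 * tf ('X%:P - 'X^2).
    by rewrite rmorphB rmorphXn mulrBr mulVf.
  rewrite mulf_neq0 ?invr_eq0 // tf_eq0.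
  apply: contraNneq X_neq0 => /(congr1 (fun p => p.[0])).
  by rewrite hornerD hornerN hornerXn hornerC expr0n subr0 horner0 => ->.
have v0 : v != 0 by rewrite tf_eq0 polyX_eq0.
have -> : 1 - v ^- 2 = v ^- 2 * tf ('X^2 - 1).
  by rewrite rmorphB rmorphXn rmorph1 mulrBr mulr1 mulVf ?expf_neq0.
rewrite mulf_neq0 ?invr_eq0 ?expf_neq0 // tf_eq0 monic_neq0 //.
exact: (monicXnsubC 1 (isT : 0 < 2)%N).
Qed.

Lemma v2_generic : v ^+ 2 - 1 != 0.
Proof.
rewrite -(rmorphXn tf) -(rmorph1 tf) -rmorphB tf_eq0 monic_neq0 //.
exact: (monicXnsubC 1 (isT : 0 < 2)%N).
Qed.

End LocalRing.

(** * The generators of the double affine Hecke algebra *)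

Section AlgebraHom.

Variables (K : fieldType) (B : lalgType K) (A0 : pzalg K) (pi : B -> kalg A0).

Record alg_hom : Prop := AlgHom {
  homD : forall a b, pi (a + b) = pi a + pi b;
  homZ : forall c a, pi (c *: a) = c *: pi a;
  homM : forall a b, pi (a * b) = pi a * pi b;
  hom1 : pi 1 = 1
}.

Hypothesis H : alg_hom.

Lemma homN a : pi (- a) = - pi a.
Proof. by rewrite -scaleN1r (homZ H) scaleN1r. Qed.

Lemma hom0 : pi 0 = 0.
Proof. by rewrite -(scale0r 0) (homZ H) scale0r. Qed.

Lemma hom_prod (I : Type) (r : seq I) (F : I -> B) :
  pi (\prod_(i <- r) F i) = \prod_(i <- r) pi (F i).
Proof. exact: (big_morph pi (homM H) (hom1 H)). Qed.

Lemma hom_sum (I : Type) (r : seq I) (F : I -> B) :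
  pi (\sum_(i <- r) F i) = \sum_(i <- r) pi (F i).
Proof. exact: (big_morph pi (homD H) hom0). Qed.

Lemma hom_m1 a b : pi (a * b) = pi 1 -> pi a * pi b = 1.
Proof. by rewrite (homM H) (hom1 H). Qed.

Lemma hom_quad a c d : pi ((a + c *: 1) * (a - d *: 1)) = pi 0 ->
  (pi a + c *: (1 : kalg A0)) * (pi a - d *: (1 : kalg A0)) = 0.
Proof. by rewrite (homM H) !(homD H) homN !(homZ H) (hom1 H) hom0. Qed.

Lemma hom_m2 a b c d : pi (a * b) = pi (c * d) -> pi a * pi b = pi c * pi d.
Proof. by rewrite !(homM H). Qed.

Lemma hom_m3 a b c d e f : pi (a * b * c) = pi (d * e * f) ->
  pi a * pi b * pi c = pi d * pi e * pi f.
Proof. by rewrite !(homM H). Qed.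

Lemma hom_m31 a b c d : pi (a * b * c) = pi d -> pi a * pi b * pi c = pi d.
Proof. by rewrite !(homM H). Qed.

Lemma hom_yx a p c : pi (a * p) = pi (c *: (p * a)) ->
  pi a * pi p = c *: (pi p * pi a).
Proof. by rewrite (homZ H) !(homM H). Qed.

Lemma hom_xy a b c : pi (a * b) = pi (b * a * c ^+ 2) ->
  pi a * pi b = pi b * pi a * pi c ^+ 2.
Proof. by rewrite !expr2 !(homM H). Qed.

End AlgebraHom.

(** The presented algebra enters only through a homomorphism [pi] from the free
    algebra that respects the relations. *)
Section DahaGenerators.

Variables (K : fieldType) (q v : K) (N : nat) (A0 : pzalg K).
Local Notation A := (kalg A0).
Variable pi : free_alg K (daha_gen N) -> A.
Hypotheses (Hpi : alg_hom pi)
  (pi_rel : forall a b, daha_rel q v a b -> pi a = pi b).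
Hypotheses (N_gt0 : (0 < N)%N) (v_neq0 : v != 0) (q_neq0 : q != 0).

Let gen (g : daha_gen N) : A := pi (free_gen K g).

(** Families indexed by the natural numbers, with value 1 out of bounds. *)
Let family n (g : 'I_n -> daha_gen N) (i : nat) : A :=
  oapp (fun k : 'I_n => gen (g k)) 1 (insub i).

Let familyE n (g : 'I_n -> daha_gen N) (k : 'I_n) : family g k = gen (g k).
Proof. by rewrite /family valK. Qed.

Definition daha_t := family (@HT N).
Definition daha_ti := family (@HTV N).
Definition daha_x := family (@HX N).
Definition daha_xi := family (@HXV N).
Definition daha_y := family (@HY N).
Definition daha_yi := family (@HYV N).

Lemma daha_tE (k : 'I_N.-1) : daha_t k = pi (free_gen K (HT k)).
Proof. exact: familyE. Qed.

Let inv_gen g : gen (g, false) * gen (g, true) = 1 /\ gen (g, true) * gen (g, false) = 1.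
Proof.
split; first exact (hom_m1 Hpi (pi_rel (@Hinvr K q v N g))).
exact (hom_m1 Hpi (pi_rel (@Hinvl K q v N g))).
Qed.

Let ordP n (Q : nat -> Prop) : (forall k : 'I_n, Q k) -> forall i, (i < n)%N -> Q i.
Proof. by move=> H i Hi; exact: (H (Ordinal Hi)). Qed.

Let ordP1 (Q : nat -> Prop) : (forall k : 'I_N.-1, Q k) ->
  forall i, (i.+1 < N)%N -> Q i.
Proof. by move=> H i Hi; apply: (ordP H); lia. Qed.

Let tE (k : 'I_N.-1) : daha_t k = gen (HT k) := familyE _ k.
Let tiE (k : 'I_N.-1) : daha_ti k = gen (HTV k) := familyE _ k.
Let xE (k : 'I_N) : daha_x k = gen (HX k) := familyE _ k.
Let xiE (k : 'I_N) : daha_xi k = gen (HXV k) := familyE _ k.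
Let yE (k : 'I_N) : daha_y k = gen (HY k) := familyE _ k.
Let yiE (k : 'I_N) : daha_yi k = gen (HYV k) := familyE _ k.

Let xE1 (k : 'I_N.-1) : daha_x k = gen (HX (fst_idx k)) := xE (fst_idx k).
Let xE2 (k : 'I_N.-1) : daha_x k.+1 = gen (HX (snd_idx k)) := xE (snd_idx k).
Let yE1 (k : 'I_N.-1) : daha_y k = gen (HY (fst_idx k)) := yE (fst_idx k).
Let yE2 (k : 'I_N.-1) : daha_y k.+1 = gen (HY (snd_idx k)) := yE (snd_idx k).

Lemma daha_familyP :
  daha_family q v N daha_t daha_ti daha_x daha_xi daha_y daha_yi.
Proof.
split=> //.
- by apply: ordP1 => k; rewrite tE tiE; case: (inv_gen (inl (inl k))).
- by apply: ordP1 => k; rewrite tE tiE; case: (inv_gen (inl (inl k))).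
- by apply: ordP => k; rewrite xE xiE; case: (inv_gen (inl (inr k))).
- by apply: ordP => k; rewrite xE xiE; case: (inv_gen (inl (inr k))).
- by apply: ordP => k; rewrite yE yiE; case: (inv_gen (inr k)).
- by apply: ordP => k; rewrite yE yiE; case: (inv_gen (inr k)).
- apply: ordP1 => k; rewrite tE.
  exact (hom_quad Hpi (pi_rel (@Hquad K q v N k))).
- move=> i Hi; have [H1 H2] : (i < N.-1)%N /\ (i.+1 < N.-1)%N by lia.
  rewrite (tE (Ordinal H1)) (tE (Ordinal H2)).
  exact (hom_m3 Hpi (pi_rel (@Hbraid K q v N (Ordinal H1) (Ordinal H2) erefl))).
- move=> i k ik Hk; have [H1 H2] : (i < N.-1)%N /\ (k < N.-1)%N by lia.
  have H3 : (i.+1 < k)%N || (k.+1 < i)%N by rewrite ik.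
  rewrite (tE (Ordinal H1)) (tE (Ordinal H2)).
  exact (hom_m2 Hpi (pi_rel (@Hcomm K q v N (Ordinal H1) (Ordinal H2) H3))).
- move=> j k Hj Hk; rewrite (xE (Ordinal Hj)) (xE (Ordinal Hk)).
  exact (hom_m2 Hpi (pi_rel (@HXX K q v N (Ordinal Hj) (Ordinal Hk)))).
- move=> j k Hj Hk; rewrite (yE (Ordinal Hj)) (yE (Ordinal Hk)).
  exact (hom_m2 Hpi (pi_rel (@HYY K q v N (Ordinal Hj) (Ordinal Hk)))).
- apply: ordP1 => k; rewrite tE xE1 xE2.
  exact (hom_m31 Hpi (pi_rel (@HTX K q v N k))).
- apply: ordP1 => k; rewrite tiE yE1 yE2.
  exact (hom_m31 Hpi (pi_rel (@HTY K q v N k))).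
- move=> i k Hi Hk n1 n2; have H1 : (i < N.-1)%N by lia.
  rewrite (tE (Ordinal H1)) (xE (Ordinal Hk)).
  exact (hom_m2 Hpi (pi_rel (@HTXc K q v N (Ordinal H1) (Ordinal Hk) n1 n2))).
- move=> i k Hi Hk n1 n2; have H1 : (i < N.-1)%N by lia.
  rewrite (tE (Ordinal H1)) (yE (Ordinal Hk)).
  exact (hom_m2 Hpi (pi_rel (@HTYc K q v N (Ordinal H1) (Ordinal Hk) n1 n2))).
- have -> : \prod_(0 <= j < N) daha_x j = pi (\prod_(j < N) free_gen K (HX j)).
    rewrite big_mkord (hom_prod Hpi); apply: eq_bigr => j _.
    exact: xE.
  rewrite (yE (Ordinal N_gt0)).
  exact (hom_yx Hpi (pi_rel (@HYX K q v N (Ordinal N_gt0) erefl))).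
move=> N1; have H1 : (0 < N.-1)%N by lia.
rewrite (xiE (fst_idx (Ordinal H1))) (tiE (Ordinal H1)) (yE2 (Ordinal H1)).
exact (hom_xy Hpi (pi_rel (@HXY K q v N (Ordinal H1) erefl))).
Qed.

Lemma free_alg_ind (Q : A -> Prop) : Q 0 -> (forall a b, Q a -> Q b -> Q (a + b)) ->
  (forall c a, Q a -> Q (c *: a)) ->
  (forall s : seq (daha_gen N), Q (\prod_(g <- s) gen g)) -> forall z, Q (pi z).
Proof.
move=> Q0 QD QZ QP z; rewrite [z]monalgE (hom_sum Hpi).
apply: big_ind => // k _.
have -> : << z@_k *g k >> = z@_k *: << k >> :> free_alg K (daha_gen N).
  by apply/malgP => k'; rewrite mcoeffZ !mcoeffU mulrnAr mulr1.
rewrite (homZ Hpi); apply: (QZ).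
have -> : << k >> = \prod_(g <- fmonom_val k) free_gen K g.
  case: k => s /=; elim: s => [|g s IH].
    by rewrite big_nil (_ : FMonom [::] = fmone _) // /fmone fmE.
  rewrite big_cons -IH /free_gen malgM_def fgmulUU mulr1.
  by rewrite (_ : FMonom (g :: s) = fmmul (fmu g) (FMonom s)) // /fmmul /fmu !fmE.
by rewrite (hom_prod Hpi).
Qed.

Variable O : K -> Prop.
Hypothesis HO : generic_at_one q v O.

Local Notation G := (G N daha_t daha_x daha_xi daha_y daha_yi O).

Lemma G_daha_gen g : G 1 (gen g).
Proof.
have D := daha_familyP.
case: g => [[[k|j]|j] []].
- rewrite -[gen _]/(gen (HTV k)) -tiE; apply: (GS HO (d := 0)).
  exact (G_ti1 D HO (ltn_ord (snd_idx k))).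
- rewrite -[gen _]/(gen (HT k)) -tE; apply: (GS HO (d := 0)).
  exact (G_t1 D HO (ltn_ord (snd_idx k))).
- rewrite -[gen _]/(gen (HXV j)) -xiE; exact (G_letter _ _ _ _ _ HO ((false, true), j)).
- rewrite -[gen _]/(gen (HX j)) -xE; exact (G_letter _ _ _ _ _ HO ((false, false), j)).
- rewrite -[gen _]/(gen (HYV j)) -yiE; exact (G_letter _ _ _ _ _ HO ((true, true), j)).
rewrite -[gen _]/(gen (HY j)) -yE; exact (G_letter _ _ _ _ _ HO ((true, false), j)).
Qed.

Lemma G_daha_prod (s : seq (daha_gen N)) : G (size s) (\prod_(g <- s) gen g).
Proof.
elim: s => [|g s IH]; first by rewrite big_nil; exact (G_1 N _ _ _ _ _ HO 0).
by rewrite big_cons; exact (GM daha_familyP HO (G_daha_gen g) IH).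
Qed.

End DahaGenerators.

(** * The homomorphism and its image *)

Section Surjection.

Variables (K : fieldType) (q v : K) (N : nat) (A0 : pzalg K).
Local Notation A := (kalg A0).
Variable pi : free_alg K (daha_gen N) -> A.
Hypotheses (Hpi : alg_hom pi)
  (pi_rel : forall a b, daha_rel q v a b -> pi a = pi b)
  (pi_surj : forall h, exists z, pi z = h).
Hypotheses (N_gt0 : (0 < N)%N) (v_neq0 : v != 0) (q_neq0 : q != 0).
Variable O : K -> Prop.
Hypotheses (HO : generic_at_one q v O) (g11_neq0 : (gpoly q (v ^- 2)).[1] != 0).

Let D := daha_familyP Hpi pi_rel N_gt0 v_neq0 q_neq0.
Local Notation t := (daha_t pi).
Local Notation x := (daha_x pi).
Local Notation xi := (daha_xi pi).
Local Notation y := (daha_y pi).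
Local Notation yi := (daha_yi pi).

Definition spherical_unit : A := (poincare v N)^-1 *: hecke_sum v N t.
Local Notation S := spherical_unit.

Let poincare_neq0 : poincare v N != 0.
Proof.
rewrite /poincare prodf_seq_neq0; apply/allP => i; rewrite mem_index_iota => /andP[i0 _].
by have [-> _] := lr_qnum HO i0.
Qed.

Let O1 : O 1 := lr1 HO.
Let OM a b : O a -> O b -> O (a * b). Proof. exact (@lrM _ _ _ _ HO a b). Qed.

Let O_poincareV : O (poincare v N)^-1.
Proof.
rewrite /poincare big_seq -prodfV; apply: O_prod => // i; rewrite mem_index_iota => /andP[i0 _].
by case: (lr_qnum HO i0).
Qed.

Let SS : symmetrizer v N t S := hecke_symmetrizer D poincare_neq0.

Let G_S : G N t x xi y yi O 0 S.
Proof.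
rewrite /spherical_unit /hecke_sum; apply: (GZ HO) => //.
apply: (G_sum HO) => w _; apply: (GZ HO).
  by apply: O_exp => //; exact (lr_v HO).
exact (G_hecke t x xi y yi HO w).
Qed.

Let qN_neq0 : qnum v N != 0 := proj1 (lr_qnum HO N_gt0).
Let two_neq0 : (2 : K) != 0 := proj1 (lr_nat HO (isT : 0 < 2)%N).
Let q_gen (l : int) : l != 0 -> q ^ l != 1.
Proof. by move=> l0; have [+ _] := lr_qpow HO l0; rewrite subr_eq0. Qed.

Let im := qgl_image q v N x xi y yi S.
Let SeS := S_S SS.
Let Sim c : S * im c = im c := qgl_image_idl q x xi y yi SS c.
Let imS c : im c * S = im c := qgl_image_idr q x xi y yi SS c.
Let rel_ev := qgl_rel_eval D SS qN_neq0 two_neq0 q_gen g11_neq0.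

Definition qgl_hom : quantum_gl q (v ^- 2) -> A :=
  @presented_eval K qgl_gen A0 S im (qgl_rel q (v ^- 2)).

Lemma qgl_hom_linear c : {morph qgl_hom : a b / c *: a + b}.
Proof. exact (presented_eval_linear SeS Sim imS rel_ev c). Qed.

Lemma qgl_homM : {morph qgl_hom : a b / a * b}.
Proof. exact (presented_evalM SeS Sim imS rel_ev). Qed.

Lemma qgl_hom1 : qgl_hom 1 = S.
Proof. exact (presented_eval1 SeS Sim imS rel_ev). Qed.

Let W (a : A) : Prop := exists z, qgl_hom z = a.

Let W0 : W 0.
Proof.
pose u : quantum_gl q (v ^- 2) := 1.
have /= E := qgl_hom_linear (-1) u u; exists (-1 *: u + u).
by rewrite E scaleN1r addNr.
Qed.

Let WD a b : W a -> W b -> W (a + b).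
Proof.
move=> [z <-] [z' <-]; have /= E := qgl_hom_linear 1 z z'; exists (1 *: z + z').
by rewrite E scale1r.
Qed.

Let WZ c a : W a -> W (c *: a).
Proof.
move=> [z <-]; have [z0 E0] := W0; have /= E := qgl_hom_linear c z z0.
by exists (c *: z + z0); rewrite E E0 addr0.
Qed.

Let WM a b : W a -> W b -> W (a * b).
Proof. by move=> [z <-] [z' <-]; exists (z * z'); exact: qgl_homM. Qed.

Let W_gen c : W (im c).
Proof. by eexists; exact (presented_eval_gen SeS Sim imS rel_ev c). Qed.

Let W_f m : W (curf x xi y S m).
Proof.
have := WZ (f_scale q v N)^-1 (W_gen (QF m)).
rewrite /im /= /scaled_curf scalerA mulVf ?scale1r //.
exact (f_scale_neq0 D qN_neq0 q_gen).
Qed.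

Let W_Sl a : W a -> S * a = a.
Proof. by move=> [z <-]; exact (corner_eval_idl SeS Sim imS _). Qed.

Let W_Sr a : W a -> a * S = a.
Proof. by move=> [z <-]; exact (corner_eval_idr SeS Sim imS _). Qed.

Lemma qgl_hom_spherical z : S * qgl_hom z * S = qgl_hom z.
Proof. by rewrite W_Sl ?W_Sr //; exists z. Qed.

(** The image W is a subspace closed under products and contains the currents,
    so that [W_G] applies to it. *)
Lemma qgl_hom_surj h : exists z, qgl_hom z = S * h * S.
Proof.
have [z <-] := pi_surj h.
have W_S : W S by exists 1; exact: qgl_hom1.
apply: (@free_alg_ind _ _ _ pi Hpi (fun a => W (S * a * S))).
- by rewrite mulr0 mul0r.
- by move=> a b Wa Wb; rewrite mulrDr mulrDl; exact: WD.
- by move=> c a Wa; rewrite -(scaleAr c S a) -(scaleAl c (S * a)); exact: WZ.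
move=> s; apply: (W_G D HO SS G_S W0 WD WZ WM W_S (fun m => W_gen (QE m)) W_f W_Sl W_Sr).
exact (G_daha_prod Hpi pi_rel N_gt0 v_neq0 q_neq0 HO s).
Qed.

End Surjection.

Lemma linear_of_morph (K : fieldType) (U V : lmodType K) (f : U -> V) :
  (forall c, {morph f : a b / c *: a + b}) -> exists g : {linear U -> V}, g =1 f.
Proof.
move=> fL; pose fP := GRing.isLinear.Build K U V *:%R f fL.
pose g : {linear U -> V} := HB.pack_for {linear U -> V} f fP.
by exists g.
Qed.

Definition presented_alg (K : fieldType) (I : choiceType)
    (rel : free_alg K I -> free_alg K I -> Prop) : pzalg K :=
  @PzAlg K (presented rel) (@presented_scale K I rel)
    (@presented_scaleA K I rel) (@presented_scale1 K I rel)
    (@presented_scaleDr K I rel) (@presented_scaleDl K I rel)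
    (@presented_scalerAl K I rel) (@presented_scalerAr K I rel).

Lemma presented_hom (K : fieldType) (I : choiceType)
    (rel : free_alg K I -> free_alg K I -> Prop) :
  alg_hom (presented_pi rel : free_alg K I -> kalg (presented_alg rel)).
Proof.
(* The operations of the two structures on the quotient are the same terms. *)
refine (@AlgHom K _ (presented_alg rel) (presented_pi rel) _ _ _ (erefl _)).
- exact (fun a b => raddfD (presented_pi rel) a b).
- exact (@presented_pi_scale K I rel).
exact (@presented_pi_mul K I rel).
Qed.

Section Units.

Variables (K : fieldType) (q v : K) (N : nat).
Hypothesis v2_neq1 : v ^+ 2 - 1 != 0.

Lemma qintE i : qint v i = qnum v i.
Proof. by rewrite /qint qnum_geom addrAC subrr add0r mulrC mulKf. Qed.

Lemma qfactE : qfact v N = poincare v N.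
Proof. by apply: eq_bigr => i _; exact: qintE. Qed.

Local Notation A0 := (presented_alg (@daha_rel K q v N)).

(** Up to [perm_lengthE] and [qfactE] the two sides are the same term. *)
Lemma daha_S_unit : daha_S q v N =
  spherical_unit v (presented_pi (@daha_rel K q v N) : _ -> kalg A0).
Proof.
pose A := kalg A0.
pose pi : _ -> A := presented_pi (@daha_rel K q v N).
have E (w : 'S_N) : v ^+ perm_length w *: (\prod_(i <- reduced_word w) pi (free_gen K (HT i)) : A)
   = v ^+ inversions w *: (\prod_(i <- reduced_word w) daha_t pi i : A).
  rewrite perm_lengthE; congr (_ *: _).
  by apply: eq_bigr => i _; rewrite daha_tE.
rewrite /spherical_unit -qfactE.
rewrite /hecke_sum /hecke_T.
rewrite -(eq_bigr _ (fun w _ => E w)).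
exact (erefl _).
Qed.

End Units.

Theorem theorem5p4 (R : realType) (N : nat) (hN : (0 < N)%N) :
  let q := var_q R in
  let v := var_v R in
  let S := daha_S q v N in
  exists phi : {linear quantum_gl q (v ^- 2) -> daha q v N},
    [/\ phi 1 = S,
        {morph phi : x y / x * y} &
        range phi = spherical_daha q v N].
Proof.
have C0 n : (0 < n)%N -> (n%:R : R[i]) != 0 by rewrite pnatr_eq0 -lt0n.
pose tf : {rmorphism {poly {poly R[i]}} -> Cqv R} := @tofrac {poly {poly R[i]}}.
have tf0 : forall p, (tf p == 0) = (p == 0) by exact: tofrac_eq0.
have HO : generic_at_one (var_q R) (var_v R) (regular_at_one tf).
  exact (generic_regular C0 tf0).
have g11 : (gpoly (var_q R) (var_v R ^- 2)).[1] != 0.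
  exact (gpoly_generic tf0).
have v0 : var_v R != 0 by rewrite tofrac_eq0 polyX_eq0.
have q0 : var_q R != 0 by rewrite tofrac_eq0 polyC_eq0 polyX_eq0.
have v2 : var_v R ^+ 2 - 1 != 0.
  exact (v2_generic tf0).
move: (Cqv R) (var_q R) (var_v R) (regular_at_one tf) HO g11 v0 q0 v2.
move=> K q v O HO g11 v0 q0 v2 /=.
pose rel := @daha_rel K q v N.
pose pi : free_alg K (daha_gen N) -> kalg (presented_alg rel) := presented_pi rel.
have Hpi : alg_hom pi := presented_hom rel.
have pi_rel a b : rel a b -> pi a = pi b by exact: presented_rel.
have pi_surj h : exists z, pi z = h by exists (generic_quotient.repr h); exact: presented_pi_repr.
have SE : daha_S q v N = spherical_unit v pi := daha_S_unit q N v2.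
have [phi phiE] := linear_of_morph (U := quantum_gl q (v ^- 2)) (V := daha q v N)
  (qgl_hom_linear Hpi pi_rel hN v0 q0 HO g11).
exists phi; split.
- rewrite phiE SE; exact (qgl_hom1 Hpi pi_rel hN v0 q0 HO g11).
- move=> a b; rewrite !phiE; exact (qgl_homM Hpi pi_rel hN v0 q0 HO g11 a b).
apply/seteqP; split=> [_ [z _ <-]|_ [h _ <-]].
  apply: (ex_intro2 _ _ (phi z) I); rewrite SE phiE.
  exact (qgl_hom_spherical Hpi pi_rel hN v0 q0 HO z).
have [z zE] := qgl_hom_surj Hpi pi_rel pi_surj hN v0 q0 HO g11 h.
apply: (ex_intro2 _ _ z I); rewrite phiE SE; exact zE.
Qed.
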